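(* Let $s\ge 2$ be an integer, and let $X$ and $Y$ be two connected graphs of order $n$, at least one of which is non-bipartite. Suppose $Y\notin\{C_n,\theta_0\}$ (up to isomorphism) and $\Delta(X)+\kappa(Y)\ge n+s-1$. Then $\mathrm{FS}(X,Y)$ is $s$-connected.
   Context: All graphs are finite and simple; the order of a graph is its number of vertices. For two graphs $X,Y$ of the same order $n$, the friends-and-strangers graph $\mathrm{FS}(X,Y)$ has as vertices all bijections $\sigma:V(X)\to V(Y)$; two bijections $\sigma,\sigma'$ are adjacent if and only if there are distinct $a,b\in V(X)$ with $ab\in E(X)$, $\sigma(a)\sigma(b)\in E(Y)$, $\sigma(a)=\sigma'(b)$, $\sigma(b)=\sigma'(a)$, and $\sigma(c)=\sigma'(c)$ for all $c\in V(X)\setminus\{a,b\}$. $\Delta(G)$ is the maximum degree of $G$. A graph $G$ is $s$-connected if it has more than $s$ vertices and removing any $s-1$ vertices leaves a connected graph; $\kappa(G)$ (vertex connectivity) is the maximum $s$ for which $G$ is $s$-connected (so $\kappa(K_n)=n-1$). $C_n$ is the cycle of order $n$. $\theta_0$ is the graph of order 7 obtained from a 6-cycle by adding one new vertex adjacent to exactly two opposite (distance 3) vertices of the cycle. *)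

(* Defs.v *)
From mathcomp Require Import all_boot.

Set Implicit Arguments.
Unset Strict Implicit.
Unset Printing Implicit Defensive.

Record sgraph := SGraph {
  vertex :> finType;
  edge : rel vertex;
  edge_sym : symmetric edge;
  edge_irr : irreflexive edge }.

Definition isomorphic (G H : sgraph) : Prop :=
  exists f : G -> H, bijective f /\ forall x y, edge (f x) (f y) = edge x y.

Definition bipartite (G : sgraph) : Prop :=
  exists c : G -> bool, forall x y, edge x y -> c x != c y.

Definition connected (G : sgraph) : bool :=
  [forall x : G, forall y : G, connect (@edge G) x y].

Definition max_degree (G : sgraph) : nat :=
  \max_(x : G) #|[set y : G | edge x y]|.

Section Deletion.
Variables (G : sgraph) (S : {set G}).

Definition del_edge : rel {x : G | x \notin S} :=
  fun x y => edge (val x) (val y).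

Fact del_edge_sym : symmetric del_edge.
Proof. by move=> x y; apply: edge_sym. Qed.

Fact del_edge_irr : irreflexive del_edge.
Proof. by move=> x; apply: edge_irr. Qed.

Definition del : sgraph := SGraph del_edge_sym del_edge_irr.
End Deletion.

(* Writing |S| = s - 1 as |S|.+1 = s makes the condition on S vacuous at
   s = 0, so that every nonempty graph is 0-connected. *)
Definition s_connected (G : sgraph) (s : nat) : bool :=
  (s < #|G|) && [forall S : {set G}, (#|S|.+1 == s) ==> connected (del S)].

(* The range s < #|G| loses nothing, as s-connected graphs have order > s. *)
Definition kappa (G : sgraph) : nat :=
  \max_(s < #|G| | s_connected G s) s.

Section Cycle.
Variable n : nat.

Definition cycle_edge : rel 'I_n := fun i j =>
  (i != j) && ((j == i.+1 %% n :> nat) || (i == j.+1 %% n :> nat)).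

Fact cycle_edge_sym : symmetric cycle_edge.
Proof. by move=> i j; rewrite /cycle_edge eq_sym orbC. Qed.

Fact cycle_edge_irr : irreflexive cycle_edge.
Proof. by move=> i; rewrite /cycle_edge eqxx. Qed.

(* The cycle C_n when 3 <= n; for n <= 2 it is the complete graph. *)
Definition cycle_graph : sgraph := SGraph cycle_edge_sym cycle_edge_irr.
End Cycle.

(* None is the vertex added to the 6-cycle. *)
Definition theta0_edge : rel (option 'I_6) := fun u v =>
  match u, v with
  | Some i, Some j => cycle_edge i j
  | None, Some i | Some i, None => (i == 0 :> nat) || (i == 3 :> nat)
  | None, None => false
  end.

Fact theta0_edge_sym : symmetric theta0_edge.
Proof. by move=> [i|] [j|] //=; apply: cycle_edge_sym. Qed.

Fact theta0_edge_irr : irreflexive theta0_edge.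
Proof. by move=> [i|] //=; apply: cycle_edge_irr. Qed.

Definition theta0 : sgraph := SGraph theta0_edge_sym theta0_edge_irr.

Section FriendsAndStrangers.
Variables X Y : sgraph.

Definition bijb (f : {ffun X -> Y}) : bool :=
  injectiveb f && [forall y, exists x, f x == y].

Definition FS_edge : rel {f : {ffun X -> Y} | bijb f} := fun u v =>
  let f := val u in let g := val v in
  [exists a : X, exists b : X,
    [&& a != b, edge a b, edge (f a) (f b), f a == g b, f b == g a
      & [forall c : X, (c != a) && (c != b) ==> (f c == g c)]]].

Fact FS_edge_sym : symmetric FS_edge.
Proof.
suff imp u v : FS_edge u v -> FS_edge v u by move=> u v; apply/idP/idP; apply: imp.
case/existsP=> a /existsP[b /and5P[nab Xab Yab /eqP fa /andP[/eqP fb /forallP fc]]].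
apply/existsP; exists a; apply/existsP; exists b.
rewrite nab Xab -fa -fb edge_sym Yab !eqxx /=.
by apply/forallP=> c; apply/implyP=> /(implyP (fc c)); rewrite eq_sym.
Qed.

Fact FS_edge_irr : irreflexive FS_edge.
Proof.
move=> u; apply/negbTE/existsP=> -[a /existsP[b /and5P[_ _ Yab /eqP fab _]]].
by rewrite fab edge_irr in Yab.
Qed.

Definition FS : sgraph := SGraph FS_edge_sym FS_edge_irr.
End FriendsAndStrangers.

(* Main.v *)
Require Import Defs.
From mathcomp Require Import all_boot.
From mathcomp Require Import all_fingroup zify.

Set Implicit Arguments.
Unset Strict Implicit.
Unset Printing Implicit Defensive.

(** Let [c] be a vertex of [X] of maximum degree, [N] the set of its neighbours and [r] the number
of the remaining vertices. The hypothesis on degrees makes [Y] an [r + s]-connected graph. The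
vertex sets are identified by a bijection, so that a state is a permutation [p] taking each token
(vertex of [X]) to its position (vertex of [Y]), and a swap replaces [p] by [tperm a b * p]. The
token [c] acts as the blank of a sliding puzzle on [Y], in which the tokens of [N] slide.

Any two states are connected. The [r] tokens outside [c |: N] can be brought to prescribed positions
one after the other, since [Y] remains connected when fewer than [r + 2] positions are blocked
([placeable_all]); what remains is a permutation [g] of [N] ([reach_mod_star]). Now the [r] tokens
are frozen on a set [U] of positions, and the blank moves in [Y] without [U], a 2-connected graph.
By the theorem of Wilson ([wilson]) it brings about all even permutations, unless that graph is a
cycle or theta0. Both exceptions have two adjacent vertices of degree 2; by the connectivity of [Y]
these were adjacent to all of [U], which is impossible in a bipartite graph and otherwise produces a
triangle, with the help of which a better [U] is found ([bip_mobile], [nonbip_mobile_deletions]).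
For [r = 0] the exceptions are excluded by hypothesis. There remains the sign of [g]. If [Y] is not
bipartite, a closed walk of the blank of odd length changes it ([reach_nonbip]). If [Y] is
bipartite, then [X] is not. The sign, corrected by the colours of some positions, is invariant under
the swaps along the edges of a connected bipartite subgraph of [X]; these swaps connect all states
of the same parity, and any edge of [X] that breaks the bipartition connects the two classes
([reach_bip]).

The theorem of Wilson rests on a block argument: a maximal set of positions on which a group of
permutations has all 3-cycles is stable under each element which keeps one of its points in it
([alt3_block]). In a theta graph, a single 3-cycle of positions therefore spreads by the rotations
along its cycles ([alt3_two_cycles]), and from there along ears over the whole graph
([good_extend]). The rotations generate a 3-cycle in every simple theta graph but theta0
([theta_roles]), and theta0 with an ear contains another theta graph ([theta0_ear]).

For [s]-connectedness the deleted states are added one at a time ([swap_kconn]): the new one, [w],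
can be avoided if any two neighbours of [w] are joined without meeting [w] or the at most [s - 2]
states deleted before. A swap away from the blank commutes with almost all moves of the blank, which
provides enough detours to a neighbour obtained by moving the blank ([joined_to_star]). If the blank
can move from [w] to [y1] and to [y2], then it is led around a cycle of [Y] through its position,
[y1] and [y2]: this cycle of states passes through [w] once, between the two neighbours, and the
cycle of [Y] is chosen to miss the deleted states ([star_neighbours_connected]). *)

Local Open Scope group_scope.

(** * Cycles as products of transpositions along walks *)

Lemma map_next (T : eqType) (s : seq T) : uniq s -> map (next s) s = rot 1 s.
Proof.
move=> U; case: s U => [|x0 s0] //; set s := x0 :: s0 => U.
apply: (@eq_from_nth _ x0); first by rewrite size_map size_rot.
rewrite size_map => i hi; rewrite (nth_map x0) // next_nth mem_nth //.
rewrite /s rot1_cons nth_rcons index_uniq // -/s.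
by move: hi; rewrite ltnS; case: ltngtP => // h _; rewrite h nth_default.
Qed.

Section Walks.
Variable T : finType.
Implicit Types (x y z : T) (s : seq T) (p g : {perm T}).

Fixpoint walk y s : {perm T} :=
  if s is z :: s' then tperm y z * walk z s' else 1.

(** The inverse makes the cycle go forward: the tokens shift backward when the blank walks along
[s], see [cycE] and [cyc_closed_walk]. *)
Definition cyc s : {perm T} := if s is x :: s' then (walk x s')^-1 else 1.

Lemma walk_cat y s1 s2 : walk y (s1 ++ s2) = walk y s1 * walk (last y s1) s2.
Proof. by elim: s1 y => [|z s1 IH] y /=; rewrite ?mul1g // IH mulgA. Qed.

Lemma walk_last y s : walk y s y = last y s.
Proof.
by elim: s y => [|z s IH] y /=; rewrite ?perm1 // permM tpermL IH.
Qed.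

Lemma walk_out y s x : x \notin y :: s -> walk y s x = x.
Proof.
elim: s y => [|z s IH] y /=; rewrite ?perm1 // !inE !negb_or.
by case/and3P=> xy xz xs; rewrite permM tpermD 1?eq_sym // IH // inE negb_or xz.
Qed.

Lemma walk_stable (V : {set T}) y s x :
  y \in V -> {subset s <= V} -> x \in V -> walk y s x \in V.
Proof.
elim: s y x => [|z s IH] y x yV sV xV /=; first by rewrite perm1.
have zV : z \in V by apply: sV; rewrite mem_head.
rewrite permM; apply: IH => //; first by move=> t ts; apply: sV; rewrite inE ts orbT.
by case: tpermP => // ->.
Qed.

Lemma cyc_nil : cyc [::] = 1.
Proof. by []. Qed.

Lemma cyc_cons x s : cyc (x :: s) = (walk x s)^-1.
Proof. by []. Qed.

Lemma cyc_cons2 x y s : cyc (x :: y :: s) = cyc (y :: s) * tperm x y.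
Proof. by rewrite /= invMg tpermV. Qed.

Lemma cyc_conj s g : cyc s ^ g = cyc (map g s).
Proof.
case: s => [|x s]; first by rewrite conj1g.
rewrite /= conjVg; congr (_^-1).
by elim: s x => [|z s IH] x /=; rewrite ?conj1g // conjMg IH tpermJ.
Qed.

(** Conjugating the first transposition of the walk through the rest of it moves it to the end. *)
Lemma cyc_rcons x s : uniq (x :: s) -> cyc (rcons s x) = cyc (x :: s).
Proof.
case: s => [|z s] //= /andP[xzs Us]; congr (_^-1).
set g := walk z s.
have -> : tperm x z * g = g * tperm x z ^ g by rewrite conjgE mulKVg.
rewrite tpermJ -cats1 walk_cat -/g /= mulg1.
by rewrite /g walk_out // walk_last tpermC.
Qed.

Lemma cyc_rot n s : uniq s -> cyc (rot n s) = cyc s.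
Proof.
elim: n => [|n IH] Us; first by rewrite rot0.
case: (leqP (size s) n) => [h|h]; first by rewrite rot_oversize // ltnW.
have -> : rot n.+1 s = rot 1 (rot n s) by rewrite rotS.
have Ur : uniq (rot n s) by rewrite rot_uniq.
rewrite -IH //; case: (rot n s) Ur => [|x r] // Ur.
by rewrite rot1_cons cyc_rcons.
Qed.

Lemma cycE s x : uniq s -> cyc s x = next s x.
Proof.
move=> Us; case: (boolP (x \in s)) => xs; last first.
  rewrite next_nth (negbTE xs); case: s xs {Us} => [|y s] xs /=; first by rewrite perm1.
  by apply: (canLR (permK _)); rewrite walk_out.
case/rot_to: xs => i s' def_s.
have Us' : uniq (x :: s') by rewrite -def_s rot_uniq.
rewrite -(cyc_rot i Us) -(next_rot i Us) def_s.
case: s' Us' {def_s} => [|y s'] Us'; first by rewrite /= invg1 perm1 eqxx.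
rewrite cyc_cons2 permM /= eqxx.
suff -> : (walk y s')^-1 x = x by rewrite tpermL.
by apply: (canLR (permK _)); rewrite walk_out //; case/andP: Us'.
Qed.

Lemma cyc_out s x : x \notin s -> cyc s x = x.
Proof.
case: s => [|y s] xs /=; first by rewrite perm1.
by apply: (canLR (permK _)); rewrite walk_out.
Qed.

Lemma cyc_rev s : uniq s -> cyc (rev s) = (cyc s)^-1.
Proof.
move=> Us; apply/permP=> x; apply: (canRL (permK _)).
by rewrite !cycE ?rev_uniq // next_rev // next_prev.
Qed.

Lemma next_infix s1 x y s2 :
  uniq (s1 ++ x :: y :: s2) -> next (s1 ++ x :: y :: s2) x = y.
Proof.
move=> U; rewrite -(next_rot (size s1) U) rot_size_cat /=.
by rewrite eqxx.
Qed.

Lemma next_last x s : uniq (x :: s) -> next (x :: s) (last x s) = x.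
Proof.
case/lastP: s => [|s z] U; first by rewrite /= eqxx.
have U' : uniq (rcons (rcons s z) x) by rewrite -rot1_cons rot_uniq.
rewrite last_rcons -(next_rot 1 U) rot1_cons; move: U'.
by rewrite -!cats1 -catA; apply: next_infix.
Qed.

Lemma map_cyc s : uniq s -> map (cyc s) s = rot 1 s.
Proof. by move=> U; rewrite -map_next //; apply: eq_map => x; rewrite cycE. Qed.

Lemma perm_cyc3 (a b d : T) : uniq [:: a; b; d] ->
  [/\ cyc [:: a; b; d] a = b, cyc [:: a; b; d] b = d & cyc [:: a; b; d] d = a].
Proof.
move=> U; rewrite !cycE // /= !eqxx; move: U => /=.
rewrite !inE negb_or andbT eq_sym => /andP[/andP[/negbTE-> h2] /negbTE].
by rewrite eq_sym => h3; rewrite (eq_sym d) (negbTE h2) h3.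
Qed.

Lemma cyc_transitive s x y : uniq s -> x \in s -> y \in s ->
  exists k, (cyc s ^+ k) x = y.
Proof.
move=> U xs ys; have := fconnect_cycle (cycle_next U) xs y.
rewrite ys => /iter_findex <-; set k := findex _ _ _; exists k.
rewrite permX; elim: k => //= k ->; exact: cycE.
Qed.

Lemma cyc_closed s (D : {set T}) x : uniq s -> (forall z, z \in D -> cyc s z \in D) ->
  x \in s -> x \in D -> {subset s <= D}.
Proof.
move=> U cD xs xD y ys; have [k <-] := cyc_transitive U xs ys.
by rewrite permX; elim: k => //= k; apply: cD.
Qed.

End Walks.

Global Opaque cyc.

(** * Permutation groups containing 3-cycles *)

Section ThreeCycles.
Variable T : finType.
Implicit Types (x y z : T) (s : seq T) (p g : {perm T}) (D M : {set T}).

Lemma odd_cyc3 (a b d : T) : uniq [:: a; b; d] -> odd_perm (cyc [:: a; b; d]) = false.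
Proof.
rewrite /= !inE negb_or andbT => /andP[/andP[ab _] bd].
by rewrite cyc_cons /= mulg1 odd_permV odd_permM !odd_tperm ab bd.
Qed.

Lemma uniq3 (a b d : T) : uniq [:: a; b; d] = [&& a != b, a != d & b != d].
Proof. by rewrite /= !inE negb_or andbT andbA. Qed.

Lemma other_two M z : 2 < #|M| -> z \in M ->
  exists d1 d2, [/\ d1 \in M, d2 \in M & uniq [:: z; d1; d2]].
Proof.
move=> M2 zM; have : 1 < #|M :\ z| by rewrite (cardsD1 z) zM in M2.
case/card_gt1P=> d1 [d2 []]; rewrite !inE => /andP[h1 h2] /andP[h3 h4] h5.
by exists d1, d2; rewrite /= !inE negb_or ![z == _]eq_sym h1 h3 h5.
Qed.

Variable G : {group {perm T}}.

(** Stated on 3-cycles rather than on the alternating group of [D], so that [D] can grow by one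
3-cycle at a time; [alt3_even] recovers the even permutations. *)
Definition alt3 D :=
  [forall a in D, forall b in D, forall d in D,
     uniq [:: a; b; d] ==> (cyc [:: a; b; d] \in G)].

Lemma alt3P D :
  reflect (forall a b d, a \in D -> b \in D -> d \in D -> uniq [:: a; b; d] ->
             cyc [:: a; b; d] \in G) (alt3 D).
Proof.
apply: (iffP forall_inP) => [h a b d aD bD dD U|h a aD].
  by move/forall_inP: (h a aD) => /(_ b bD) /forall_inP /(_ d dD) /implyP; apply.
by apply/forall_inP=> b bD; apply/forall_inP=> d dD; apply/implyP; apply: h.
Qed.

Lemma alt3S D M : D \subset M -> alt3 M -> alt3 D.
Proof.
move=> /subsetP sDM /alt3P h; apply/alt3P=> a b d aD bD dD.
by apply: h; apply: sDM.
Qed.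

Lemma alt3_small D : #|D| <= 2 -> alt3 D.
Proof.
move=> D2; apply/alt3P=> a b d aD bD dD U.
have : #|[:: a; b; d]| <= #|D|.
  by apply/subset_leq_card/subsetP=> x; rewrite !inE => /or3P[] /eqP ->.
by rewrite (card_uniqP U) leqNgt ltnS D2.
Qed.

Lemma cyc3_rot (a b d : T) : uniq [:: a; b; d] -> cyc [:: b; d; a] = cyc [:: a; b; d].
Proof. by move=> U; rewrite -(cyc_rot 1 U). Qed.

Lemma cyc3_swap (a b d : T) : uniq [:: a; b; d] ->
  cyc [:: a; b; d] \in G -> cyc [:: b; a; d] \in G.
Proof.
move=> U h; have <- : cyc [:: d; b; a] = cyc [:: b; a; d].
  by apply/esym/cyc3_rot; move: (rev_uniq [:: a; b; d]); rewrite U /rev /=.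
by rewrite (cyc_rev U) groupV.
Qed.

Lemma cyc3_conj (a b d : T) g : g \in G ->
  cyc [:: a; b; d] \in G -> cyc [:: g a; g b; g d] \in G.
Proof. by move=> gG h; rewrite -(cyc_conj [:: a; b; d] g) groupJ. Qed.

Lemma alt3_image D g : g \in G -> alt3 D -> alt3 (g @: D).
Proof.
move=> gG /alt3P h; apply/alt3P=> _ _ _ /imsetP[a aD ->] /imsetP[b bD ->] /imsetP[d dD ->].
rewrite -[[:: _; _; _]]/(map g [:: a; b; d]) (map_inj_uniq perm_inj) => U.
by apply: cyc3_conj => //; apply: h.
Qed.

(** The 3-cycles on [D] move the pair of old points around, so that one 3-cycle through the new
point [x] yields all of them. *)
Lemma alt3_add D x a b : alt3 D -> a \in D -> b \in D -> a != b -> x \notin D ->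
  cyc [:: a; b; x] \in G -> alt3 (x |: D).
Proof.
move=> /alt3P hD aD bD ab xD h.
have xn y : y \in D -> y != x by apply: contraTneq => ->.
have U y z : y \in D -> z \in D -> y != z -> uniq [:: y; z; x].
  by move=> yD zD yz; rewrite /= !inE negb_or yz !xn.
have step y z t : y \in D -> z \in D -> t \in D -> y != z -> t != z ->
    cyc [:: y; z; x] \in G -> cyc [:: z; t; x] \in G.
  move=> yD zD tD yz tz hyz; have [->|ty] := eqVneq t y.
    by apply: cyc3_swap hyz; apply: U.
  have U3 : uniq [:: y; z; t] by rewrite /= !inE negb_or yz eq_sym ty eq_sym tz.
  have [c1 c2 _] := perm_cyc3 U3.
  have := cyc3_conj (hD _ _ _ yD zD tD U3) hyz; rewrite c1 c2 cyc_out //.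
  by rewrite !inE !negb_or ![x == _]eq_sym !xn.
have all y z : y \in D -> z \in D -> y != z -> cyc [:: y; z; x] \in G.
  move=> yD zD yz; have [e|yb] := eqVneq y b.
    by rewrite e; apply: (step a); rewrite // -?e // eq_sym.
  apply: (step b) => //; rewrite 1?eq_sym //.
  by apply: (step a) => //; rewrite 1?eq_sym.
apply/alt3P=> p q r; rewrite !inE.
case/predU1P=> [->|pD]; case/predU1P=> [->|qD]; case/predU1P=> [->|rD] Upqr;
  move: (Upqr); rewrite uniq3 ?eqxx ?andbF // => /and3P[n1 n2 n3].
- by rewrite -(cyc3_rot Upqr); apply: all.
- by rewrite -(cyc_rot 2 Upqr); apply: all => //; rewrite eq_sym.
- exact: all.
exact: hD.
Qed.

Lemma alt3_of_cyc3 (a b d : T) : uniq [:: a; b; d] -> cyc [:: a; b; d] \in G ->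
  alt3 [set a; b; d].
Proof.
move=> U h; rewrite setUC; move: (U); rewrite uniq3 => /and3P[ab ad bd].
apply: alt3_add h; rewrite ?inE ?eqxx ?orbT //; first by apply: alt3_small; rewrite cards2 ab.
by rewrite negb_or ![d == _]eq_sym ad.
Qed.

(** The 3-cycles on [g @: M] belong to [G] as well, and this set meets [M] in [g z]. If it contained
a point outside [M], a 3-cycle through this point and two points of [M] would arise, and [M] would
not be maximal by [alt3_add]. *)
Lemma alt3_block M g z : maxset alt3 M -> 2 < #|M| -> g \in G -> z \in M -> g z \in M ->
  forall x, x \in M -> g x \in M.
Proof.
move=> maxM M2 gG zM gzM x xM; apply: contraT => gxM.
have hM := maxsetp maxM.
suff hx : alt3 (g x |: M).
  by rewrite -(maxsetsup maxM hx (subsetU1 _ _)) setU11 in gxM.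
have zx : g z != g x by apply: contraNneq gxM => <-.
have h' := alt3_image gG hM.
have inI t : t \in M -> g t \in g @: M by move=> tM; apply: imset_f.
have M2' : 2 < #|g @: M| by rewrite card_imset //; apply: perm_inj.
have [e2 e2M U] : exists2 e2, e2 \in g @: M & uniq [:: g z; g x; e2].
  have [e1 [e2 [h1 h2 U]]] := other_two M2' (inI z zM).
  have [e|n] := eqVneq e1 (g x); first by exists e2 => //; rewrite -e.
  by exists e1 => //; move: U; rewrite /= !inE !negb_or zx (eq_sym (g x)) n => /andP[/andP[-> _] _].
have hz : cyc [:: g z; g x; e2] \in G by move/alt3P: h'; apply; rewrite ?inI.
have [e2M'|ne2] := boolP (e2 \in M).
  apply: (alt3_add hM gzM e2M') => //.
    by move: U; rewrite /= !inE negb_or => /andP[/andP[]].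
  move: (U); rewrite uniq3 => /and3P[n1 n2 n3].
  by rewrite cyc3_rot ?(cyc3_swap U) // uniq3 eq_sym n1 n3.
have [d1 [d2 [d1M d2M Ud]]] := other_two M2 gzM.
have hd : cyc [:: g z; d1; d2] \in G by move/alt3P: hM; apply.
have [c1 _ _] := perm_cyc3 U.
have nin t : t \in M -> t != g z -> t \notin [:: g z; g x; e2].
  move=> tM tz; rewrite !inE (negbTE tz) /= negb_or.
  by apply/andP; split; [apply: contraNneq gxM => <-|apply: contraNneq ne2 => <-].
move: (Ud); rewrite /= !inE negb_or ![g z == _]eq_sym andbT => /andP[/andP[n1 n2] n12].
have := cyc3_conj hz hd; rewrite c1 !cyc_out ?nin // => hh.
apply: (alt3_add hM d1M d2M) => //; rewrite cyc3_rot //.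
rewrite /= !inE negb_or n12 !andbT; apply/andP.
by split; apply: contraNneq gxM => ->.
Qed.

(** Multiplying by a 3-cycle makes [p] fix one more point; only an odd [p] may get stuck, at a
transposition. *)
Lemma alt3_even D p : alt3 D -> perm_on D p -> odd_perm p = false -> p \in G.
Proof.
move: {2}#|D| (erefl #|D|) => n; elim: n D p => [|n IH] D p cD hD onD ep.
  by rewrite (perm_on_id onD) ?cD // group1.
have /card_gt0P[x xD] : 0 < #|D| by rewrite cD.
have card_D' : #|D :\ x| = n by apply/eqP; rewrite -eqSS -cD (cardsD1 x D) xD.
have hD' : alt3 (D :\ x) by apply: alt3S hD; apply: subsetDl.
have onD' q : perm_on D q -> q x = x -> perm_on (D :\ x) q.
  move=> onq qx; apply/subsetP=> y; rewrite !inE => qy.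
  rewrite (subsetP onq) // andbT; by apply: contraNneq qy => ->; rewrite qx.
have [px|px] := eqVneq (p x) x; first by apply: IH hD' _ ep => //; apply: onD'.
set y := p x in px *.
have yD : y \in D by rewrite /y (perm_closed _ onD).
have [t Ut|no] := pickP [pred t in D | uniq [:: y; x; t]]; last first.
  have D2 t : t \in D -> t = x \/ t = y.
    move=> tD; move: (no t) => /=; rewrite tD !inE negb_or px /= => /negbT.
    rewrite andbT negb_and !negbK => /orP[] /eqP; by [right|left].
  suff e : p = tperm x y by rewrite e odd_tperm eq_sym px in ep.
  have py : p y = x.
    have [//|e] : p y = x \/ p y = y by apply: D2; rewrite (perm_closed _ onD).
    by move: e px => /perm_inj ->; rewrite eqxx.
  apply/permP=> z; case: tpermP => [->|->|zx zy] //.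
  by apply: (out_perm onD); apply/negP=> /D2[].
case/andP: Ut => tD' U.
set q := cyc [:: y; x; t].
have qG : q \in G by move/alt3P: hD; apply.
rewrite -(groupMr p qG); apply: (IH _ _ card_D' hD').
  apply: onD'; last by rewrite permM; have [] := perm_cyc3 U.
  apply: perm_onM => //; apply/subsetP=> z; rewrite inE; apply: contraR => zD.
  by rewrite cyc_out // !inE !negb_or; apply/and3P; split; apply: contraNneq zD => ->.
by rewrite odd_permM ep odd_cyc3.
Qed.

End ThreeCycles.

(** * Tours of a blank and rotations along two cycles *)

Lemma connect_homo (T1 T2 : finType) (e1 : rel T1) (e2 : rel T2) (f : T1 -> T2) :
  (forall x y, e1 x y -> connect e2 (f x) (f y)) ->
  forall x y, connect e1 x y -> connect e2 (f x) (f y).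
Proof.
move=> h x y /connectP[s ps ->]; elim: s x ps => [|z s IH] x //= /andP[xz zs].
by apply: connect_trans (h _ _ xz) _; apply: IH.
Qed.

Section Slides.
Variables (T : finType) (e : rel T).
Implicit Types (c x y z : T) (s : seq T) (p q g w : {perm T}).

Definition slide c : rel {perm T} :=
  fun p q => e (p c) (q c) && (q == p * tperm (p c) (q c)).

Definition slides c := connect (slide c).

Lemma slidesM g c p q : slides (g c) p q -> slides c (g * p) (g * q).
Proof.
apply: connect_homo => {}p {}q /andP[h1 /eqP h2]; apply: connect1.
by rewrite /slide !permM h1 {1}h2 mulgA eqxx.
Qed.

Lemma slides_walk c p s : path e (p c) s -> slides c p (p * walk (p c) s).
Proof.
elim: s p => [|z s IH] p /=; first by rewrite mulg1 /slides connect0.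
case/andP=> pz zs; have e1 : (p * tperm (p c) z) c = z by rewrite permM tpermL.
apply: (@connect_trans _ _ (p * tperm (p c) z)).
  by apply: connect1; rewrite /slide e1 pz eqxx.
by rewrite mulgA -{3}e1; apply: IH; rewrite e1.
Qed.

(** Permutations of the positions brought about by closed walks of a blank placed at [y], read off
as the states reached from the identity. *)
Definition tour y : {set {perm T}} := [set w : {perm T} | (w y == y) && slides y 1 w].

Lemma tour_group_set y : group_set (tour y).
Proof.
apply/group_setP; split; first by rewrite inE perm1 eqxx /slides connect0.
move=> u w; rewrite !inE => /andP[/eqP uy hu] /andP[/eqP wy hw].
rewrite permM uy wy eqxx; apply: connect_trans hu _.
by rewrite -{1}[u]mulg1; apply: slidesM; rewrite uy.
Qed.

Canonical tour_group y := Group (tour_group_set y).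

Lemma tour_slides c p w : w \in tour (p c) -> slides c p (p * w).
Proof. by rewrite inE => /andP[_ h]; rewrite -{1}[p]mulg1; apply: slidesM. Qed.

Lemma cyc_closed_walk y s : uniq (y :: s) -> walk y (rcons s y) = (cyc s)^-1.
Proof.
case: s => [|z s] U; first by rewrite /= mulg1 tperm1 cyc_nil invg1.
rewrite -cats1 walk_cat {1}/walk -/walk /= mulg1 cyc_cons invgK.
set g := walk z s.
have -> : tperm y z * g = g * tperm y z ^ g by rewrite conjgE mulKVg.
have gy : g y = y by apply: walk_out; case/andP: U.
by rewrite tpermJ gy [g z]walk_last (tpermC y) -mulgA tperm2 mulg1.
Qed.

(** When the blank goes once around a cycle, the other tokens of the cycle rotate by one step. *)
Lemma tour_cyc y s : uniq (y :: s) -> path.cycle e (y :: s) -> cyc s \in tour y.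
Proof.
move=> U /= h; rewrite -groupV /= -(cyc_closed_walk U) inE.
rewrite walk_last last_rcons eqxx /=.
have := @slides_walk y 1 (rcons s y); rewrite perm1 mul1g; exact.
Qed.

Hypothesis e_sym : symmetric e.

Lemma slide_sym c : symmetric (slide c).
Proof.
suff h p q : slide c p q -> slide c q p by move=> p q; apply/idP/idP; apply: h.
case/andP=> h1 /eqP h2; rewrite /slide e_sym h1 /= tpermC.
have tt : tperm (p c) (q c) * tperm (p c) (q c) = 1 by apply: tperm2.
by set t := tperm (p c) (q c) in h2 tt *; rewrite h2 -mulgA tt mulg1.
Qed.

Lemma slides_sym c p q : slides c p q = slides c q p.
Proof. exact: sym_connect_sym (@slide_sym c) p q. Qed.

Lemma tour_conj y w g : slides y 1 w -> g \in tour y -> g ^ w \in tour (w y).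
Proof.
move=> hw; rewrite inE => /andP[/eqP gy hg].
rewrite inE conjgE !permM permK gy eqxx /=.
rewrite -(mulVg w); apply: slidesM; rewrite permK.
rewrite slides_sym in hw; apply: (connect_trans hw); apply: (connect_trans hg).
by rewrite -{1}[g]mulg1; apply: slidesM; rewrite gy slides_sym.
Qed.

Lemma alt3_tour_conj y w (D : {set T}) : slides y 1 w ->
  alt3 (tour_group y) D -> alt3 (tour_group (w y)) (w @: D).
Proof.
move=> hw /alt3P h; apply/alt3P=> _ _ _ /imsetP[a aD ->] /imsetP[b bD ->] /imsetP[d dD ->].
rewrite -[[:: _; _; _]]/(map w [:: a; b; d]) (map_inj_uniq perm_inj) => U.
by rewrite -cyc_conj; apply: tour_conj => //; apply: h.
Qed.

End Slides.

Section ThetaTours.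
Variable T : finType.
Implicit Types (x y z : T) (s xs bs cs : seq T) (g : {perm T}).
Variable G : {group {perm T}}.

(** A maximal block that meets [bs] and [xs ++ cs] is stable under both rotations, since each
rotation fixes the points off its own cycle. *)
Lemma alt3_two_cycles xs bs cs a b d :
  uniq (xs ++ bs ++ cs) -> xs != [::] -> cs != [::] ->
  cyc (xs ++ bs) \in G -> cyc (xs ++ cs) \in G ->
  uniq [:: a; b; d] -> cyc [:: a; b; d] \in G ->
  a \in bs -> b \in xs ++ cs ->
  alt3 G [set x in xs ++ bs ++ cs].
Proof.
move=> U xs0 cs0 rG gG Uabd habd abs bxc.
have [M maxM sM] := maxset_exists (alt3_of_cyc3 Uabd habd).
have M2 : 2 < #|M|.
  apply: leq_trans (subset_leq_card sM); move: (Uabd); rewrite uniq3 => /and3P[ab ad bd].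
  by rewrite setUC cardsU1 cards2 ab !inE negb_or ![d == _]eq_sym ad bd.
have aM : a \in M by apply: (subsetP sM); rewrite !inE eqxx.
have bM : b \in M by apply: (subsetP sM); rewrite !inE eqxx orbT.
have U1 : uniq (xs ++ cs) by apply: subseq_uniq U; rewrite cat_subseq // suffix_subseq.
have U2 : uniq (xs ++ bs) by apply: subseq_uniq U; rewrite catA prefix_subseq.
have nb z : z \in bs -> z \notin xs ++ cs.
  move=> zb; rewrite mem_cat negb_or.
  move: U; rewrite cat_uniq has_cat => /and3P[_ /norP[h1 _]]; rewrite cat_uniq => /and3P[_ h2 _].
  by rewrite (contraNN _ h1) ?(contraNN _ h2) => // h; apply/hasP; exists z.
have nc z : z \in cs -> z \notin xs ++ bs.
  move=> zc; rewrite mem_cat negb_or.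
  move: U; rewrite cat_uniq has_cat => /and3P[_ /norP[_ h1]]; rewrite cat_uniq => /and3P[_ h2 _].
  by rewrite (contraNN _ h1) ?(contraNN _ h2) => // h; apply/hasP; exists z.
have sub1 : {subset xs ++ cs <= M}.
  apply: (cyc_closed U1 _ bxc bM); apply: (alt3_block maxM M2 gG aM).
  by rewrite cyc_out ?nb.
case: cs cs0 sub1 nc {gG bxc U U1 nb} => // z0 cs _ sub1 nc.
case: xs xs0 sub1 nc rG U2 => // x0 xs _ sub1 nc rG U2.
have zM : z0 \in M by apply: sub1; rewrite mem_cat mem_head orbT.
have x0M : x0 \in M by apply: sub1; rewrite mem_head.
have sub2 : {subset (x0 :: xs) ++ bs <= M}.
  apply: (cyc_closed U2 _ (mem_head _ _) x0M); apply: (alt3_block maxM M2 rG zM).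
  by rewrite cyc_out ?nc ?mem_head.
apply: alt3S (maxsetp maxM); apply/subsetP=> t; rewrite inE catA mem_cat.
by case/orP=> [/sub2//|h]; apply: sub1; rewrite mem_cat h orbT.
Qed.

Lemma cyc_insert s1 s2 x y : uniq (s1 ++ x :: y :: s2) ->
  cyc (s1 ++ x :: y :: s2) = cyc (s1 ++ y :: s2) * tperm x y.
Proof.
move=> U; have U' : uniq (s1 ++ y :: s2).
  by apply: subseq_uniq U; rewrite cat_subseq // (suffix_subseq [:: x]).
rewrite -(cyc_rot (size s1) U) -(cyc_rot (size s1) U') !rot_size_cat.
exact: cyc_cons2.
Qed.

Lemma map_cyc_prefix x xs z cs : uniq (x :: xs ++ z :: cs) ->
  map (cyc (x :: xs ++ z :: cs)) (x :: xs) = rcons xs z.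
Proof.
move=> U; have := congr1 (take (size xs).+1) (map_cyc U).
rewrite -map_take rot1_cons /= take_size_cat // => ->.
by rewrite rcons_cat /= -cat_rcons take_size_cat // size_rcons.
Qed.

(** Conjugating one cycle by the other shifts their common part by one step; the result differs from
the original cycle in two places only. *)
Lemma double_transposition x1 xs b bs z cs :
  uniq ((x1 :: xs) ++ (b :: bs) ++ z :: cs) ->
  cyc ((x1 :: xs) ++ b :: bs) \in G -> cyc ((x1 :: xs) ++ z :: cs) \in G ->
  tperm x1 (head b xs) * tperm z b \in G.
Proof.
set r := cyc _; set g := cyc _ => U rG gG.
have U1 : uniq (x1 :: xs ++ z :: cs).
  by apply: subseq_uniq U; rewrite (cat_subseq (subseq_refl (x1 :: xs))) // suffix_subseq.
have nb t : t \in b :: bs -> t \notin x1 :: xs ++ z :: cs.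
  move=> tb; move: U; rewrite cat_uniq has_cat => /and3P[_ /norP[h1 _]].
  rewrite cat_uniq => /and3P[_ h2 _]; rewrite -cat_cons mem_cat negb_or.
  by rewrite (contraNN _ h1) ?(contraNN _ h2) => // h; apply/hasP; exists t.
have rg : r ^ g = cyc (xs ++ z :: b :: bs).
  rewrite cyc_conj map_cat /g map_cyc_prefix // -cats1 -catA; congr (cyc (_ ++ _ ++ _)).
  by rewrite -[RHS]map_id; apply/eq_in_map => t tb; rewrite cyc_out // nb.
have U2 : uniq (xs ++ z :: b :: bs).
  have P : perm_eq (xs ++ (b :: bs) ++ [:: z]) (xs ++ z :: b :: bs).
    by rewrite perm_cat2l perm_catC.
  rewrite -(perm_uniq P); apply: subseq_uniq U.
  rewrite cat_subseq ?subseq_cons // cat_subseq //; exact: (prefix_subseq [:: z]).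
have := groupM (groupVr rG) (groupJ rG gG).
suff -> : r^-1 * r ^ g = tperm x1 (head b xs) * tperm z b by [].
rewrite rg (cyc_insert U2); have -> : r = cyc (xs ++ b :: bs) * tperm x1 (head b xs).
  by rewrite /r; case: (xs) => [|x2 xs'] /=; apply: cyc_cons2.
by rewrite invMg tpermV -!mulgA mulKg.
Qed.

Lemma cyc3E x y z : cyc [:: x; y; z] = tperm y z * tperm x y.
Proof. by rewrite cyc_cons /= mulg1 invMg !tpermV. Qed.

(** Conjugating one double transposition by another that meets it in the single point [b] moves only
[b]; the quotient is a 3-cycle. *)
Lemma cyc3_of_double x1 x2 x3 x4 z t b :
  uniq [:: x1; x2; x3; x4; z; t; b] ->
  tperm x1 x2 * tperm z b \in G -> tperm x3 x4 * tperm t b \in G ->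
  cyc [:: t; z; b] \in G.
Proof.
rewrite /= !inE !negb_or => /and4P[/and5P[n12 n13 n14 n1z /andP[n1t n1b]]].
move=> /and5P[n23 n24 n2z n2t n2b] /and4P[n34 n3z n3t n3b].
move=> /andP[/and3P[n4z n4t n4b] /andP[/andP[nzt nzb] /andP[ntb _]]] h1 h2.
have e : (tperm x1 x2 * tperm z b) ^ (tperm x3 x4 * tperm t b) = tperm x1 x2 * tperm z t.
  have out (p q r : T) : p != r -> q != r -> tperm p q r = r by apply: tpermD.
  rewrite conjMg !tpermJ !permM.
  rewrite (out x3 x4 x1) 1?eq_sym // (out x3 x4 x2) 1?eq_sym //.
  rewrite (out x3 x4 z) // (out x3 x4 b) // tpermR.
  by rewrite (out t b x1) 1?eq_sym // (out t b x2) 1?eq_sym // (out t b z) 1?eq_sym.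
have := groupM h1 (groupJ h1 h2); rewrite e; congr (_ \in G).
have -> : tperm x1 x2 * tperm z b = tperm z b * tperm x1 x2.
  have -> : tperm x1 x2 * tperm z b = tperm z b * tperm x1 x2 ^ tperm z b by rewrite conjgE mulKVg.
  by rewrite tpermJ !tpermD 1?eq_sym.
by rewrite -mulgA (mulgA (tperm x1 x2)) tperm2 mul1g cyc3E tpermC (tpermC t).
Qed.

End ThetaTours.

(** * 3-cycles from two cycles sharing a path *)

Section Words.
Variables (T : finType) (x0 : T) (s : seq T).
Hypothesis Us : uniq s.
Let f := nth x0 s.
Implicit Types (w : seq (seq nat)) (l : seq nat).

(** Products of cycles on the entries of a duplicate-free sequence are followed on the indices,
where they can be computed. *)
Definition word_run w i := foldl (fun i l => next l i) i w.
Definition word_ok w := all (fun l => uniq l && all (gtn (size s)) l) w.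

Lemma cyc_nth l i : uniq l -> all (gtn (size s)) l -> i < size s ->
  cyc (map f l) (f i) = f (next l i).
Proof.
move=> Ul /allP hl hi.
have finj : {in l &, injective f}.
  by move=> a b /hl ha /hl hb /eqP; rewrite /f nth_uniq // => /eqP.
have Ufl : uniq (map f l) by rewrite map_inj_in_uniq.
have [il|il] := boolP (i \in l); last first.
  rewrite cyc_out ?next_nth ?(negbTE il) //; apply: contraNN il => /mapP[j jl /eqP].
  by have hj : j < size s := hl _ jl; rewrite /f nth_uniq // => /eqP ->.
have := map_cyc Ufl; rewrite -map_rot -map_next // -!map_comp => /eq_in_map.
exact.
Qed.

Lemma word_prod w i : word_ok w -> i < size s ->
  (\prod_(l <- w) cyc (map f l)) (f i) = f (word_run w i).
Proof.
elim: w i => [|l w IH] i /=; first by rewrite big_nil perm1.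
case/andP=> /andP[Ul hl] hw hi; rewrite big_cons permM cyc_nth // IH //.
have [il|il] := boolP (i \in l); first by move/allP: hl; apply; rewrite mem_next.
by rewrite next_nth (negbTE il).
Qed.

Lemma word_eq w l : word_ok (l :: w) ->
  all (fun i => word_run w i == next l i) (iota 0 (size s)) ->
  \prod_(l <- w) cyc (map f l) = cyc (map f l).
Proof.
move=> /andP[/andP[Ul hl] hw] /allP h; apply/permP=> x.
have [xs|xs] := boolP (x \in s).
  rewrite -(nth_index x0 xs) -/f word_prod ?index_mem // (eqP (h _ _)) ?cyc_nth ?index_mem //.
  by rewrite mem_iota index_mem.
have out l' : all (gtn (size s)) l' -> cyc (map f l') x = x.
  move=> /allP hl'; apply: cyc_out; apply: contraNN xs => /mapP[j /hl' jl ->].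
  exact: mem_nth.
rewrite out //; elim: w hw {h} => [|l' w IH] /=; first by rewrite big_nil perm1.
by case/andP=> /andP[_ hl'] hw; rewrite big_cons permM out // IH.
Qed.

Lemma word_mem (G : {group {perm T}}) k w l : word_ok (l :: flatten (nseq k w)) ->
  all (fun i => word_run (flatten (nseq k w)) i == next l i) (iota 0 (size s)) ->
  (forall l', l' \in w -> cyc (map f l') \in G) -> cyc (map f l) \in G.
Proof.
move=> ok h hG; rewrite -(word_eq ok h) big_seq; apply: group_prod => l' /flattenP[w'].
by rewrite mem_nseq => /andP[_ /eqP ->]; apply: hG.
Qed.

End Words.

Lemma nth_uniqs (T : eqType) (x0 : T) s l :
  uniq s -> uniq l && all (gtn (size s)) l -> uniq (map (nth x0 s) l).
Proof.
move=> Us /andP[Ul /allP hl]; rewrite map_inj_in_uniq // => i j /hl hi /hl hj /eqP.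
by rewrite nth_uniq // => /eqP.
Qed.

Section ThetaRoles.
Variable T : finType.
Variable G : {group {perm T}}.
Implicit Types (xs bs cs : seq T).

(** Sizes of the three paths for which a 3-cycle is produced, [a] being that of the path shared by
the two cycles. *)
Definition roles a b c :=
  [&& 0 < b, 0 < c & [|| a == 0%N, (a == 1%N) && (b == 1%N), (2 < a) && (2 < c),
    (a == 1%N) && (3 < c), (a == 2) && (4 < c)
    | (a, b, c) \in [:: (1%N, 2, 3); (2, 2, 2); (2, 2, 3); (2, 2, 4)]]].

Lemma cyc_pow (x0 : T) (s : seq T) i k : uniq s -> i + k < size s ->
  (cyc s ^+ k) (nth x0 s i) = nth x0 s (i + k).
Proof.
move=> U; elim: k => [|k IH] h; first by rewrite addn0 perm1.
rewrite addnS in h; rewrite expgSr permM IH ?(ltnW h) // cycE // addnS.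
rewrite -[s in RHS](cat_take_drop (i + k)) (drop_nth x0 (ltnW h)) (drop_nth x0 h).
rewrite nth_cat size_take (ltnW h) ltnNge leqnSn /= subSnn /=.
set y := nth x0 s (i + k).
have def_s : s = take (i + k) s ++ y :: nth x0 s (i + k).+1 :: drop (i + k).+2 s.
  by rewrite /y -drop_nth // -drop_nth ?(ltnW h) // cat_take_drop.
rewrite {1}def_s next_infix // -def_s //.
Qed.

(** The double transposition of [double_transposition] and its conjugate by the [k]-th power of the
second rotation meet in the point of [bs] only, as soon as the six indices are distinct. *)
Lemma theta_shift k xs bs cs :
  uniq (xs ++ bs ++ cs) -> 1 < size xs -> 0 < size bs ->
  cyc (xs ++ bs) \in G -> cyc (xs ++ cs) \in G ->
  uniq [:: 0%N; 1%N; k; k.+1; size xs; size xs + k] -> size xs + k < size (xs ++ cs) ->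
  alt3 G [set x in xs ++ bs ++ cs].
Proof.
move=> U xs1 b0 rG gG Uk hk.
have cs0 : 0 < size cs.
  by rewrite size_cat in hk; case: (cs) hk => //=; rewrite addn0 ltnNge leq_addr.
case: bs b0 U rG => [|b bs] // _ U rG.
have ne s : 0 < size s -> s != [::] by move=> {U}; case: s.
set l := xs ++ cs in gG hk.
have Ul : uniq l by apply: subseq_uniq U; rewrite cat_subseq // suffix_subseq.
have nbl : b \notin l.
  rewrite mem_cat negb_or; move: U; rewrite cat_uniq has_cat => /and3P[_ /norP[h1 _]].
  rewrite cat_uniq => /and3P[_ h2 _].
  by rewrite (contraNN _ h1) ?(contraNN _ h2) // => h; apply/hasP; exists b; rewrite ?mem_head.
have hl i : i \in [:: 0%N; 1%N; k; k.+1; size xs; size xs + k] -> i < size l.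
  move=> hi; apply: leq_ltn_trans hk; move: hi; rewrite !inE.
  case/or4P => [/eqP->|/eqP->|/eqP->|/or3P[]/eqP->] //; rewrite ?leq_addr ?leq_addl //.
  - by rewrite ltn_addr // ltnW.
  - by rewrite -add1n leq_add2r ltnW.
have D : tperm (nth b l 0) (nth b l 1) * tperm (nth b l (size xs)) b \in G.
  rewrite /l !nth_cat xs1 ltnW // ltnn subnn.
  case: cs cs0 {hk Ul nbl hl} @l U gG => [|z cs] // _ l U gG.
  case: xs xs1 {Uk} U rG @l gG => [|x1 [|x2 xs]] // _ U rG l gG.
  exact: double_transposition U rG gG.
have bfix : (cyc l ^+ k) b = b by rewrite permX iter_fix // cyc_out.
have pow i : i + k < size l -> (cyc l ^+ k) (nth b l i) = nth b l (i + k) by exact: cyc_pow.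
have := groupJ D (groupX k gG); rewrite conjMg !tpermJ bfix !pow // ?add0n ?add1n.
2,3: by apply: hl; rewrite !inE eqxx ?orbT.
move=> D'.
have U7 : uniq (rcons (map (nth b l) [:: 0%N; 1%N; k; k.+1; size xs; size xs + k]) b).
  rewrite rcons_uniq map_inj_in_uniq // ?Uk ?andbT.
    by apply: contraNN nbl => /mapP[i /hl hi ->]; apply: mem_nth.
  by move=> i j /hl hi /hl hj /eqP; rewrite nth_uniq // => /eqP.
have h := cyc3_of_double U7 D D'.
have U3 : uniq [:: b; nth b l (size xs + k); nth b l (size xs)].
  have : uniq [:: nth b l (size xs); nth b l (size xs + k); b].
    apply: subseq_uniq U7; exact: (suffix_subseq (map _ [:: 0%N; 1%N; k; k.+1])).
  by rewrite !uniq3 => /and3P[n1 n2 n3]; rewrite !(eq_sym b) n3 n2 eq_sym n1.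
have h2 : cyc [:: b; nth b l (size xs + k); nth b l (size xs)] \in G.
  rewrite -(cyc3_rot U3); exact: h.
apply: (alt3_two_cycles U (ne _ _ (ltnW xs1)) (ne _ _ cs0) rG gG U3 h2 (mem_head _ _)).
by apply: mem_nth; apply: hl; rewrite !inE eqxx ?orbT.
Qed.

(** In the general case [theta_shift] applies with [k = 2]; short shared paths need a larger [k],
and hence a longer path [cs]. In the remaining cases one of the rotations or the quotient of
[double_transposition] is itself a 3-cycle, except for finitely many sizes, for which an explicit
word in the two rotations is one. *)
Lemma theta_roles xs bs cs :
  uniq (xs ++ bs ++ cs) -> 0 < size xs ->
  cyc (xs ++ bs) \in G -> cyc (xs ++ cs) \in G ->
  roles (size xs).-1 (size bs) (size cs) -> alt3 G [set x in xs ++ bs ++ cs].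
Proof.
move=> U xs0 rG gG /and3P[b0 c0 R].
have ne s : 0 < size s -> s != [::] by move=> {U}; case: s.
have fin a b d : a \in bs -> b \in xs ++ cs -> uniq [:: a; b; d] ->
    cyc [:: a; b; d] \in G -> alt3 G [set x in xs ++ bs ++ cs].
  move=> ha hb Uabd h.
  exact: (alt3_two_cycles U (ne _ _ xs0) (ne _ _ c0) rG gG Uabd h ha hb).
have shift k : 1 < size xs -> uniq [:: 0%N; 1%N; k; k.+1; size xs; size xs + k] ->
    k < size cs -> alt3 G [set x in xs ++ bs ++ cs].
  by move=> xs1 Uk hk; apply: (theta_shift U xs1 b0 rG gG Uk); rewrite size_cat ltn_add2l.
case/or4P: R => [a0|/andP[a1 b1]|/andP[a2 c2]|/or3P[/andP[a1 c2]|/andP[a2 c2]|R]].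
(* the shared path is a single point, and the two transpositions have b in common: their product is
a 3-cycle *)
- case: xs xs0 a0 U rG gG fin {shift} => [|v [|? ?]] // _ _ U rG gG fin.
  case: bs b0 U rG fin => [|b bs] // _ U rG fin.
  case: cs c0 U gG fin => [|z cs] // _ U gG fin.
  have /= h := double_transposition U rG gG.
  have Uvbz : uniq [:: v; b; z].
    by apply: subseq_uniq U; rewrite /= !eqxx; apply: (cat_subseq (sub0seq bs)); rewrite /= eqxx sub0seq.
  apply: (fin b v z); rewrite ?mem_head ?inE ?eqxx ?orbT //.
    by move: Uvbz; rewrite !uniq3 => /and3P[n1 n2 n3]; rewrite eq_sym n1 n3 n2.
  have Uzbv : uniq [:: z; b; v].
    by move: Uvbz; rewrite !uniq3 => /and3P[n1 n2 n3]; rewrite (eq_sym z b) n3 (eq_sym z v) n2 (eq_sym b v) n1.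
  by rewrite (cyc3_rot Uzbv) cyc3E (tpermC b).
(* the first cycle has three points besides the blank, so its rotation is a 3-cycle *)
- case: xs xs0 a1 U rG gG fin {shift} => [|x [|v [|? ?]]] // _ _ U rG gG fin.
  case: bs b0 b1 U rG fin => [|b [|? ?]] // _ _ U rG fin.
  have U3 : uniq [:: b; x; v].
    have : uniq [:: x; v; b] by apply: subseq_uniq U; apply: (prefix_subseq [:: x; v; b]).
    by rewrite !uniq3 => /and3P[n1 n2 n3]; rewrite (eq_sym b x) n2 (eq_sym b v) n3 n1.
  apply: (fin b x v); rewrite ?mem_head //.
  rewrite -(cyc3_rot U3); exact: rG.
- have {}a2 : 3 < size xs by case: (xs) a2.
  apply: shift (ltnW (ltnW a2)) _ c2.
  by case: (size xs) a2 => [|[|[|[|m]]]] //= _; rewrite addn2 !inE !eqSS (ltn_eqF (leqnSn m.+1)).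
- have xs2 : size xs = 2 by case: (xs) xs0 a1 => [|? [|? []]].
  by apply: (@shift 3) c2; rewrite xs2.
- have xs3 : size xs = 3 by case: (xs) xs0 a2 => [|? [|? [|? []]]].
  by apply: (@shift 4) c2; rewrite xs3.
(* with the rotations g1 along xs ++ bs and g2 along xs ++ cs, the words below are (g1 g2)^4, (g1 g2
g2)^2, (g1 g2 g2)^5 and (g1 g1 g2 g1^-1 g2 g2)^4 *)
move: R fin U rG gG {shift ne b0 c0}; rewrite !inE !xpair_eqE.
case: xs xs0 => [|x0 [|x1 [|x2 [|? ?]]]] // _;
case: bs => [|b0 [|b1 [|? ?]]] //;
case: cs => [|c0 [|c1 [|c2 [|c3 [|? ?]]]]] // _ fin U rG gG.
- apply: (fin b1 x1 b0 _ _ (@nth_uniqs _ x0 _ [:: 3; 1%N; 2] U isT)).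
  1,2: by rewrite !inE eqxx ?orbT.
  apply: (@word_mem _ x0 _ U G 4 [:: [:: 0%N; 1%N; 2; 3]; [:: 0%N; 1%N; 4; 5; 6]] [:: 3; 1%N; 2]
    isT isT) => l'.
  by rewrite !inE => /orP[] /eqP ->.
- apply: (fin b0 x2 b1 _ _ (@nth_uniqs _ x0 _ [:: 3; 2; 4] U isT)).
  1,2: by rewrite !inE eqxx ?orbT.
  apply: (@word_mem _ x0 _ U G 2 [:: [:: 0%N; 1%N; 2; 3; 4]; [:: 0%N; 1%N; 2; 5; 6];
    [:: 0%N; 1%N; 2; 5; 6]] [:: 3; 2; 4] isT isT) => l'.
  by rewrite !inE => /or3P[] /eqP ->.
- apply: (fin b0 x2 b1 _ _ (@nth_uniqs _ x0 _ [:: 3; 2; 4] U isT)).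
  1,2: by rewrite !inE eqxx ?orbT.
  apply: (@word_mem _ x0 _ U G 5 [:: [:: 0%N; 1%N; 2; 3; 4]; [:: 0%N; 1%N; 2; 5; 6; 7];
    [:: 0%N; 1%N; 2; 5; 6; 7]] [:: 3; 2; 4] isT isT) => l'.
  by rewrite !inE => /or3P[] /eqP ->.
apply: (fin b1 c0 c3 _ _ (@nth_uniqs _ x0 _ [:: 4; 5; 8] U isT)).
1,2: by rewrite ?mem_cat !inE eqxx ?orbT.
have rV := groupVr rG; rewrite -cyc_rev in rV; last first.
  exact: (@nth_uniqs _ x0 _ [:: 0%N; 1%N; 2; 3; 4] U isT).
apply: (@word_mem _ x0 _ U G 4 [:: [:: 0%N; 1%N; 2; 3; 4]; [:: 0%N; 1%N; 2; 3; 4];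
  [:: 0%N; 1%N; 2; 5; 6; 7; 8]; [:: 4; 3; 2; 1%N; 0%N]; [:: 0%N; 1%N; 2; 5; 6; 7; 8];
  [:: 0%N; 1%N; 2; 5; 6; 7; 8]] [:: 4; 5; 8] isT isT) => l'.
by rewrite !inE => /or4P[|||/or3P[]] /eqP ->.
Qed.

End ThetaRoles.

(** * Ears of 2-connected graphs *)

Section Connectivity.
Variables (T : finType) (e : rel T).
Implicit Types (x y z u v : T) (s P : seq T) (V W S : {set T}).

Definition induced V : rel T := fun x y => [&& x \in V, y \in V & e x y].

Definition conn V := forall x y, x \in V -> y \in V -> connect (induced V) x y.

Definition kconn k V := k < #|V| /\ forall S : {set T}, #|S| < k -> conn (V :\: S).

Lemma kconn_sub k r V S : kconn (r + k) V -> #|S| <= r -> kconn k (V :\: S).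
Proof.
case=> hV hc hS; split.
  rewrite -(ltn_add2l r); apply: leq_trans hV _.
  by rewrite -(cardsID S V) leq_add2r (leq_trans _ hS) // subset_leq_card // subsetIr.
move=> S' hS'; rewrite setDDl; apply: hc.
rewrite (leq_ltn_trans (leq_card_setU S S')) //.
by rewrite (leq_ltn_trans (leq_add hS (leqnn _))) // ltn_add2l.
Qed.

Lemma kconn_conn k V : 0 < k -> kconn k V -> conn V.
Proof. by move=> k0 [_ h]; rewrite -(setD0 V); apply: h; rewrite cards0. Qed.

Lemma kconnW k l V : l <= k -> kconn k V -> kconn l V.
Proof.
move=> lk [h1 h2]; split; first exact: leq_ltn_trans lk h1.
by move=> S hS; apply: h2; apply: leq_trans lk.
Qed.

Lemma kconnD1 k V z : kconn k.+1 V -> kconn k (V :\ z).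
Proof. by move=> h; apply: (@kconn_sub k 1) => //; rewrite cards1. Qed.

Lemma path_induced V x s : path e x s -> x \in V -> {subset s <= V} -> path (induced V) x s.
Proof.
elim: s x => //= y s IH x /andP[xy ys] xV sV.
have yV : y \in V by apply: sV; rewrite mem_head.
by rewrite /induced xy xV yV /=; apply: IH => // t ts; apply: sV; rewrite inE ts orbT.
Qed.

Lemma induced_path V x s : path (induced V) x s -> path e x s /\ {subset s <= V}.
Proof.
elim: s x => //= y s IH x /andP[/and3P[_ yV ->] /IH[-> sV]]; split=> // t.
by rewrite inE => /predU1P[->|/sV].
Qed.

Lemma conn_path V x y : conn V -> x \in V -> y \in V ->
  exists s, [/\ path e x s, last x s = y, uniq (x :: s) & {subset s <= V}].
Proof.
move=> cV xV yV; have /connectP[s0 ps ->] := cV x y xV yV.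
case/shortenP: ps => s /induced_path[ps sV] Us _; by exists s.
Qed.

Lemma first_hit (W : {set T}) x s : path e x s -> x \notin W -> last x s \in W -> uniq (x :: s) ->
  exists P v, [/\ v \in W, path e x (rcons P v), uniq (x :: rcons P v),
    {subset P <= ~: W} & {subset rcons P v <= s}].
Proof.
move=> ps xW lW Us.
have hs : has [in W] s.
  apply/hasP; exists (last x s) => //; case: (s) lW => [|y s'] /=; first by rewrite (negbTE xW).
  by rewrite mem_last.
case: (split_find hs) ps Us => v P s2 vW nP; rewrite -cat_cons cat_path cat_uniq.
move=> /andP[p1 _] /and3P[U1 _ _]; exists P, v; split=> //.
  by move=> t tP; rewrite inE; apply: contra nP => tW; apply/hasP; exists t.
by move=> t tP; rewrite mem_cat tP.
Qed.

Definition is_ear V W u v P :=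
  [/\ u \in W, v \in W, u != v, path e u (rcons P v) & uniq P /\ {subset P <= V :\: W}].

(** An edge [u w'] leaving [W] is continued by a path from [w'] back to [W] that avoids [u]. *)
Lemma ear_exists V W : (forall z, conn (V :\ z)) -> conn V -> W \subset V -> 1 < #|W| -> W != V ->
  exists u v P, is_ear V W u v P /\ P != [::].
Proof.
move=> cV1 cV sWV W2 nWV.
have /subsetPn[w wV wW] : ~~ (V \subset W).
  by apply: contra nWV => h; rewrite eqEsubset sWV.
have /card_gt0P[a aW] : 0 < #|W| by apply: ltnW.
have aV := subsetP sWV a aW.
have [s [ps ls Us sV]] := conn_path cV aV wV.
have [u [w' [uW w'W uw' w'V]]] : exists u w', [/\ u \in W, w' \notin W, e u w' & w' \in V].
  elim: s a aW ps ls sV {aV Us} => [|b s IH] a aW /=.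
    by move=> _ aw; rewrite -aw aW in wW.
  move=> /andP[ab ps] ls sV; have bV : b \in V by apply: sV; rewrite mem_head.
  have [bW|bW] := boolP (b \in W); last by exists a, b.
  by apply: (IH b) => // t ts; apply: sV; rewrite inE ts orbT.
have [b] : exists b, b \in W :\ u by apply/card_gt0P; rewrite (cardsD1 u) uW in W2.
rewrite !inE => /andP[bu bW].
have uw : w' != u by apply: contraNneq w'W => ->.
have [s' [ps' ls' Us' sV']] : exists s, [/\ path e w' s, last w' s = b, uniq (w' :: s) & {subset s <= V :\ u}].
  by apply: conn_path; rewrite ?inE ?bu ?uw ?w'V // (subsetP sWV).
have [|P [v [vW pP UP PW sPs]]] := first_hit ps' w'W _ Us'; first by rewrite ls'.
have vs : v \in s' by apply: sPs; rewrite mem_rcons mem_head.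
exists u, v, (w' :: P); split=> //; split=> //=.
- by move: (sV' v vs); rewrite !inE eq_sym => /andP[].
- by rewrite uw'.
split; first by move: UP; rewrite /= mem_rcons inE rcons_uniq negb_or => /andP[/andP[_ ->] /andP[]].
move=> t; rewrite inE => /predU1P[->|tP]; first by rewrite inE w'W.
have := PW t tP; rewrite !inE => ->; rewrite /=.
by have := sV' t (sPs t _); rewrite !inE mem_rcons inE tP orbT => /(_ isT) /andP[].
Qed.

Hypothesis e_sym : symmetric e.

Lemma induced_sym V : symmetric (induced V).
Proof. by move=> x y; rewrite /induced e_sym andbCA. Qed.

Lemma path_rcons_rev x y s : path e x (rcons s y) = path e y (rcons (rev s) x).
Proof.
rewrite -[in LHS]rev_path last_rcons belast_rcons rev_cons.
by apply: eq_path => a b; rewrite e_sym.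
Qed.

Lemma conn_from V u : (forall x, x \in V -> connect (induced V) u x) -> conn V.
Proof.
move=> h x y xV yV; apply: connect_trans (h y yV).
by rewrite (sym_connect_sym (@induced_sym V)); apply: h.
Qed.

Lemma conn_path_from V u s x : path e u s -> u \in V -> {subset s <= V} -> x \in u :: s ->
  connect (induced V) u x.
Proof. by move=> ps uV sV; apply: (path_connect (path_induced ps uV sV)). Qed.

Lemma connS V W : V \subset W -> forall x y, connect (induced V) x y -> connect (induced W) x y.
Proof.
move=> sVW; apply: connect_sub => a b /and3P[aV bV ab]; apply: connect1.
by rewrite /induced !(subsetP sVW).
Qed.

Lemma conn_ear V W u v P : conn W -> is_ear V W u v P -> conn (W :|: [set x in P]).
Proof.
move=> cW [uW vW uv pP [UP PW]]; apply: (@conn_from _ u) => x; rewrite !inE => /orP[xW|xP].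
  by apply: connS (cW u x uW xW); apply: subsetUl.
apply: (conn_path_from pP); rewrite ?inE ?uW ?mem_rcons ?inE ?xP ?orbT //.
by move=> t; rewrite mem_rcons !inE => /predU1P[->|->]; rewrite ?vW ?orbT.
Qed.

Definition good V := forall y, y \in V -> alt3 (tour_group e y) (V :\ y).

(** A walk of the blank from [y] to [u] permutes [V] and conjugates the tours at [y] into tours at
[u]. *)
Lemma alt3_base V y u : conn V -> y \in V -> u \in V ->
  alt3 (tour_group e y) (V :\ y) -> alt3 (tour_group e u) (V :\ u).
Proof.
move=> cV yV uV h; have [s [ps ls _ sV]] := conn_path cV yV uV.
have hw : slides e y 1 (walk y s).
  by have := @slides_walk _ e y 1 s; rewrite perm1 mul1g; apply.
have := alt3_tour_conj e_sym hw h; rewrite walk_last ls; apply: alt3S.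
have wV : walk y s @: V \subset V.
  by apply/subsetP=> _ /imsetP[x xV ->]; apply: walk_stable.
have eV : walk y s @: V = V.
  by apply/eqP; rewrite eqEcard wV (card_imset _ (@perm_inj _ _)) leqnn.
apply/subsetP=> x; rewrite !inE => /andP[xu xV].
move: xV; rewrite -{1}eV => /imsetP[z zV def_x]; apply/imsetP; exists z => //.
rewrite !inE zV andbT; apply: contraNneq xu => zy.
by rewrite def_x zy walk_last ls.
Qed.

(** The ear is closed up by a path inside [W] to a cycle through one of its ends [u], where the
blank is placed. The rotation along it takes some point of [W :\ u] to a point of [W :\ u], so that
a maximal block containing [W :\ u] absorbs the ear. *)
Lemma good_ear V W u v P : conn W -> 3 < #|W| -> good W -> is_ear V W u v P ->
  good (W :|: [set x in P]).
Proof.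
move=> cW W4 gW hE; have cWP := conn_ear cW hE; case: hE => uW vW uv pP [UP PW].
suff h : alt3 (tour_group e u) ((W :|: [set x in P]) :\ u).
  by move=> y yWP; apply: alt3_base h => //; rewrite inE uW.
have [s [ps ls Us sW]] := conn_path cW vW uW.
case: (lastP s) ps ls Us sW => [|Q u'] /=; first by move=> _ vu; rewrite vu eqxx in uv.
rewrite last_rcons => ps u'u; rewrite {u'}u'u in ps *.
rewrite mem_rcons inE negb_or rcons_uniq => /and3P[/andP[_ vQ] uQ UQ] sW.
have QW t : t \in Q -> t \in W by move=> tQ; apply: sW; rewrite mem_rcons inE tQ orbT.
have nP t : t \in W -> t \notin P.
  by move=> tW; apply: contraTN tW => /PW; rewrite inE => /andP[].
have Uc : uniq (u :: P ++ v :: Q).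
  rewrite /= mem_cat inE !negb_or nP // uv uQ cat_uniq /= UP vQ UQ !andbT /=.
  by rewrite negb_or nP //; apply/hasPn=> t /QW; apply: nP.
have hc : cyc (P ++ v :: Q) \in tour_group e u.
  apply: tour_cyc => //=; rewrite rcons_cat cat_path /=.
  by move: pP; rewrite rcons_path => /andP[-> ->].
have [M maxM sM] := maxset_exists (gW u uW).
have M2 : 2 < #|M|.
  by apply: leq_trans (subset_leq_card sM); rewrite (cardsD1 u) uW in W4.
have inM t : t \in W -> t != u -> t \in M.
  by move=> tW tu; apply: (subsetP sM); rewrite !inE tu.
have vM : v \in M by rewrite inM // eq_sym.
(* if Q is empty, any further point of W will do, as it is fixed; otherwise v goes to a point of Q *)
have [z zM czM] : exists2 z, z \in M & cyc (P ++ v :: Q) z \in M.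
  case: Q uQ Uc hc QW {ps vQ UQ sW} => [|q Q] uQ Uc hc QW.
    have [d1 [d2 [d1W d2W U3]]] := other_two (ltnW W4) uW.
    have [d [dW du dv]] : exists d, [/\ d \in W, d != u & d != v].
      move: U3; rewrite uniq3 => /and3P[n1 n2 n3].
      have [d1v|d1v] := eqVneq d1 v; last by exists d1; rewrite eq_sym n1.
      by exists d2; rewrite eq_sym n2 eq_sym -d1v.
    exists d; first exact: inM.
    by rewrite cyc_out ?inM // mem_cat inE negb_or nP.
  exists v => //; case/andP: Uc => _ Uc; rewrite cycE // next_infix //.
  by rewrite inM ?QW ?mem_head //; move: uQ; rewrite inE negb_or eq_sym => /andP[].
have sub : {subset P ++ v :: Q <= M}.
  case/andP: Uc => _ Uc; apply: (cyc_closed Uc _ _ vM); last by rewrite mem_cat mem_head orbT.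
  exact: (alt3_block maxM M2 hc zM czM).
apply: alt3S (maxsetp maxM); apply/subsetP=> t; rewrite !inE => /andP[tu /orP[tW|tP]].
  exact: inM.
by apply: sub; rewrite mem_cat tP.
Qed.

Lemma good_extend V W : (forall z, conn (V :\ z)) -> conn V -> W \subset V -> 3 < #|W| -> conn W ->
  good W -> good V.
Proof.
move=> c1 c0; move: {2}(#|V :\: W|) (leqnn #|V :\: W|) => n.
elim: n W => [|n IH] W hn sWV W4 cW gW; have [<- //|nWV] := eqVneq W V.
  case/negP: nWV; rewrite eqEsubset sWV -setD_eq0 -cards_eq0 -leqn0 hn //.
have [u [v [P [hE P0]]]] := ear_exists c1 c0 sWV (ltnW (ltnW W4)) nWV.
case: (hE) => _ _ _ _ [_ PW].
have sub : W :|: [set x in P] \subset V.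
  by rewrite subUset sWV; apply/subsetP=> t; rewrite inE => /PW; rewrite inE => /andP[].
apply: IH sub _ (conn_ear cW hE) (good_ear cW W4 gW hE); last first.
  by rewrite (leq_trans W4) // subset_leq_card // subsetUl.
case: P P0 PW {hE} => // p P _ PW; rewrite -ltnS; apply: leq_trans hn.
apply: proper_card; apply/properP; split; first by rewrite setDS // subsetUl.
exists p; first by apply: PW; rewrite mem_head.
by rewrite !inE eqxx orbT.
Qed.

End Connectivity.

(** * Theta graphs *)

Section Thetas.
Variables (T : finType) (e : rel T).
Hypothesis e_sym : symmetric e.
Implicit Types (x y z u v : T) (s P A B C : seq T) (V W : {set T}).

(** The lists hold the inner vertices of the three paths from [u] to [v]. *)
Definition theta u v A B C :=
  [&& path e u (rcons A v), path e u (rcons B v), path e u (rcons C v)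
    & uniq (u :: v :: A ++ B ++ C)].

Lemma theta_swap12 u v A B C : theta u v A B C -> theta u v B A C.
Proof.
case/and4P=> h1 h2 h3 U; apply/and4P; split=> //.
by rewrite (perm_uniq (s2 := u :: v :: A ++ B ++ C)) // !perm_cons perm_catCA.
Qed.

Lemma theta_swap23 u v A B C : theta u v A B C -> theta u v A C B.
Proof.
case/and4P=> h1 h2 h3 U; apply/and4P; split=> //.
by rewrite (perm_uniq (s2 := u :: v :: A ++ B ++ C)) // !perm_cons perm_cat2l perm_catC.
Qed.

Lemma theta_tour u v A B C : theta u v A B C -> cyc (rcons A v ++ rev B) \in tour_group e u.
Proof.
case/and4P=> h1 h2 _ U; apply: tour_cyc.
  have : uniq (u :: v :: A ++ B).
    by apply: subseq_uniq U; rewrite /= !eqxx catA; apply: prefix_subseq.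
  rewrite (perm_uniq (s2 := u :: rcons A v ++ rev B)) // perm_cons -cat_cons perm_sym.
  apply: perm_cat; [by rewrite perm_rcons | by rewrite perm_rev].
rewrite /= rcons_cat cat_path last_rcons h1.
by rewrite (path_rcons_rev e_sym) revK.
Qed.

(** Sizes of simple theta graphs other than theta0: at most one of the paths is a single edge. *)
Definition thick a b c := [&& 0 < a + b, 0 < a + c, 0 < b + c
  & (a, b, c) \notin [:: (1%N, 2, 2); (2, 1%N, 2); (2, 2, 1%N)]].

Lemma theta_alt3_roles u v A B C : theta u v A B C -> roles (size A) (size B) (size C) ->
  alt3 (tour_group e u) [set x in v :: A ++ B ++ C].
Proof.
move=> h R; have U : uniq (rcons A v ++ rev B ++ rev C).
  case/and4P: h => _ _ _ /andP[_ U].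
  rewrite (perm_uniq (s2 := v :: A ++ B ++ C)) // -cat_cons; apply: perm_cat.
    by rewrite perm_rcons.
  by apply: perm_cat; rewrite perm_rev.
have h' := theta_roles U _ (theta_tour h) (theta_tour (theta_swap23 h)).
rewrite size_rcons !size_rev in h'; apply: alt3S (h' isT R).
by apply/subsetP=> x; rewrite !inE !mem_cat mem_rcons !mem_rev inE -orbA.
Qed.

(** The middle path is shared by the two cycles if it has at least three inner vertices and the
shortest one is not an edge, and the shortest one otherwise. *)
Lemma roles_sorted a b c : a <= b <= c -> thick a b c ->
  if (0 < a) && (2 < b) then roles b a c else roles a b c.
Proof.
case/andP=> ab bc /and4P[h1 _ h3].
have big a' b' c' : 2 < a' -> 0 < b' -> 2 < c' -> roles a' b' c'.
  by rewrite /roles => -> b0 c2; rewrite b0 c2 (ltn_trans _ c2) // !orbT.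
case: a ab h1 => [|[|[|a]]] ab h1.
- by rewrite /roles /= h1 (leq_trans h1 bc).
- case: b ab bc {h1} h3 => [|[|[|b]]] // _ bc _ np.
  + by rewrite /roles /= bc.
  + by case: c bc np => [|[|[|[|c]]]].
  + by apply: big => //; apply: leq_trans bc.
- case: b ab bc {h1} h3 => [|[|[|b]]] // _ bc _ np.
  + by case: c bc np => [|[|[|[|[|c]]]]].
  + by apply: big => //; apply: leq_trans bc.
case: b ab bc {h1} h3 => [|[|[|b]]] // _ bc _ np.
by apply: big => //; apply: leq_trans bc.
Qed.

Lemma thickC a b c : thick a b c = thick b a c.
Proof.
rewrite /thick !inE !xpair_eqE (addnC b a); case: (0 < a + c); case: (0 < b + c); rewrite ?andbF //.
by case: (a == 1%N); case: (a == 2); case: (b == 1%N); case: (b == 2); case: (c == 1%N); case: (c == 2).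
Qed.

Lemma thickAC a b c : thick a b c = thick a c b.
Proof.
rewrite /thick !inE !xpair_eqE (addnC c b); case: (0 < a + c); case: (0 < a + b); rewrite ?andbF //.
by case: (a == 1%N); case: (a == 2); case: (b == 1%N); case: (b == 2); case: (c == 1%N); case: (c == 2).
Qed.

Lemma theta_alt3 u v A B C : theta u v A B C -> thick (size A) (size B) (size C) ->
  alt3 (tour_group e u) [set x in v :: A ++ B ++ C].
Proof.
have sorted A' B' C' : theta u v A' B' C' -> thick (size A') (size B') (size C') ->
    size A' <= size B' <= size C' -> alt3 (tour_group e u) [set x in v :: A' ++ B' ++ C'].
  move=> h t s; have := roles_sorted s t; case: ifP => _; last exact: theta_alt3_roles.
  move=> R; apply: alt3S (theta_alt3_roles (theta_swap12 h) R).
  by apply/subsetP=> x; rewrite !inE !mem_cat; case: (x \in A'); case: (x \in B'); rewrite ?orbT ?orbF.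
have two A' B' C' : theta u v A' B' C' -> thick (size A') (size B') (size C') ->
    size A' <= size B' -> alt3 (tour_group e u) [set x in v :: A' ++ B' ++ C'].
  move=> h t sAB; have [sBC|sCB] := leqP (size B') (size C'); first by apply: sorted; rewrite // sAB.
  have [sAC|sCA] := leqP (size A') (size C').
    apply: alt3S (sorted _ _ _ (theta_swap23 h) _ _).
    - by apply/subsetP=> x; rewrite !inE !mem_cat; case: (x \in A'); case: (x \in B'); rewrite ?orbT ?orbF.
    - by rewrite thickAC.
    - by rewrite sAC ltnW.
  apply: alt3S (sorted _ _ _ (theta_swap12 (theta_swap23 h)) _ _).
  - by apply/subsetP=> x; rewrite !inE !mem_cat; case: (x \in A'); case: (x \in B'); rewrite ?orbT ?orbF.
  - by rewrite thickC thickAC.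
  - by rewrite ltnW.
move=> h t; have [sAB|sBA] := leqP (size A) (size B); first exact: two.
apply: alt3S (two _ _ _ (theta_swap12 h) _ (ltnW sBA)); last by rewrite thickC.
by apply/subsetP=> x; rewrite !inE !mem_cat; case: (x \in A); case: (x \in B); rewrite ?orbT ?orbF.
Qed.

Lemma theta_extend V u v A B C : (forall z, conn e (V :\ z)) -> conn e V ->
  {subset u :: v :: A ++ B ++ C <= V} -> theta u v A B C -> thick (size A) (size B) (size C) ->
  good e V.
Proof.
move=> c1 c0 sV h t; set W := [set x in u :: v :: A ++ B ++ C].
have inW x : x \in u :: v :: A ++ B ++ C -> x \in W by rewrite [x \in W]inE.
have uW : u \in W by rewrite inW ?mem_head.
have a3 := theta_alt3 h t; case/and4P: h => pA pB pC U.
have eW : W :\ u = [set x in v :: A ++ B ++ C].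
  apply/setP=> x; rewrite !inE; have [->|] //= := eqVneq x u.
  by case/andP: U; rewrite inE => /negbTE ->.
have cW : conn e W.
  apply: (conn_from e_sym (u := u)) => x; rewrite inE inE => /predU1P[->|]; first exact: connect0.
  have sub s : s = A \/ s = B \/ s = C -> {subset rcons s v <= W}.
    move=> hs y; rewrite mem_rcons !inE !mem_cat.
    by case/predU1P=> [->|ys]; rewrite ?eqxx ?orbT //; case: hs => [<-|[]<-]; rewrite ys ?orbT.
  rewrite inE !mem_cat => hx.
  have [xA|nxA] := boolP (x \in u :: rcons A v).
    by apply: (conn_path_from pA) => //; apply: sub; left.
  have [xB|nxB] := boolP (x \in u :: rcons B v).
    by apply: (conn_path_from pB) => //; apply: sub; right; left.
  apply: (conn_path_from pC) => //; first by apply: sub; right; right.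
  move: hx nxA nxB; rewrite !inE !mem_rcons !inE !negb_or.
  by case/or4P=> ->; rewrite ?andbF ?orbT.
apply: (good_extend e_sym c1 c0 _ _ cW).
- by apply/subsetP=> x; rewrite inE => /sV.
- rewrite cardsE (card_uniqP U) /= !size_cat.
  by case/and4P: t; case: (size A) => [|[|a]]; case: (size B) => [|b];
    case: (size C) => [|c]; rewrite ?addSn ?addnS.
by move=> y yW; apply: alt3_base cW uW yW _ => //; rewrite eW.
Qed.

Lemma split_cycle Z u v : path.cycle e Z -> uniq Z -> u \in Z -> v \in Z -> u != v ->
  exists A B i, [/\ rot i Z = u :: A ++ v :: B, uniq (u :: A ++ v :: B),
    path e u (rcons A v) & path e u (rcons (rev B) v)].
Proof.
move=> cZ UZ uZ vZ uv; case/rot_to: (uZ) => i s def_s.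
have : v \in u :: s by rewrite -def_s mem_rot.
rewrite inE eq_sym (negbTE uv) /= => vs.
case/splitPr: vs def_s => A B def_s; exists A, B, i; split=> //.
  by rewrite -[_ && _]/(uniq (u :: A ++ v :: B)) -def_s rot_uniq.
  by have := cZ; rewrite -(rot_cycle i) def_s /= rcons_cat cat_path /= !rcons_path => /and3P[-> ->].
have := cZ; rewrite -(rot_cycle i) def_s /= rcons_cat cat_path /= => /and3P[_ _].
by rewrite (path_rcons_rev e_sym).
Qed.

End Thetas.

(** * The theorem of Wilson on sliding puzzles *)

(** Used to check that the paths of a theta graph found in another one are disjoint. *)
Lemma uniq_count (T : eqType) (s0 s : seq T) :
  uniq s0 -> (forall x, count_mem x s <= count_mem x s0) -> uniq s.
Proof.
move=> U h; apply: count_mem_uniq => x; have := h x; rewrite (count_uniq_mem _ U).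
have := has_pred1 x s; rewrite has_count => <-.
by case: (x \in s0); case: (count_mem x s) => [|[|k]].
Qed.

(** Inequalities between multiplicities are linear once the equality tests are abstracted. *)
Ltac count_lia :=
  move=> ?; rewrite /= ?count_cat ?count_rev /=;
  repeat match goal with |- context [nat_of_bool ?b] => generalize (nat_of_bool b) end;
  repeat match goal with |- context [count ?a ?s] => generalize (count a s) end;
  clear; intros; lia.

Ltac adj E := by rewrite /= ?E.

(** The vertices are numbered [u], [v], [a1], [a2], [b1], [b2], [m], where [u] and [v] are opposite
on the 6-cycle [u a1 a2 v b2 b1] and [m] is adjacent to both. *)
Definition theta0_adj (i j : nat) :=
  let E := [:: (0, 2); (2, 3); (3, 1); (0, 4); (4, 5); (5, 1); (0, 6); (6, 1)]%N in
  ((i, j) \in E) || ((j, i) \in E).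

(** Ends of an ear up to symmetry. The pairs of the second list are adjacent, so the ear needs an
inner vertex. *)
Definition theta0_rep (inner : bool) (i j : nat) :=
  ((i, j) \in [:: (0, 1); (2, 5); (0, 3); (2, 4); (6, 2)]%N) ||
  inner && ((i, j) \in [:: (0, 2); (2, 3); (6, 0)]%N).

Definition theta0_syms : seq (seq nat) :=
  [:: [:: 0; 1; 2; 3; 4; 5; 6]; [:: 0; 1; 4; 5; 2; 3; 6];
      [:: 1; 0; 3; 2; 5; 4; 6]; [:: 1; 0; 5; 4; 3; 2; 6]]%N.

Lemma theta0_rep_sym inner i j : i < 7 -> j < 7 -> i != j -> inner || ~~ theta0_adj i j ->
  exists sg i' j', [/\ sg \in theta0_syms, theta0_rep inner i' j' &
    (i, j) = (nth 0%N sg i', nth 0%N sg j') \/ (j, i) = (nth 0%N sg i', nth 0%N sg j')].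
Proof.
move=> hi hj ij hN.
have : has (fun sg => has (fun ij' : nat * nat =>
    theta0_rep inner ij'.1 ij'.2 && (((i, j) == (nth 0%N sg ij'.1, nth 0%N sg ij'.2)) ||
     ((j, i) == (nth 0%N sg ij'.1, nth 0%N sg ij'.2))))
    [:: (0, 1); (2, 5); (0, 3); (2, 4); (6, 2); (0, 2); (2, 3); (6, 0)]%N) theta0_syms.
  move: hi hj ij hN; case: i => [|[|[|[|[|[|[|i]]]]]]] // _; case: j => [|[|[|[|[|[|[|j]]]]]]] //;
  by case: inner; vm_compute.
case/hasP=> sg hsg /hasP[[i' j'] _ /andP[h1 h2]]; exists sg, i', j'; split=> //.
by case/orP: h2 => /eqP; [left|right].
Qed.

Section Wilson.
Variables (T : finType) (e : rel T).
Hypothesis e_sym : symmetric e.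
Implicit Types (x y z u v : T) (s P A B C : seq T) (W : {set T}).
Variable V : {set T}.
Hypothesis (c1 : forall z, conn e (V :\ z)) (c0 : conn e V).

Lemma theta_flip u v A B C : theta e u v A B C -> theta e v u (rev A) (rev B) (rev C).
Proof.
case/and4P=> h1 h2 h3 U; apply/and4P; split; rewrite -?(path_rcons_rev e_sym) //.
apply: uniq_count U _; count_lia.
Qed.

Definition theta0_ctx u v a1 a2 b1 b2 m P :=
  [/\ theta e u v [:: a1; a2] [:: b1; b2] [:: m], uniq ([:: u; v; a1; a2; b1; b2; m] ++ P)
    & {subset [:: u; v; a1; a2; b1; b2; m] ++ P <= V}].

Lemma theta0_swap u v a1 a2 b1 b2 m P :
  theta0_ctx u v a1 a2 b1 b2 m P -> theta0_ctx u v b1 b2 a1 a2 m P.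
Proof.
case=> h1 h2 h3; split; first exact: theta_swap12.
  by apply: uniq_count h2 _; count_lia.
by move=> x hx; apply: h3; move: hx; rewrite !inE; do ![case: (x == _) => //=].
Qed.

Lemma theta0_flip u v a1 a2 b1 b2 m P :
  theta0_ctx u v a1 a2 b1 b2 m P -> theta0_ctx v u a2 a1 b2 b1 m P.
Proof.
case=> h1 h2 h3; split; first exact: theta_flip h1.
  by apply: uniq_count h2 _; count_lia.
by move=> x hx; apply: h3; move: hx; rewrite !inE; do ![case: (x == _) => //=].
Qed.

Lemma theta0_rev u v a1 a2 b1 b2 m P :
  theta0_ctx u v a1 a2 b1 b2 m P -> theta0_ctx u v a1 a2 b1 b2 m (rev P).
Proof.
case=> h1 h2 h3; split=> //.
  by apply: uniq_count h2 _; count_lia.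
by move=> x hx; apply: h3; move: hx; rewrite !mem_cat mem_rev.
Qed.

Lemma theta0_edges u v a1 a2 b1 b2 m : theta e u v [:: a1; a2] [:: b1; b2] [:: m] ->
  [/\ e u a1, e a1 a2, e a2 v & [/\ e u b1, e b1 b2, e b2 v, e u m & e m v]].
Proof. by case/and4P=> /and4P[-> -> -> _] /and4P[-> -> -> _] /and3P[-> -> _]. Qed.

Definition theta0_seq u v a1 a2 b1 b2 m : seq T := [:: u; v; a1; a2; b1; b2; m].

(** In each position the ear and some paths of theta0 form a theta graph of other sizes; a second
choice is needed for the length of the ear for which the first one is theta0 again. *)
Lemma theta0_ear_rep u v a1 a2 b1 b2 m P i j :
  let L := theta0_seq u v a1 a2 b1 b2 m in
  theta0_ctx u v a1 a2 b1 b2 m P -> path e (nth u L i) (rcons P (nth u L j)) ->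
  theta0_rep (P != [::]) i j -> good e V.
Proof.
move=> L [/theta0_edges[e1 e2 e3 [e4 e5 e6 e7 e8]] U sV] pP.
have ext p' q' A B C : path e p' (rcons A q') -> path e p' (rcons B q') -> path e p' (rcons C q') ->
    (forall x, count_mem x (p' :: q' :: A ++ B ++ C) <=
               count_mem x ([:: u; v; a1; a2; b1; b2; m] ++ P)) ->
    thick (size A) (size B) (size C) -> good e V.
  move=> pA pB pC hc; have U' := uniq_count U hc.
  apply: (theta_extend e_sym c1 c0 (u := p') (v := q')); last by apply/and4P; split.
  move=> x hx; apply: sV; rewrite -has_pred1 has_count; apply: leq_trans (hc x).
  by rewrite -has_count has_pred1.
have sE x y : e x y -> e y x by rewrite e_sym.
have E := (e1, e2, e3, e4, e5, e6, e7, e8, (sE _ _ e1, sE _ _ e2, sE _ _ e3, sE _ _ e4,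
  (sE _ _ e5, sE _ _ e6, sE _ _ e7, sE _ _ e8))).
have chord : P != [::] -> 0 < size P by case: (P).
case/orP=> [|/andP[/chord P0]].
  rewrite !inE !xpair_eqE => /or4P[|||/orP[]] /andP[/eqP ? /eqP ?]; subst i j; rewrite /= in pP.
  - have [k1|k1] := eqVneq (size P) 1%N.
      apply: (ext u v [:: m] P [:: a1; a2]); [adj E|done|adj E|count_lia|by rewrite k1].
    apply: (ext u v [:: a1; a2] [:: b1; b2] P); [adj E|adj E|done|count_lia|].
    by case: (size P) k1 => [|[|k]].
  - have [k1|k1] := eqVneq (size P) 1%N.
      case: P k1 pP U sV ext {chord} => [|x [|? ?]] // _ /and3P[a1x xb2 _] U sV ext.
      apply: (ext v b2 [::] [:: m; u; b1] [:: a2; a1; x]);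
        [adj E|adj E|by rewrite /= ?E a1x xb2|count_lia|done].
    apply: (ext a1 b2 [:: a2; v] [:: u; b1] P); [adj E|adj E|done|count_lia|].
    by case: (size P) k1 => [|[|k]].
  - apply: (ext u a2 [:: a1] [:: b1; b2; v] P); [adj E|adj E|done|count_lia|].
    by case: (size P) => [|[|[|k]]].
  - apply: (ext a1 b1 [:: u] [:: a2; v; b2] P); [adj E|adj E|done|count_lia|].
    by case: (size P) => [|[|[|k]]].
  have [k2|k2] := eqVneq (size P) 2.
    case: P k2 pP U sV ext {chord} => [|x [|y [|? ?]]] // _ /and4P[mx xy ya1 _] U sV ext.
    apply: (ext m v [::] [:: u; b1; b2] [:: x; y; a1; a2]);
      [adj E|adj E|by rewrite /= ?E mx xy ya1|count_lia|done].
  apply: (ext m a1 [:: u] [:: v; a2] P); [adj E|adj E|done|count_lia|].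
  by case: (size P) k2 => [|[|[|k]]].
rewrite !inE !xpair_eqE => /or3P[] /andP[/eqP ? /eqP ?]; subst i j; rewrite /= in pP.
- apply: (ext u a1 [::] [:: b1; b2; v; a2] P); [adj E|adj E|done|count_lia|].
  by case: (size P) P0 => [|[|[|k]]].
- apply: (ext a1 a2 [::] [:: u; b1; b2; v] P); [adj E|adj E|done|count_lia|].
  by case: (size P) P0 => [|[|[|k]]].
apply: (ext m u [::] [:: v; a2; a1] P); [adj E|adj E|done|count_lia|].
by case: (size P) P0 => [|[|[|k]]].
Qed.

(** Up to the symmetries of theta0 and the reversal of the ear there are eight positions. *)
Lemma theta0_ear u v a1 a2 b1 b2 m P i j :
  let L := theta0_seq u v a1 a2 b1 b2 m in
  theta0_ctx u v a1 a2 b1 b2 m P -> path e (nth u L i) (rcons P (nth u L j)) ->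
  i < 7 -> j < 7 -> i != j -> (P != [::]) || ~~ theta0_adj i j -> good e V.
Proof.
move=> L h pP hi hj ij hN.
have [sg [i' [j' [hsg hrep hij]]]] := theta0_rep_sym hi hj ij hN.
have [i7 j7] : i' < 7 /\ j' < 7.
  by case/orP: hrep => [|/andP[_]]; rewrite !inE !xpair_eqE;
    [case/or4P=> [|||/orP[]]|case/or3P] => /andP[/eqP-> /eqP->].
have [P' hP' [h' pP']] : exists2 P', (P' != [::]) = (P != [::]) &
    theta0_ctx u v a1 a2 b1 b2 m P' /\
    path e (nth u L (nth 0%N sg i')) (rcons P' (nth u L (nth 0%N sg j'))).
  case: hij => [[<- <-]|[<- <-]]; first by exists P.
  exists (rev P); first by case: (P) => // x s; rewrite rev_cons; case: (rev s).
  by split; [exact: theta0_rev | rewrite -(path_rcons_rev e_sym)].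
rewrite -hP' in hrep; move: pP'.
have nthE sg' k : size sg' = 7 -> k < 7 -> nth u L (nth 0%N sg' k) = nth u (map (nth u L) sg') k.
  by move=> s7 hk; rewrite (nth_map 0%N) // s7.
have s7 : size sg = 7 by move: hsg; rewrite !inE => /or4P[]/eqP->.
rewrite !nthE //; move: hsg; rewrite !inE => /or4P[]/eqP-> /= pP'.
- exact: theta0_ear_rep h' pP' hrep.
- exact: theta0_ear_rep (theta0_swap h') pP' hrep.
- apply: theta0_ear_rep (theta0_flip h') _ hrep.
  by rewrite !(set_nth_default u v).
apply: theta0_ear_rep (theta0_swap (theta0_flip h')) _ hrep.
by rewrite !(set_nth_default u v).
Qed.

Definition exact_cycle := exists Z, [/\ uniq Z, 2 < size Z, V =i Z &
  {in Z &, forall x y, e x y = (y == next Z x) || (x == next Z y)}].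

Definition exact_theta0 := exists u L, [/\ uniq L, size L = 7, V =i L &
  forall i j, i < 7 -> j < 7 -> e (nth u L i) (nth u L j) = theta0_adj i j].

Hypothesis e_irr : irreflexive e.
Hypothesis V3 : 2 < #|V|.

(** An edge together with an ear on it. *)
Lemma cycle_exists : exists Z, [/\ path.cycle e Z, uniq Z, 2 < size Z & {subset Z <= V}].
Proof.
have /card_gt0P[a aV] : 0 < #|V| by apply: ltnW (ltnW V3).
have [b [bV ab]] : exists b, b \in V /\ e a b.
  have [d1 [d2 [d1V d2V]]] := other_two V3 aV; rewrite uniq3 => /and3P[ad _ _].
  have [s [ps ls _ sV]] := conn_path c0 aV d1V.
  case: s ps ls sV => [_ /= ad'|b s /= /andP[ab _] _ sV]; first by rewrite ad' eqxx in ad.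
  by exists b; rewrite sV ?mem_head.
have nab : a != b by apply: contraTneq ab => ->; rewrite e_irr.
have [|||u [v [P [[uW vW uv pP [UP PW]] P0]]]] := @ear_exists _ e V [set a; b] c1 c0.
- by apply/subsetP=> x; rewrite !inE => /orP[]/eqP->.
- by rewrite cards2 nab.
- by apply: contraTneq V3 => <-; rewrite cards2 nab.
have vu : e v u.
  by move: uW vW uv; rewrite !inE => /orP[]/eqP-> /orP[]/eqP->; rewrite ?eqxx // e_sym.
have out x : x \in [set a; b] -> x \notin P.
  by move=> xW; apply: contraTN xW => /PW; rewrite inE => /andP[].
exists (u :: rcons P v); split.
- by rewrite /= rcons_path pP last_rcons.
- by rewrite /= mem_rcons inE negb_or uv out //= rcons_uniq UP out.
- by rewrite /= size_rcons; case: (P) P0.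
move=> x; rewrite inE mem_rcons inE.
have inV y : y \in [set a; b] -> y \in V by rewrite !inE => /orP[]/eqP->.
case/or3P=> [/eqP->|/eqP->|/PW]; [exact: inV|exact: inV|by rewrite inE => /andP[]].
Qed.

(** Among the sizes of simple theta graphs only those of theta0 are not [thick]. *)
Lemma theta_or_theta0 u v A B C : theta e u v A B C -> 0 < size A + size B ->
  0 < size A + size C -> 0 < size B + size C -> {subset u :: v :: A ++ B ++ C <= V} ->
  good e V \/ exists a1 a2 b1 b2 m, theta0_ctx u v a1 a2 b1 b2 m [::].
Proof.
move=> h s1 s2 s3 sV.
have [t|] := boolP (thick (size A) (size B) (size C)).
  by left; exact: (theta_extend e_sym c1 c0 sV h t).
have fin A' B' C' : theta e u v A' B' C' -> size A' = 2 -> size B' = 2 -> size C' = 1%N ->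
    {subset u :: v :: A' ++ B' ++ C' <= V} ->
    exists a1 a2 b1 b2 m, theta0_ctx u v a1 a2 b1 b2 m [::].
  case: A' => [|a1 [|a2 []]] //; case: B' => [|b1 [|b2 []]] //; case: C' => [|m []] // h' _ _ _ sV'.
  by exists a1, a2, b1, b2, m; split=> //; case/and4P: h'.
have subs A' B' C' : perm_eq (A' ++ B' ++ C') (A ++ B ++ C) ->
    {subset u :: v :: A' ++ B' ++ C' <= V}.
  by move=> p x; rewrite !inE (perm_mem p) => hx; apply: sV; rewrite !inE.
rewrite /thick s1 s2 s3 /= negbK !inE !xpair_eqE => hs; right.
case/or3P: hs => /andP[/andP[/eqP sA /eqP sB] /eqP sC].
- apply: (fin B C A (theta_swap23 (theta_swap12 h)) sB sC sA); apply: subs.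
  by rewrite catA perm_catC.
- apply: (fin A C B (theta_swap23 h) sA sC sB); apply: subs.
  by rewrite perm_cat2l perm_catC.
exact: (fin A B C).
Qed.

(** Unless the graph is a cycle, some cycle has an ear, or a chord if it is spanning, and forms a
theta graph with it. If the latter is theta0 and is not the whole graph, there is again an ear or a
chord. *)
Lemma wilson : good e V \/ exact_cycle \/ exact_theta0.
Proof.
have [Z [cZ UZ Z3 ZV]] := cycle_exists.
have [eZ|nZ] := eqVneq [set x in Z] V; last first.
  have [||u [v [P [[uW vW uv pP [UP PW]] P0]]]] := @ear_exists _ e V [set x in Z] c1 c0 _ _ nZ.
  - by apply/subsetP=> x; rewrite inE => /ZV.
  - by rewrite cardsE (card_uniqP UZ) ltnW.
  rewrite !inE in uW vW; have [A [B [i [def_Z UAB pA pB]]]] := split_cycle e_sym cZ UZ uW vW uv.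
  have inZ x : x \in Z -> x \notin P.
    by move=> xZ; apply/negP=> /PW; rewrite !inE xZ.
  have memZ x : (x \in u :: A ++ v :: B) = (x \in Z) by rewrite -def_Z mem_rot.
  have h : theta e u v A (rev B) P.
    apply/and4P; split=> //.
    have : uniq ((u :: A ++ v :: B) ++ P).
      by rewrite cat_uniq UAB UP andbT; apply/hasPn=> x; apply: contraL; rewrite /= memZ; apply: inZ.
    by move/uniq_count; apply; count_lia.
  have sZ : 0 < size A + size B.
    by have := Z3; rewrite -(size_rot i) def_Z /= size_cat /= addnS.
  have P1 : 0 < size P by case: (P) P0.
  have sV : {subset u :: v :: A ++ rev B ++ P <= V}.
    move=> x hx; have [/PW|xP] := boolP (x \in P); first by rewrite inE => /andP[].
    apply: ZV; rewrite -memZ; move: hx; rewrite !inE !mem_cat mem_rev inE (negbTE xP) orbF.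
    by case: (x == u); case: (x == v); case: (x \in A).
  have s1 : 0 < size A + size (rev B) by rewrite size_rev.
  have [|h0] := theta_or_theta0 h s1 (ltn_addl _ P1) (ltn_addl _ P1) sV; first by left.
  case: h0 => a1 [a2 [b1 [b2 [m h0]]]]; set L := theta0_seq u v a1 a2 b1 b2 m.
  have UL : uniq L by case: h0 => _; rewrite cats0.
  have LV : {subset L <= V} by case: h0 => _ _; rewrite cats0.
  have [eL|nL] := eqVneq [set x in L] V; last first.
    have [||p [q [Q [[pW qW pq pQ [UQ QW]] Q0]]]] := @ear_exists _ e V [set x in L] c1 c0 _ _ nL.
    - by apply/subsetP=> x; rewrite inE => /LV.
    - by rewrite cardsE (card_uniqP UL).
    left; rewrite !in_set in pW qW; have [i1 hi def_p] := nthP u pW; have [j1 hj def_q] := nthP u qW.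
    have hQ : theta0_ctx u v a1 a2 b1 b2 m Q.
      case: h0 => h1 h2 h3; split=> //.
        rewrite cats0 in h2; rewrite cat_uniq h2 UQ andbT; apply/hasPn=> x /QW.
        by rewrite !inE => /andP[].
      by move=> x; rewrite mem_cat => /orP[/LV|/QW] //; rewrite inE => /andP[].
    apply: (theta0_ear hQ (i := i1) (j := j1)); rewrite ?Q0 // -?/L ?def_p ?def_q //.
    by apply: contraNneq pq => e1; rewrite -def_p -def_q e1.
  have [hE|] := boolP [forall i : 'I_7, forall j : 'I_7, e (nth u L i) (nth u L j) == theta0_adj i j].
    right; right; exists u, L; split=> //; first by move=> x; rewrite -eL inE.
    move=> i1 j1 hi hj; exact: eqP (forallP (forallP hE (Ordinal hi)) (Ordinal hj)).
  rewrite negb_forall => /existsP[i1]; rewrite negb_forall => /existsP[j1] hN; left.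
  have [E1|E1] := boolP (theta0_adj i1 j1).
    case/negP: hN; rewrite E1; case: h0 => /theta0_edges[e1 e2 e3 [e4 e5 e6 e7 e8]] _ _.
    by case/orP: E1; rewrite !inE !xpair_eqE; case/or4P=> [|||/or4P[|||/orP[]]];
      case/andP=> /eqP-> /eqP-> /=; rewrite ?e1 ?e2 ?e3 ?e4 ?e5 ?e6 ?e7 ?e8 //;
      rewrite e_sym ?e1 ?e2 ?e3 ?e4 ?e5 ?e6 ?e7 ?e8.
  have e12 : e (nth u L i1) (nth u L j1) by move: hN; rewrite (negbTE E1) eqbF_neg negbK.
  apply: (theta0_ear h0 (i := i1) (j := j1)); rewrite ?E1 //= -?/L ?e12 //.
  by apply: contraTneq e12 => ->; rewrite e_irr.
have [hE|] := boolP [forall x in Z, forall y in Z, e x y == (y == next Z x) || (x == next Z y)].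
  right; left; exists Z; split=> //; first by move=> x; rewrite -eZ inE.
  by move=> x y xZ yZ; exact: eqP (forall_inP (forall_inP hE x xZ) y yZ).
rewrite negb_forall_in => /exists_inP[x xZ]; rewrite negb_forall_in => /exists_inP[y yZ] hN.
have nextE z : z \in Z -> e z (next Z z) by move=> zZ; apply: next_cycle.
have [exy|nexy] := boolP (e x y); last first.
  case/negP: hN; rewrite (negbTE nexy) eq_sym eqbF_neg negb_or.
  by apply/andP; split; apply: contraNneq nexy => ->; rewrite ?nextE // e_sym nextE.
move: hN; rewrite exy eq_sym eqb_id negb_or => /andP[yx xy]; left.
have nxy : x != y by apply: contraTneq exy => ->; rewrite e_irr.
have [A [B [i [def_Z UAB pA pB]]]] := split_cycle e_sym cZ UZ xZ yZ nxy.
have A0 : 0 < size A.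
  case: (A) def_Z UAB => // def_Z UAB; case/eqP: yx.
  by rewrite -(next_rot i UZ) def_Z /= eqxx.
have B0 : 0 < size B.
  case: (B) def_Z UAB => // def_Z UAB; case/eqP: xy.
  rewrite -(next_rot i UZ) def_Z -(next_rot 1 UAB) rot1_cons -cats1 -catA.
  by rewrite next_infix ?eqxx //; have := UAB; rewrite -(rot_uniq 1) rot1_cons -cats1 -catA.
have h : theta e x y A (rev B) [::].
  apply/and4P; split=> //; first by rewrite /= exy.
  by apply: uniq_count UAB _; count_lia.
have sV : {subset x :: y :: A ++ rev B ++ [::] <= V}.
  move=> t ht; apply: ZV; rewrite -(mem_rot i) def_Z; move: ht.
  rewrite cats0 !inE !mem_cat mem_rev inE; by case: (t == x); case: (t == y); case: (t \in A).
apply: (theta_extend e_sym c1 c0 sV h); rewrite size_rev.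
by case: (size A) A0 => // a _; case: (size B) B0 => // b _; rewrite /thick !inE !xpair_eqE !andbF.
Qed.

End Wilson.

(** * Deleting vertices from highly connected graphs *)

Section Deletions.
Variables (T : finType) (e : rel T).
Hypotheses (e_sym : symmetric e) (e_irr : irreflexive e).
Implicit Types (x y z u v : T) (V W U : {set T}).

(** [good e V] would let the blank leave [V] on its tours; restricting the edges keeps it inside,
which is what allows the tokens off [V] to stay where they are. *)
Definition mobile V := good (induced e V) V.

Definition nbhd V x := [set y in V | e x y].

Definition bip V :=
  [exists f : {ffun T -> bool}, [forall x in V, forall y in V, e x y ==> (f x != f y)]].

Lemma bipP V : reflect (exists f : T -> bool, {in V &, forall x y, e x y -> f x != f y}) (bip V).
Proof.
apply: (iffP existsP) => [[f /forall_inP h]|[f h]].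
  by exists f => x y xV yV; apply/implyP; move/forall_inP: (h x xV); apply.
exists [ffun x => f x]; apply/forall_inP=> x xV; apply/forall_inP=> y yV; apply/implyP.
by rewrite !ffunE; apply: h.
Qed.

Lemma conn_induced V W : W \subset V -> conn e W -> conn (induced e V) W.
Proof.
move=> sWV cW x y xW yW; have := cW x y xW yW; apply: connect_sub => a b /and3P[aW bW ab].
by apply: connect1; rewrite /induced aW bW !(subsetP sWV).
Qed.

(** The neighbours of [x] separate it from the other vertices. *)
Lemma min_degree k V x : kconn e k V -> x \in V -> k <= #|nbhd V x|.
Proof.
case=> hV hc xV; rewrite leqNgt; apply/negP=> hN.
have xW : x \in V :\: nbhd V x by rewrite !inE e_irr andbF.
have [w wW wx] : exists2 w, w \in V :\: nbhd V x & w != x.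
  have : 0 < #|(V :\: nbhd V x) :\ x|.
    rewrite -(ltn_add2l 1%N) -[1%N in X in _ < X](erefl (nat_of_bool true)).
    move: (cardsD1 x (V :\: nbhd V x)); rewrite xW => <-.
    rewrite cardsD (setIidPr _); last by apply/subsetP=> y; rewrite inE => /andP[].
    by rewrite addn0 ltn_subRL addn1; apply: leq_ltn_trans hV.
  by case/card_gt0P=> w; rewrite in_setD1 => /andP[wx wW]; exists w.
have [s [ps ls _ sW]] := conn_path (hc _ hN) xW wW.
case: s ps ls sW => [_ /= xw|y s /= /andP[xy _] _ sW]; first by rewrite xw eqxx in wx.
by have := sW y (mem_head _ _); rewrite !inE xy andbT andNb.
Qed.

(** An ear of the triangle makes it a theta graph one path of which is an edge. *)
Lemma triangle_mobile V a b d : kconn e 2 V -> 3 < #|V| -> a \in V -> b \in V -> d \in V ->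
  e a b -> e b d -> e a d -> mobile V.
Proof.
move=> k2 V4 aV bV dV ab bd ad.
have on_s := induced_sym e_sym V.
have c1 z : conn (induced e V) (V :\ z).
  by apply: conn_induced; [exact: subsetDl | apply: kconn_conn (kconnD1 z k2)].
have c0 : conn (induced e V) V by apply: conn_induced => //; apply: kconn_conn k2.
have neq x y : e x y -> x != y by apply: contraTneq => ->; rewrite e_irr.
have [ba db da] : [/\ e b a, e d b & e d a] by rewrite !(e_sym d) (e_sym b).
set W := [set a; b; d].
have sWV : W \subset V by apply/subsetP=> x; rewrite !inE -orbA => /or3P[]/eqP->.
have W3 : #|W| = 3.
  by rewrite /W setUC cardsU1 cards2 neq // !inE negb_or ![d == _]eq_sym !neq.
have [||p [q [P [[pW qW pq pP [UP PW]] P0]]]] := ear_exists c1 c0 sWV; rewrite ?W3 //.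
  by apply: contraTneq V4 => <-; rewrite W3.
have [t [tW pt tq tp qt]] : exists t, [/\ t \in W, e p t, e t q, t != p & t != q].
  move: pW qW pq; rewrite !inE -!orbA.
  case/or3P=> /eqP-> /or3P[]/eqP->; rewrite ?eqxx // => _;
    [exists d|exists b|exists d|exists a|exists b|exists a];
    split; rewrite ?inE ?eqxx ?orbT ?neq //.
have out x : x \in W -> x \notin P.
  by move=> xW; apply: contraTN xW => /PW; rewrite inE => /andP[].
have inV x : x \in W -> x \in V by move/(subsetP sWV).
have epq : e p q.
  move: pW qW pq; rewrite !inE -!orbA.
  by case/or3P=> /eqP-> /or3P[]/eqP->; rewrite ?eqxx.
have onE x y : x \in W -> y \in W -> e x y -> induced e V x y by move=> xW yW xy; rewrite /induced !inV.
have h : theta (induced e V) p q [::] [:: t] P.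
  apply/and4P; split=> //; first by rewrite /= onE.
    by rewrite /= !onE.
  rewrite /= !inE !negb_or pq ![_ == t]eq_sym tp qt !out //.
apply: (theta_extend on_s c1 c0 _ h); last by case: (size P) (P) P0 => [|k] [].
move=> x; rewrite !inE => /or4P[/eqP->|/eqP->|/eqP->|/PW]; try exact: inV.
by rewrite inE => /andP[].
Qed.

Lemma exact_degrees V : exact_cycle (induced e V) V \/ exact_theta0 (induced e V) V ->
  exists a b, [/\ a \in V, b \in V, e a b, #|nbhd V a| <= 2 & #|nbhd V b| <= 2].
Proof.
case=> [[Z [UZ Z3 VZ hE]]|[u [L [UL L7 VL hE]]]].
  have deg x : x \in V -> #|nbhd V x| <= 2.
    move=> xV; apply: leq_trans (_ : #|[set next Z x; prev Z x]| <= 2); last by rewrite cards2; case: eqP.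
    apply/subset_leq_card/subsetP=> y; rewrite !inE => /andP[yV xy].
    have : induced e V x y by rewrite /induced xV yV.
    rewrite hE -?VZ // => /orP[->//|/eqP->]; by rewrite (prev_next UZ) eqxx orbT.
  case: Z UZ Z3 VZ hE deg => // a Z UZ Z3 VZ hE deg.
  have aV : a \in V by rewrite VZ mem_head.
  have bV : next (a :: Z) a \in V by rewrite VZ mem_next mem_head.
  exists a, (next (a :: Z) a); split; rewrite ?deg //.
  by have := hE a (next (a :: Z) a); rewrite -!VZ eqxx => /(_ aV bV) /and3P[].
have nV i : i < 7 -> nth u L i \in V by rewrite VL -L7 => /mem_nth.
have adj i j : i < 7 -> j < 7 -> e (nth u L i) (nth u L j) = theta0_adj i j.
  by move=> hi hj; rewrite -hE // /induced !nV.
exists (nth u L 2), (nth u L 3); rewrite !nV // adj //; split=> //.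
  apply: leq_trans (_ : #|[set nth u L 0; nth u L 3]| <= 2); last by rewrite cards2; case: eqP.
  apply/subset_leq_card/subsetP=> y; rewrite !inE VL => /andP[/(nthP u)[j]]; rewrite L7 => hj <-.
  rewrite adj // => h; have : (j == 0%N) || (j == 3) by move: hj h; case: j => [|[|[|[|[|[|[|j]]]]]]].
  by case/orP=> /eqP->; rewrite eqxx ?orbT.
apply: leq_trans (_ : #|[set nth u L 1; nth u L 2]| <= 2); last by rewrite cards2; case: eqP.
apply/subset_leq_card/subsetP=> y; rewrite !inE VL => /andP[/(nthP u)[j]]; rewrite L7 => hj <-.
rewrite adj // => h; have : (j == 1%N) || (j == 2) by move: hj h; case: j => [|[|[|[|[|[|[|j]]]]]]].
by case/orP=> /eqP->; rewrite eqxx ?orbT.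
Qed.

Lemma wilson_induced V : kconn e 2 V ->
  mobile V \/ exact_cycle (induced e V) V \/ exact_theta0 (induced e V) V.
Proof.
move=> k2; apply: wilson.
- exact: induced_sym.
- by move=> z; apply: conn_induced; [exact: subsetDl | apply: kconn_conn (kconnD1 z k2)].
- by apply: conn_induced => //; apply: kconn_conn k2.
- by move=> x; rewrite /induced e_irr !andbF.
- by case: k2.
Qed.

(** A cycle and theta0 have two adjacent vertices of degree 2. Their degree in [V] is at least [r +
3], so they are adjacent to all the [r + 1] vertices of [U]. *)
Lemma mobile_or_triangle r V U : kconn e (r.+1 + 2) V -> U \subset V -> #|U| = r.+1 ->
  mobile (V :\: U) \/
  exists a b u, [/\ a \in V :\: U, b \in V :\: U, u \in U & [/\ e a b, e a u & e b u]].
Proof.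
move=> kV sUV cU; have k2 : kconn e 2 (V :\: U) by apply: kconn_sub kV _; rewrite cU.
have [|/exact_degrees[a [b [aW bW ab da db]]]] := wilson_induced k2; [by left|right].
have /card_gt0P[u uU] : 0 < #|U| by rewrite cU.
have sub x : x \in V :\: U -> #|nbhd (V :\: U) x| <= 2 -> e x u.
  rewrite inE => /andP[xU xV] dx; have dV := min_degree kV xV.
  have hU : #|U| <= #|nbhd V x :&: U|.
    rewrite cU -(leq_add2r 2); apply: leq_trans dV _.
    rewrite -(cardsID U) leq_add2l; apply: leq_trans dx.
    apply/subset_leq_card/subsetP=> y; rewrite !inE => /and3P[-> -> ->] //.
  have /eqP eU : nbhd V x :&: U == U by rewrite eqEcard subsetIr.
  by move: uU; rewrite -eU !inE => /andP[/andP[]].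
by exists a, b, u; rewrite !sub.
Qed.

Lemma bip_mobile r V U : kconn e (r.+1 + 2) V -> U \subset V -> #|U| = r.+1 -> bip V ->
  mobile (V :\: U).
Proof.
move=> kV sUV cU /bipP[f hf].
have [//|[a [b [u [aW bW uU [ab au bu]]]]]] := mobile_or_triangle kV sUV cU.
have [aV bV uV] : [/\ a \in V, b \in V & u \in V].
  by move: aW bW; rewrite !inE => /andP[_ ->] /andP[_ ->]; rewrite (subsetP sUV).
have := hf a b aV bV ab; have := hf a u aV uV au; have := hf b u bV uV bu.
by case: (f a); case: (f b); case: (f u).
Qed.

Lemma bip_unique W (f g : T -> bool) : conn e W ->
  {in W &, forall x y, e x y -> f x != f y} -> {in W &, forall x y, e x y -> g x != g y} ->
  {in W &, forall x y, f x (+) g x = f y (+) g y}.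
Proof.
move=> cW hf hg x y xW yW; have /connectP[s ps ->] := cW x y xW yW.
elim: s x ps {xW} => //= z s IH x /andP[/and3P[xW zW xz] /IH <-].
have := hf x z xW zW xz; have := hg x z xW zW xz.
by case: (f x); case: (f z); case: (g x); case: (g z).
Qed.

(** Suppose all deletions of a vertex are bipartite, and colour [V :\ y]. If two neighbours [p] and
[q] of [y] had different colours, then so would they in the colouring of [V :\ z] for any other
vertex [z], as the two colourings agree or are opposite on the connected set left without [y] and
[z]; but there both are adjacent to [y]. So [y] can be coloured. *)
Lemma bip_deletion V : kconn e 3 V -> ~~ bip V -> exists2 z, z \in V & ~~ bip (V :\ z).
Proof.
move=> kV nb; apply/exists_inP; apply: contraNT nb => /exists_inPn hb.
have {}hb z : z \in V -> bip (V :\ z) by move/hb; rewrite negbK.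
have /card_gt0P[y yV] : 0 < #|V| by case: kV => h _; apply: leq_trans h.
have /bipP[f hf] := hb y yV.
have [/exists_inP[p pN /exists_inP[q qN fpq]]|no] :=
  boolP [exists p in nbhd V y, exists q in nbhd V y, f p != f q].
  have [pV yp] : p \in V /\ e y p by move: pN; rewrite inE => /andP[].
  have [qV yq] : q \in V /\ e y q by move: qN; rewrite inE => /andP[].
  have [z zV /norP[zy /norP[zp zq]]] : exists2 z, z \in V & ~~ [|| z == y, z == p | z == q].
    have : 0 < #|V :\: [set y; p; q]|.
      rewrite cardsD subn_gt0; case: kV => h _; apply: leq_ltn_trans h.
      apply: leq_trans (subset_leq_card (subsetIr _ _)) _; rewrite setUC cardsU1 cards2.
      by case: (_ \notin _); case: (_ == _).
    by case/card_gt0P=> z; rewrite !inE -orbA => /andP[h zV]; exists z.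
  have /bipP[g hg] := hb z zV.
  have neq x t : e x t -> t != x by apply: contraTneq => ->; rewrite e_irr.
  have cW : conn e (V :\: [set y; z]).
    by case: kV => _; apply; rewrite cards2; case: (_ == _).
  have hfg := bip_unique (f := f) (g := g) cW.
  have inW x : x \in V :\: [set y; z] = [&& x \in V, x != y & x != z].
    by rewrite !inE negb_or andbC.
  have [yz pz qz] : [/\ y != z, p != z & q != z] by rewrite ![_ == z]eq_sym.
  have gyp : g y != g p by apply: hg; rewrite ?inE ?yV ?pV ?yz ?pz.
  have gyq : g y != g q by apply: hg; rewrite ?inE ?yV ?qV ?yz ?qz.
  have : f p (+) g p = f q (+) g q.
    apply: hfg; rewrite ?inW ?pV ?qV ?(neq y) ?pz ?qz //.
    - move=> x t; rewrite !inW => /and3P[xV xy xz] /and3P[tV ty tz].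
      by apply: hf; rewrite !inE ?xy ?ty.
    move=> x t; rewrite !inW => /and3P[xV xy xz] /and3P[tV ty tz].
    by apply: hg; rewrite !inE ?xz ?tz.
  by move: fpq gyp gyq; case: (f p); case: (f q); case: (g p); case: (g q); case: (g y).
have same p q : p \in V -> q \in V -> e y p -> e y q -> f p = f q.
  move=> pV qV yp yq; apply/eqP; apply: contraNT no => h.
  apply/exists_inP; exists p; first by rewrite inE pV yp.
  by apply/exists_inP; exists q; rewrite ?inE ?qV ?yq.
apply/bipP; exists (fun x => if x == y then ~~ [exists p in nbhd V y, f p] else f x).
have col p : p \in V -> e y p -> [exists p in nbhd V y, f p] = f p.
  move=> pV yp; apply/exists_inP/idP => [[q]|fp]; last by exists p; rewrite ?inE ?pV.
  by rewrite inE => /andP[qV yq]; rewrite (same q p).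
move=> x t xV tV xt; have [ex|xy] := eqVneq x y; have [et|ty] := eqVneq t y.
- by rewrite ex et e_irr in xt.
- by rewrite ex in xt; rewrite (col t) //; case: (f t).
- by rewrite et e_sym in xt; rewrite (col x) //; case: (f x).
by apply: hf; rewrite ?inE ?xy ?ty.
Qed.

(** If the vertex [z0] given by [bip_deletion] does not do, it is on a triangle, and any vertex off
this triangle can be deleted instead: the triangle ensures both properties. *)
Lemma nonbip_mobile_deletion k V : kconn e k.+3 V -> ~~ bip V ->
  exists2 z, z \in V & ~~ bip (V :\ z) /\ mobile (V :\ z).
Proof.
move=> kV nb; have k3 : kconn e 3 V by apply: kconnW kV.
have [z0 z0V nb0] := bip_deletion k3 nb.
have [||h|[a [b [u]]]] := @mobile_or_triangle 0 V [set z0] k3; rewrite ?sub1set ?cards1 //.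
  by exists z0.
rewrite !inE => -[/andP[az aV] /andP[bz bV] /eqP-> [ab au bu]].
(* with at most four vertices, two positions are left besides z0 and that of the blank, and there
are no 3-cycles *)
have [V4|V5] := leqP #|V| 4.
  exists z0 => //; split=> // y yV; apply: alt3_small.
  by rewrite (cardsD1 z0) z0V (cardsD1 y) yV in V4.
have [z1 z1V /norP[n1 /norP[n2 n3]]] : exists2 z, z \in V & ~~ [|| z == a, z == b | z == z0].
  have : 0 < #|V :\: [set a; b; z0]|.
    rewrite cardsD subn_gt0; apply: leq_ltn_trans (ltnW V5).
    apply: leq_trans (subset_leq_card (subsetIr _ _)) _; rewrite setUC cardsU1 cards2.
    by case: (_ \notin _); case: (_ == _).
  by case/card_gt0P=> z; rewrite !inE -orbA => /andP[h zV]; exists z.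
have [aW bW uW] : [/\ a \in V :\ z1, b \in V :\ z1 & z0 \in V :\ z1].
  by rewrite !inE ![_ == z1]eq_sym n1 n2 n3 aV bV z0V.
exists z1 => //; split; last first.
  apply: (triangle_mobile (a := a) (b := b) (d := z0)) => //; first exact: kconnD1 k3.
  by rewrite (cardsD1 z1) z1V in V5.
apply/bipP=> -[f hf]; have := hf a b aW bW ab; have := hf a z0 aW uW au; have := hf b z0 bW uW bu.
by case: (f a); case: (f b); case: (f z0).
Qed.

Lemma nonbip_mobile_deletions r V : kconn e (r.+1 + 2) V -> ~~ bip V ->
  exists U, [/\ U \subset V, #|U| = r.+1, ~~ bip (V :\: U) & mobile (V :\: U)].
Proof.
elim: r V => [|r IH] V kV nb.
  have [z zV [h1 h2]] := nonbip_mobile_deletion kV nb.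
  by exists [set z]; rewrite sub1set cards1.
have kV' : kconn e (r + 1).+3 V by rewrite addn1; rewrite addn2 in kV.
have [z zV [h1 _]] := nonbip_mobile_deletion kV' nb.
have [|U [sU cU h2 h3]] := IH (V :\ z) _ h1; first by apply: kconnD1; rewrite -addSn.
have zU : z \notin U by apply/negP=> /(subsetP sU); rewrite !inE eqxx.
exists (z |: U); rewrite -setDDl cardsU1 zU cU; split=> //.
by rewrite subUset sub1set zV (subset_trans sU) // subsetDl.
Qed.

End Deletions.

(** * Placing the tokens that cannot be exchanged with the blank *)

Lemma slides_induced_fix (T : finType) (e : rel T) (V : {set T}) c p q a :
  slides (induced e V) c p q -> p a \notin V -> q a = p a.
Proof.
case/connectP=> s ps -> {q}; elim: s p ps => //= q s IH p /andP[/andP[/and3P[pV qV _] /eqP dq]].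
move=> /IH h paV; have qa : q a = p a.
  rewrite dq permM tpermD //; first by apply: contraNneq paV => <-.
  by apply: contraNneq paV => <-.
by rewrite h qa.
Qed.

Lemma perm_of_sets (T : finType) (V W : {set T}) : #|V| = #|W| ->
  exists p : {perm T}, p @: V = W.
Proof.
move=> cVW; pose s1 := enum V ++ enum (~: V); pose s2 := enum W ++ enum (~: W).
have U U' : uniq (enum (U' : {set T}) ++ enum (~: U')).
  rewrite cat_uniq !enum_uniq andbT /=; apply/hasPn=> x; rewrite !mem_enum inE.
  by [].
have m1 x : x \in s1 by rewrite mem_cat !mem_enum inE orbN.
have sz : size s1 = size s2.
  by rewrite !size_cat -!cardE [#|~: V|]cardsCs [#|~: W|]cardsCs !setCK cVW.
pose f x := nth x s2 (index x s1).
have finj : injective f.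
  move=> x y; rewrite /f (set_nth_default x y); last by rewrite -sz index_mem.
  move/eqP; rewrite nth_uniq ?U // -?sz ?index_mem // => /eqP h.
  by rewrite -(nth_index x (m1 x)) h nth_index.
exists (perm finj); apply/eqP; rewrite eqEcard card_imset ?cVW ?leqnn ?andbT; last exact: perm_inj.
apply/subsetP=> _ /imsetP[x xV ->]; rewrite permE /f.
have xi : index x s1 < size (enum V) by rewrite index_cat mem_enum xV index_mem mem_enum.
by rewrite nth_cat -cardE -cVW cardE xi -mem_enum mem_nth // -cardE -cVW cardE.
Qed.

Section Swaps.
Variables (T : finType) (eX eY : rel T).
Implicit Types (p q : {perm T}) (a b c x y z l : T) (V W U A : {set T}).

Definition swap : rel {perm T} := fun p q =>
  [exists a, exists b, [&& eX a b, eY (p a) (p b) & q == tperm a b * p]].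

Definition reach := connect swap.

Lemma swapI p a b : eX a b -> eY (p a) (p b) -> swap p (tperm a b * p).
Proof. by move=> h1 h2; apply/existsP; exists a; apply/existsP; exists b; rewrite h1 h2 eqxx. Qed.

Lemma swapP p q : reflect (exists a b, [/\ eX a b, eY (p a) (p b) & q = tperm a b * p]) (swap p q).
Proof.
apply: (iffP existsP) => [[a /existsP[b /and3P[h1 h2 /eqP h3]]]|[a [b [h1 h2 ->]]]].
  by exists a, b.
by exists a; apply/existsP; exists b; rewrite h1 h2 eqxx.
Qed.

Hypotheses (Y_sym : symmetric eY) (Y_irr : irreflexive eY).

Lemma swap_sym : symmetric swap.
Proof.
suff h p q : swap p q -> swap q p by move=> p q; apply/idP/idP; apply: h.
case/swapP=> a [b [h1 h2 ->]]; apply/swapP; exists a, b.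
by rewrite !permM tpermL tpermR Y_sym mulgA tperm2 mul1g.
Qed.

Lemma reach_sym p q : reach p q = reach q p.
Proof. exact: sym_connect_sym swap_sym p q. Qed.

Variables (c : T) (r : nat).
Let N := [set l | eX c l].
Let S := c |: N.
Hypothesis cN : c \notin N.
Hypothesis kY : kconn eY (r + 2) setT.
Hypothesis cS : #|~: S| = r.

(** As long as only tokens of the star are on [V], the moves of the blank on [V] are swaps. *)
Lemma slide_swap V p q : (forall x, x \in V -> p^-1 x \in S) -> slide (induced eY V) c p q ->
  swap p q /\ forall x, x \in V -> q^-1 x \in S.
Proof.
move=> hV /andP[/and3P[pV qV pq] /eqP dq]; pose l := p^-1 (q c).
have pl : p l = q c by rewrite permKV.
have lc : l != c by apply: contraTneq pq => e; rewrite -pl e Y_irr.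
have dq' : q = tperm c l * p.
  rewrite dq -pl; have <- : tperm c l ^ p = tperm (p c) (p l) by rewrite tpermJ.
  by rewrite conjgE mulKVg.
have lN : l \in N by have := hV _ qV; rewrite in_setU1 (negbTE lc).
split; first by rewrite dq'; apply: swapI; [rewrite inE in lN | rewrite pl].
move=> x xV; rewrite dq' invMg tpermV permM; case: tpermP => [_|_|_ _].
- by rewrite in_setU1 lN orbT.
- exact: setU11.
exact: hV.
Qed.

Lemma slides_reach V p q : (forall x, x \in V -> p^-1 x \in S) ->
  slides (induced eY V) c p q -> reach p q.
Proof.
move=> hV /connectP[s ps ->] {q}; elim: s p hV ps => [|q s IH] p hV /=; first by rewrite /reach connect0.
case/andP=> /(slide_swap hV)[pq hq] /(IH _ hq).
exact/connect_trans/connect1.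
Qed.

Lemma blank_move V p z : (forall x, x \in V -> p^-1 x \in S) -> p c \in V -> z \in V ->
  conn eY V -> exists q, [/\ reach p q, q c = z & forall a, p a \notin V -> q a = p a].
Proof.
move=> hV pcV zV cV; have [s [ps ls _ sV]] := conn_path cV pcV zV.
have ps' := path_induced ps pcV sV; have h := slides_walk ps'.
exists (p * walk (p c) s); split.
- exact: slides_reach hV h.
- by rewrite permM walk_last.
by move=> a; apply: slides_induced_fix h.
Qed.

Lemma conn_big V : #|~: V| <= r.+1 -> conn eY V.
Proof. by move=> h; case: kY => _ /(_ (~: V)); rewrite setTD setCK; apply; rewrite addn2 ltnS. Qed.

Lemma card_imC p A : #|~: (p @: A)| = #|~: A|.
Proof. by rewrite cardsCs [RHS]cardsCs !setCK card_imset //; apply: perm_inj. Qed.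

Lemma mem_im p A x : (x \in p @: A) = (p^-1 x \in A).
Proof. by rewrite -{1}(permKV p x) mem_imset //; apply: perm_inj. Qed.

Lemma im_off p q A : (forall a, a \notin A -> q a = p a) -> q @: A = p @: A.
Proof.
move=> h; apply/eqP; rewrite eqEcard !card_imset ?leqnn ?andbT; try exact: perm_inj.
apply/subsetP=> _ /imsetP[a aA ->]; rewrite mem_im; apply: contraT => nA.
have := h _ nA; rewrite permKV => /perm_inj e; by rewrite e aA in nA.
Qed.

(** A neighbour [x'] of the token [x] is called to the next position on the way of [x], and they are
swapped. *)
Lemma token_move A x x' : x' \in A -> x \notin A -> eX x' x ->
  (forall p y, p^-1 y \in A -> exists q, [/\ reach p q, q x' = y & forall a, a \notin A -> q a = p a]) ->
  forall p z, conn eY (p @: (x |: A)) -> z \in p @: (x |: A) ->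
  exists q, [/\ reach p q, q x = z & forall a, a \notin x |: A -> q a = p a].
Proof.
move=> x'A xA x'x call p z cV zV.
have pxV : p x \in p @: (x |: A) by rewrite mem_im permK setU11.
have [s [ps ls _ sV]] := conn_path cV pxV zV.
rewrite -{}ls {zV pxV cV}; elim: s p ps sV => [|y s IH] p /=.
  by move=> _ _; exists p; rewrite /reach connect0.
case/andP=> xy ps sV.
have yA : p^-1 y \in A.
  have := sV y (mem_head _ _); rewrite mem_im in_setU1 => /predU1P[e|//].
  by move: xy; rewrite -e permKV Y_irr.
have [q1 [pq1 q1x' q1fix]] := call p y yA.
pose q2 := tperm x' x * q1.
have q2x : q2 x = y by rewrite permM tpermR.
have q2fix a : a \notin x |: A -> q2 a = p a.
  rewrite in_setU1 negb_or => /andP[ax aA]; rewrite permM tpermD ?q1fix // 1?eq_sym //.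
  by apply: contraNneq aA => ->.
have eA : q2 @: (x |: A) = p @: (x |: A) by apply: im_off.
have [q [h1 h2 h3]] : exists q, [/\ reach q2 q, q x = last y s & forall a, a \notin x |: A -> q a = q2 a].
  rewrite -[y in last y s]q2x; apply: IH; rewrite ?q2x //.
  by move=> t ts; rewrite eA; apply: sV; rewrite inE ts orbT.
exists q; split=> //; last by move=> a aA; rewrite h3 ?q2fix.
apply: connect_trans pq1 _; apply: connect_trans h1; apply: connect1; apply: swapI => //.
by rewrite q1x' q1fix // Y_sym.
Qed.

(** The induction hypothesis for placing the tokens one after the other, on sets [A] that grow from
the star along the edges of [X]. The additional token [l] is the one that gets called in
[token_move]. *)
Definition placeable A := forall p q0 l, (forall a, a \notin A -> p a = q0 a) ->
  exists q, [/\ reach p q, forall a, a \notin S -> q a = q0 a & q l = q0 l].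

Lemma agree_im p q0 A l : (forall a, a \notin A -> p a = q0 a) -> l \in A -> q0 l \in p @: A.
Proof. by move=> h lA; rewrite (im_off h) imset_f. Qed.

Lemma placeable_base : placeable S.
Proof.
move=> p q0 l hpq.
have invS V : V \subset p @: S -> forall x, x \in V -> p^-1 x \in S.
  by move=> /subsetP sV x /sV; rewrite mem_im.
have pcS : p c \in p @: S by rewrite mem_im permK setU11.
have bS : #|~: (p @: S)| <= r.+1 by rewrite card_imC cS.
have [lS|lS] := boolP (l \in S); last by exists p; rewrite /reach connect0 hpq.
have zS := agree_im hpq lS.
move: lS; rewrite in_setU1 => /predU1P[lc|lN].
  rewrite lc in zS *; have [q [h1 h2 h3]] := blank_move (invS _ (subxx _)) pcS zS (conn_big bS).
  exists q; split=> // a aS; have paS : p a \notin p @: S by rewrite mem_im permK.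
  by rewrite h3 // hpq.
have cl : l \notin [set c] by rewrite inE; apply: contraTneq lN => ->.
have call p1 y : p1^-1 y \in S :\ l ->
    exists q, [/\ reach p1 q, q c = y & forall a, a \notin S :\ l -> q a = p1 a].
  move=> hy.
  have hV x : x \in p1 @: (S :\ l) -> p1^-1 x \in S by rewrite mem_im => /setD1P[].
  have [|||q [h1 h2 h3]] := blank_move (z := y) hV.
  - rewrite mem_im permK in_setD1 setU11 andbT; by move: cl; rewrite inE eq_sym.
  - by rewrite mem_im.
  - apply: conn_big; rewrite card_imC setCD cardsU -cS.
    by apply: leq_trans (leq_subr _ _) _; rewrite cards1 addn1.
  by exists q; split=> // a aS; rewrite h3 // mem_im permK.
have lS : l \in S by rewrite in_setU1 lN orbT.
have eS : l |: S :\ l = S by rewrite setD1K.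
have [|||||q] := @token_move (S :\ l) l c _ _ _ call p (q0 l).
- by rewrite in_setD1 setU11 andbT; move: cl; rewrite inE eq_sym.
- by rewrite !inE eqxx.
- by rewrite inE in lN.
- by rewrite eS; apply: conn_big.
- by rewrite eS.
rewrite eS => -[h1 h2 h3]; exists q; split=> // a aS; by rewrite h3 ?hpq.
Qed.

(** The new token [x] goes to its place first, inside the positions of [x |: A]; these are
connected, being the complement of at most [r] positions. *)
Lemma placeable_step A x x' : S \subset A -> placeable A -> x' \in A -> x \notin A -> eX x' x ->
  placeable (x |: A).
Proof.
move=> sSA plA x'A xA x'x p q0 l hpq.
have call p1 y : p1^-1 y \in A ->
    exists q, [/\ reach p1 q, q x' = y & forall a, a \notin A -> q a = p1 a].
  move=> hy; have [|q [h1 h2 h3]] := plA p1 (tperm x' (p1^-1 y) * p1) x'.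
    move=> a aA; rewrite permM tpermD //; by apply: contraNneq aA => <-.
  rewrite permM tpermL permKV in h3; exists q; split=> // a aA.
  rewrite h2; last by apply: contraNN aA; apply: (subsetP sSA).
  by rewrite permM tpermD //; apply: contraNneq aA => <-.
have cV : conn eY (p @: (x |: A)).
  apply: conn_big; rewrite card_imC ltnW // ltnS -cS; apply: subset_leq_card.
  by rewrite setCS (subset_trans sSA) // subsetUr.
have [q1 [h1 h2 h3]] := token_move x'A xA x'x call cV (agree_im hpq (setU11 x A)).
have [|q [h4 h5 h6]] := plA q1 q0 l.
  move=> a aA; have [->//|ax] := eqVneq a x.
  have aA' : a \notin x |: A by rewrite in_setU1 negb_or ax.
  by rewrite h3 // hpq.
by exists q; split=> //; apply: connect_trans h1 h4.
Qed.

Hypothesis cX : forall x, connect eX c x.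

Lemma crossing_edge A : c \in A -> A != setT ->
  exists x x', [/\ x' \in A, x \notin A & eX x' x].
Proof.
move=> cA nA; have [x xA] : exists x, x \notin A.
  by apply/existsP; rewrite -negb_forall; apply: contra nA => /forallP h; apply/eqP/setP=> x; rewrite inE h.
have /connectP[s ps ex] := cX x; rewrite {x}ex in xA.
elim: s c cA ps xA => [|y s IH] a aA /=; first by rewrite aA.
case/andP=> ay ps; have [yA|yA] := boolP (y \in A); first exact: IH.
by exists y, a.
Qed.

Lemma placeable_all : placeable setT.
Proof.
have grow n A : #|~: A| <= n -> S \subset A -> placeable A -> placeable setT.
  elim: n A => [|n IH] A hn sSA plA.
    by move: hn; rewrite leqn0 cards_eq0 -setCT (inj_eq (@setC_inj T)) => /eqP <-.
  have [<-//|nA] := eqVneq A setT.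
  have cA : c \in A by apply: (subsetP sSA); rewrite setU11.
  have [x [x' [x'A xA x'x]]] := crossing_edge cA nA.
  apply: (IH (x |: A)); last exact: placeable_step x'x.
    rewrite -ltnS; apply: leq_trans hn; apply: proper_card; apply/properP.
    split; first by rewrite setCS subsetUr.
    by exists x; rewrite !inE ?xA ?eqxx.
  by rewrite (subset_trans sSA) // subsetUr.
exact: grow (leqnn _) (subxx S) placeable_base.
Qed.

(** All tokens outside the star and [c] itself can be placed, so only tokens of [N] are left to be
permuted. *)
Lemma reach_mod_star p q0 : exists g, perm_on N g /\ reach p (g * q0).
Proof.
have [|q [h1 h2 h3]] := @placeable_all p q0 c; first by move=> a; rewrite inE.
exists (q * q0^-1); rewrite mulgKV; split=> //; apply/subsetP=> a.
rewrite inE permM (canF_eq (permKV q0)) => qa; apply: contraNT qa => aN.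
have [->|ac] := eqVneq a c; first by rewrite h3.
by rewrite h2 // in_setU1 negb_or ac.
Qed.

(** The permutation of [N] is a permutation of positions fixing that of the blank, and comes from a
tour of the blank. *)
Lemma even_reach q0 g : mobile eY (q0 @: S) -> perm_on N g -> odd_perm g = false ->
  reach q0 (g * q0).
Proof.
move=> mob gN eg; have gq : g * q0 = q0 * g ^ q0 by rewrite conjgE mulKVg.
have q0c : q0 c \in q0 @: S by rewrite imset_f // setU11.
rewrite gq; apply: (@slides_reach (q0 @: S)); first by move=> x; rewrite mem_im.
apply: tour_slides; apply: (alt3_even (mob _ q0c)); last by rewrite odd_permJ.
apply/subsetP=> x; rewrite inE => hx; rewrite in_setD1 mem_im.
have : q0^-1 x \in N.
  apply: contraR hx => xN; rewrite -{1}(permKV q0 x) permJ (out_perm gN) ?permKV //.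
rewrite in_setU1 => xN; rewrite xN orbT andbT; apply: contraNneq cN => e.
by rewrite e permK in xN.
Qed.

End Swaps.

(** * The sign of the remaining permutation *)

Section OddTours.
Variables (T : finType) (e : rel T).
Hypotheses (e_sym : symmetric e) (e_irr : irreflexive e).
Implicit Types (x y z : T) (V : {set T}) (w : {perm T}).

(** If all tours were even, the sign of a walk from [y] would depend on its end only and would be a
proper colouring. *)
Lemma odd_tour V y : conn e V -> ~~ bip e V -> y \in V ->
  exists2 w, w \in tour (induced e V) y & odd_perm w.
Proof.
move=> cV nb yV; apply/exists_inP; apply: contraNT nb => /exists_inPn even.
have on_s := induced_sym e_sym V.
have parity w1 w2 : slides (induced e V) y 1 w1 -> slides (induced e V) y 1 w2 -> w1 y = w2 y ->
    odd_perm w1 = odd_perm w2.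
  move=> h1 h2 e12; pose g := w1 * w2^-1.
  have gy : g y = y by rewrite permM e12 permK.
  have : g \in tour (induced e V) y.
    rewrite inE gy eqxx; apply: connect_trans h1 _; rewrite -/(slides _ _ _ _) slides_sym //.
    have := @slidesM _ (induced e V) g y 1 w2; rewrite gy mulg1 mulgKV; exact.
  by move/even; rewrite odd_permM odd_permV negb_add => /eqP.
(* the sign of the walks from y to z *)
pose f z := [exists w, [&& slides (induced e V) y 1 w, w y == z & odd_perm w]].
have fE w : slides (induced e V) y 1 w -> f (w y) = odd_perm w.
  move=> h; apply/existsP/idP => [[w' /and3P[h' /eqP e' o']]|o]; last by exists w; rewrite h eqxx.
  by rewrite (parity w w').
apply/bipP; exists f => x z xV zV xz.
have [s [ps ls _ sV]] := conn_path cV yV xV.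
have h : slides (induced e V) y 1 (walk y s).
  have := @slides_walk _ (induced e V) y 1 s; rewrite perm1 mul1g; apply.
  exact: path_induced.
have wx : walk y s y = x by rewrite walk_last.
have wz : (walk y s * tperm x z) y = z by rewrite permM wx tpermL.
have h' : slides (induced e V) y 1 (walk y s * tperm x z).
  apply: (connect_trans h); apply: connect1; rewrite /slide wx wz eqxx andbT.
  by rewrite /induced xV zV.
have := fE _ h; have := fE _ h'; rewrite wx wz => -> ->.
have xz' : x != z by apply: contraTneq xz => ->; rewrite e_irr.
by rewrite odd_permM odd_tperm xz'; case: (odd_perm _).
Qed.

End OddTours.

Section Invariant.
Variable T : finType.
Variables xi chi : T -> bool.
Implicit Types (p g : {perm T}) (a b : T).

Definition parity p := odd_perm p (+) \big[addb/false]_(a | xi a) chi (p a).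

Lemma parity_relabel g p : (forall a, xi (g a) = xi a) -> parity (g * p) = odd_perm g (+) parity p.
Proof.
move=> hg; rewrite /parity odd_permM -addbA; congr (_ (+) (_ (+) _)).
rewrite [RHS](reindex_inj (@perm_inj _ g)) /=; apply: eq_big => a; first by rewrite hg.
by rewrite permM.
Qed.

(** A swap changes the sign; as one of the two tokens is in the class [xi] and the two positions have
different colours, the sum of the colours changes as well. *)
Lemma parity_swap p a b : xi a != xi b -> chi (p a) != chi (p b) ->
  parity (tperm a b * p) = parity p.
Proof.
wlog xa : a b / xi a => [hw hab h|].
  have [xa|/negbTE xa] := boolP (xi a); first exact: hw.
  have [xb|/negbTE xb] := boolP (xi b); last by rewrite xa xb in hab.
  by rewrite tpermC; apply: (hw b a) => //; rewrite eq_sym.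
rewrite xa => hb hc; have xb : xi b = false by case: (xi b) hb.
have ab : a != b by apply: contraFneq xb => <-.
rewrite /parity odd_permM odd_tperm ab !(bigD1 (P := xi) a) //= permM tpermL.
rewrite (eq_bigr (fun i => chi (p i))); last first.
  move=> i /andP[xi_i ia]; rewrite permM tpermD // 1?eq_sym //.
  by apply: contraTneq xi_i => ->; rewrite xb.
by move: hc; case: (chi (p a)); case: (chi (p b)); case: (odd_perm p); case: (\big[addb/false]_(i | _) _).
Qed.

End Invariant.

Section Bichromatic.
Variables (T : finType) (eX : rel T) (c : T).
Hypothesis X_irr : irreflexive eX.

Definition bichrom (xi : T -> bool) : rel T := fun a b => eX a b && (xi a != xi b).

(** Starting from the star of [c], a new vertex adjacent to one already reached gets the opposite
colour, without regard to its other edges. *)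
Lemma bichrom_spanning : (forall x, connect eX c x) -> exists xi,
  [/\ xi c = false, forall l, eX c l -> xi l & forall x, connect (bichrom xi) c x].
Proof.
move=> cX.
pose ok (A : {set T}) xi := [/\ xi c = false, forall l, eX c l -> xi l &
  forall x, x \in A -> connect (induced (bichrom xi) A) c x].
suff [xi [h1 h2 h3]] : exists xi, ok setT xi.
  exists xi; split=> // x; apply: connect_sub (h3 x (in_setT x)) => a b /and3P[_ _ ab].
  exact: connect1.
have grow n A xi : #|~: A| <= n -> c |: [set l | eX c l] \subset A -> ok A xi -> exists xi, ok setT xi.
  elim: n A xi => [|n IH] A xi hn sSA okA.
    exists xi; move: hn; rewrite leqn0 cards_eq0 -setCT (inj_eq (@setC_inj T)) => /eqP <- //.
  have [eA|nA] := eqVneq A setT; first by exists xi; rewrite -eA.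
  have cA : c \in A by apply: (subsetP sSA); rewrite setU11.
  have [x [x' [x'A xA x'x]]] := crossing_edge cX cA nA.
  have xS : x \notin c |: [set l | eX c l] by apply: contraNN xA; apply: (subsetP sSA).
  have sA : A \subset x |: A by apply: subsetUr.
  apply: (IH (x |: A) (fun a => if a == x then ~~ xi x' else xi a)).
  - rewrite -ltnS; apply: leq_trans hn; apply: proper_card; apply/properP.
    split; first by rewrite setCS.
    by exists x; rewrite !inE ?xA ?eqxx.
  - exact: subset_trans sA.
  case: okA => h1 h2 h3; move: xS; rewrite !inE negb_or => /andP[xc ncx].
  split; first by rewrite eq_sym (negbTE xc).
    by move=> l cl; case: eqP => [e|_]; [rewrite -e cl in ncx | apply: h2].
  have hA y : y \in A -> connect (induced (bichrom (fun a => if a == x then ~~ xi x' else xi a)) (x |: A)) c y.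
    move=> /h3; apply: connect_sub => a b /and3P[aA bA /andP[ab xab]]; apply: connect1.
    have neq d : d \in A -> d == x = false by move=> dA; apply: contraNF xA => /eqP<-.
    by rewrite /induced /bichrom !(subsetP sA) // ab !neq.
  move=> y; rewrite in_setU1 => /predU1P[->|]; last exact: hA.
  apply: connect_trans (hA x' x'A) _; apply: connect1.
  rewrite /induced /bichrom setU11 (subsetP sA) // x'x eqxx /=.
  have -> : (x' == x) = false by apply: contraNF xA => /eqP<-.
  by case: (xi x').
apply: (grow #|~: (c |: [set l | eX c l])| _ (fun a => a != c) (leqnn _) (subxx _)).
split; first by rewrite eqxx.
  by move=> l cl; apply: contraTneq cl => ->; rewrite X_irr.
move=> x; rewrite in_setU1 inE => /predU1P[->|cx]; first exact: connect0.
have xc : x != c by apply: contraTneq cx => ->; rewrite X_irr.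
by apply: connect1; rewrite /induced /bichrom setU11 !inE cx orbT eqxx xc.
Qed.

End Bichromatic.

Section Linking.
Variables (T : finType) (eX eY : rel T).
Hypothesis X_irr : irreflexive eX.
Hypotheses (Y_sym : symmetric eY) (Y_irr : irreflexive eY).
Variables (c : T) (r : nat).
Let N := [set l | eX c l].
Hypothesis kY : kconn eY (r + 2) setT.
Hypothesis cS : #|~: (c |: N)| = r.
Hypothesis cX : forall x, connect eX c x.
Implicit Types (p q g w : {perm T}) (U : {set T}).

Let cN : c \notin N. Proof. by rewrite inE X_irr. Qed.

Lemma conn_compl U : #|U| <= r -> conn eY (~: U).
Proof. by move=> hU; apply: (conn_big kY); rewrite setCK leqW. Qed.

(** An odd closed walk of the blank changes the sign of the permutation of the other tokens. *)
Lemma reach_nonbip U : #|U| = r -> mobile eY (~: U) -> ~~ bip eY (~: U) ->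
  forall p q, reach eX eY p q.
Proof.
move=> cU mU nb.
have [q0 q0U] : exists q0 : {perm T}, q0 @: (c |: N) = ~: U.
  by apply: perm_of_sets; rewrite [LHS]cardsCs cS [RHS]cardsCs setCK cU.
suff h p : reach eX eY p q0.
  by move=> p q; apply: connect_trans (h p) _; rewrite -/(reach _ _ _ _) reach_sym.
have [g [gN hg]] := reach_mod_star Y_sym Y_irr cN kY cS cX p q0.
apply: connect_trans hg _.
have ev g' : perm_on N g' -> odd_perm g' = false -> reach eX eY (g' * q0) q0.
  move=> g'N og'; rewrite reach_sym //.
  by apply: (even_reach Y_irr cN) => //; rewrite q0U.
case og: (odd_perm g); last exact: ev.
have q0c : q0 c \in ~: U by rewrite -q0U imset_f // setU11.
have [w wT ow] := odd_tour Y_sym Y_irr (conn_compl (eq_leq cU)) nb q0c.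
have gc : g c = c by apply: (out_perm gN).
have wfix x : x \notin ~: U -> w x = x.
  move=> xU; have := wT; rewrite inE => /andP[_ hw].
  by have := slides_induced_fix hw (a := x); rewrite perm1; apply.
have wy : w (q0 c) = q0 c by have := wT; rewrite inE => /andP[/eqP].
have sN : perm_on N (w ^ q0^-1).
  apply/subsetP=> a; rewrite inE; apply: contraR => aN; rewrite -{1}(permK q0 a) permJ.
  have [->|ac] := eqVneq a c; first by rewrite wy permK.
  rewrite wfix ?permK // -q0U mem_imset; last exact: perm_inj.
  by rewrite in_setU1 negb_or ac.
apply: (@connect_trans _ _ ((g * w ^ q0^-1) * q0)); last first.
  by apply: ev; [apply: perm_onM | rewrite odd_permM odd_permJ og ow].
have -> : g * w ^ q0^-1 * q0 = (g * q0) * w by rewrite conjgE invgK !mulgA mulgKV.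
apply: (slides_reach Y_irr (c := c) (V := ~: U)).
  move=> x; rewrite -q0U => /imsetP[a aS ->]; rewrite invMg permM permK.
  have [->|ac] := eqVneq a c; first by rewrite (_ : g^-1 c = c) ?setU11 //;
    apply: (canLR (permK g)); rewrite gc.
  move: aS; rewrite !in_setU1 (negbTE ac) /= => aN.
  by rewrite (perm_closed _ (perm_onV gN)) aN orbT.
by apply: tour_slides; rewrite permM gc.
Qed.

(** On the edges of the subgraph given by [bichrom_spanning] the parity is invariant, which makes
the permutation of [N] left by [reach_mod_star] even when the parities agree. A swap along an edge
of [X] joining two tokens of the same class changes the parity; such an edge exists as [X] is not
bipartite. *)
Lemma reach_bip : (forall U, #|U| = r -> mobile eY (~: U)) -> bip eY setT -> ~~ bip eX setT ->
  (exists y z, eY y z) -> forall p q, reach eX eY p q.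
Proof.
move=> mob /bipP[chi hchi] nbX [y [z yz]].
have hc a b : eY a b -> chi a != chi b by apply: hchi; rewrite inE.
have [xi [xi_c xi_N cX']] := bichrom_spanning X_irr cX.
have eN : [set l | bichrom eX xi c l] = N.
  by apply/setP=> l; rewrite !inE /bichrom xi_c; case cl: (eX c l) => //=; rewrite (xi_N _ cl).
have cN' : c \notin [set l | bichrom eX xi c l] by rewrite eN.
have cS' : #|~: (c |: [set l | bichrom eX xi c l])| = r by rewrite eN.
have inv p q : reach (bichrom eX xi) eY p q -> parity xi chi p = parity xi chi q.
  case/connectP=> s ps -> {q}; elim: s p ps => //= q s IH p /andP[/swapP[a [b [ab pab ->]]] /IH <-].
  by rewrite parity_swap ?hc //; case/andP: ab.
have sub p q : reach (bichrom eX xi) eY p q -> reach eX eY p q.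
  apply: connect_sub => {}p {}q /swapP[a [b [/andP[ab _] pab ->]]].
  by apply: connect1; apply: swapI.
have same p q : parity xi chi p = parity xi chi q -> reach eX eY p q.
  move=> epq; apply: sub.
  have [g [gN hg]] := reach_mod_star Y_sym Y_irr cN' kY cS' cX' p q.
  apply: (connect_trans hg); rewrite -/(reach _ _ _ _) reach_sym //.
  apply: (even_reach Y_irr cN') => //; first by rewrite -[_ @: _]setCK; apply: mob; rewrite card_imC.
  have gxi a : xi (g a) = xi a.
    have [aN|aN] := boolP (a \in N); last by rewrite (out_perm gN) ?eN.
    have gaN : g a \in N by rewrite -eN (perm_closed _ gN) eN.
    by rewrite !inE in aN gaN; rewrite !xi_N.
  by have := inv _ _ hg; rewrite parity_relabel // epq; case: (odd_perm g); case: (parity _ _ _).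
have [/existsP[a /existsP[b /andP[ab eab]]]|no] :=
    boolP [exists a, exists b, eX a b && (xi a == xi b)]; last first.
  case/negP: nbX; apply/bipP; exists xi => a b _ _ ab; apply: contraNN no => eab.
  by apply/existsP; exists a; apply/existsP; exists b; rewrite ab.
have nab : a != b by apply: contraTneq ab => ->; rewrite X_irr.
have nyz : y != z by apply: contraTneq yz => ->; rewrite Y_irr.
have [p1 [p1a p1b]] : exists p1 : {perm T}, p1 a = y /\ p1 b = z.
  exists (tperm a y * tperm (tperm a y b) z); rewrite !permM tpermL tpermL; split=> //.
  rewrite tpermD //; first by rewrite -{2}(tpermL a y) (inj_eq perm_inj) eq_sym.
  by rewrite eq_sym.
pose p2 := tperm a b * p1.
have r12 : reach eX eY p1 p2 by apply: connect1; apply: swapI; rewrite ?p1a ?p1b.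
have e12 : parity xi chi p2 = ~~ parity xi chi p1.
  rewrite parity_relabel ?odd_tperm ?nab // => t; case: tpermP => [->|->|] //; by rewrite (eqP eab).
have to1 p : reach eX eY p p1.
  have [e|ne] := eqVneq (parity xi chi p) (parity xi chi p1); first exact: same.
  apply: (@connect_trans _ _ p2); last by rewrite -/(reach _ _ _ _) reach_sym.
  by apply: same; rewrite e12; case: (parity _ _ p) ne; case: (parity _ _ p1).
by move=> p q; apply: connect_trans (to1 p) _; rewrite -/(reach _ _ _ _) reach_sym.
Qed.

End Linking.

(** * Neighbours of a state obtained by moving the blank *)

Section Rotation.
Variables (T : finType) (c : T) (w : {perm T}) (Q : seq T).
Implicit Types (p q : {perm T}) (x y z : T).
Let y := w c.
Let Z := y :: Q.
Hypothesis UZ : uniq Z.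

Definition advance p := p * tperm (p c) (next Z (p c)).

Lemma advance_c p : advance p c = next Z (p c).
Proof. by rewrite permM tpermL. Qed.

Lemma advance_inj : injective advance.
Proof.
apply: (can_inj (g := fun q => q * tperm (q c) (prev Z (q c)))) => p.
by rewrite advance_c (prev_next UZ) /advance tpermC -mulgA tperm2 mulg1.
Qed.

Lemma advance_off p z : p c \in Z -> z \notin Z -> (advance p)^-1 z = p^-1 z.
Proof.
move=> pZ zZ; rewrite invMg tpermV permM tpermD //; apply: contraNneq zZ => <- //.
by rewrite mem_next.
Qed.

Lemma orbit_blank i : iter i advance w c \in Z.
Proof. by elim: i => [|i IH] /=; rewrite ?mem_head // advance_c mem_next. Qed.

Lemma orbit_off i z : z \notin Z -> (iter i advance w)^-1 z = w^-1 z.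
Proof. by move=> zZ; elim: i => //= i IH; rewrite advance_off // orbit_blank. Qed.

Lemma turns_home k : ((cyc Q)^-1 ^+ k) y = y.
Proof.
rewrite permX iter_fix //; apply: (canLR (permK _)).
by rewrite cyc_out //; case/andP: UZ.
Qed.

(** [(cyc Q)^-1] is the effect of a full turn on the tokens, and [walk y s1] that of the last,
partial turn. *)
Lemma orbit_turns i : exists k s1 s2,
  Q = s1 ++ s2 /\ iter i advance w = w * (cyc Q)^-1 ^+ k * walk y s1.
Proof.
have fixy := turns_home.
elim: i => [|i [k [s1 [s2 [eQ e]]]]] /=.
  by exists 0%N, [::], Q; rewrite expg0 !mulg1.
have bl : iter i advance w c = last y s1 by rewrite e !permM fixy walk_last.
rewrite /advance bl e -mulgA.
case: s2 eQ => [|z s2] eQ.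
  exists k.+1, [::], Q; split=> //; rewrite cats0 in eQ.
  have -> : next Z (last y s1) = y.
    by rewrite -eQ; apply: next_last.
  rewrite /= mulg1 expgSr -(cyc_closed_walk UZ) -cats1 walk_cat /= mulg1 -eQ !mulgA //.
exists k, (rcons s1 z), s2; split; first by rewrite cat_rcons.
have -> : next Z (last y s1) = z.
  rewrite /Z eQ; case: (lastP s1) eQ => [|s x] eQ; first by rewrite /= eqxx.
  by rewrite last_rcons cat_rcons -cat_cons next_infix // cat_cons -cat_rcons -eQ.
by rewrite -cats1 walk_cat /= mulg1 -!mulgA.
Qed.

Lemma orbit_blank_home i : iter i advance w c = y ->
  exists k, iter i advance w = w * (cyc Q)^-1 ^+ k.
Proof.
have [k [s1 [s2 [eQ e]]]] := orbit_turns i.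
rewrite e !permM turns_home walk_last => ls; exists k.
case: (lastP s1) eQ ls => [|s x] eQ; first by rewrite mulg1.
rewrite last_rcons => xy; have := UZ; rewrite /Z /= eQ mem_cat mem_rcons inE xy eqxx //.
Qed.

(** A power of a rotation commutes with the rotation, so if it leaves one token of the cycle in
place, it leaves all of them in place. *)
Lemma orbit_no_transposition i y1 y2 (q : T) : y1 \in Q -> q \in Q -> q != y1 -> q != y2 -> y2 != y1 ->
  y2 \in Q -> iter i advance w != w * tperm y1 y2.
Proof.
move=> y1Q qQ q1 q2 y21 y2Q; apply/eqP=> e.
have UQ : uniq Q by case/andP: UZ.
have [k ek] : exists k, iter i advance w = w * (cyc Q)^-1 ^+ k.
  apply: orbit_blank_home; rewrite e permM tpermD //.
    by apply: contraTneq y1Q => ->; case/andP: UZ.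
  by apply: contraTneq y2Q => ->; case/andP: UZ.
have {}ek : (cyc Q)^-1 ^+ k = tperm y1 y2 by apply: (mulgI w); rewrite -ek.
have [m em] := cyc_transitive UQ qQ y1Q.
have comm : commute (cyc Q ^+ m) ((cyc Q)^-1 ^+ k).
  by apply: commuteX2; apply: commuteV.
have : ((cyc Q)^-1 ^+ k) y1 = y1.
  rewrite -em -permM comm permM; congr (_ _); by rewrite ek tpermD // eq_sym.
by rewrite ek tpermL => e21; rewrite e21 eqxx in y21.
Qed.

End Rotation.

Lemma perm_on_pair (T : finType) (a b : T) (h : {perm T}) :
  perm_on [set a; b] h -> h = 1 \/ h = tperm a b.
Proof.
have fixa (k : {perm T}) : perm_on [set a; b] k -> k a = a -> k = 1.
  move=> onk ka; apply: (@perm_on_id _ k [set b]); last by rewrite cards1.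
  apply/subsetP=> z kz; have nz : k z != z := kz.
  have := subsetP onk z kz; rewrite !inE => /orP[/eqP ez|//].
  by rewrite ez ka eqxx in nz.
move=> onh; have : h a \in [set a; b] by rewrite (perm_closed _ onh) !inE eqxx.
rewrite !inE => /orP[/eqP ha|/eqP ha]; first by left; apply: fixa.
right; have /(fixa _ (perm_onM onh (tperm_on a b))) e : (h * tperm a b) a = a.
  by rewrite permM ha tpermR.
by rewrite -[h]mulg1 -(tperm2 a b) mulgA e mul1g.
Qed.

Section StarNeighbours.
Variables (T : finType) (eX eY : rel T).
Hypotheses (Y_sym : symmetric eY) (Y_irr : irreflexive eY).
Variables (c : T) (r s : nat).
Let N := [set l | eX c l].
Let S := c |: N.
Hypothesis kY : kconn eY (r + s) setT.
Hypothesis cS : #|~: S| = r.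
Implicit Types (p q w : {perm T}) (B : {set {perm T}}) (x y z : T) (V D W : {set T}).

Lemma conn_star_del w W : #|W| < s -> conn eY (w @: S :\: W).
Proof.
move=> hW; have -> : w @: S :\: W = setT :\: (~: (w @: S) :|: W).
  by apply/setP=> x; rewrite !inE negb_or negbK andbT andbC.
case: kY => _; apply; apply: leq_ltn_trans (leq_card_setU _ _) _.
by rewrite card_imC cS ltn_add2l.
Qed.

Lemma card_star w : s < #|w @: S|.
Proof.
case: kY => h _; move: h; rewrite cardsT -(cardsC (w @: S)) card_imC cS addnC.
by rewrite ltn_add2r.
Qed.

(** With [inner] the path must not be the edge between its ends: it is led through a third vertex,
and the shortcuts that are taken to make it simple do not use this edge. *)
Lemma detour V y1 y2 (inner : bool) : y1 \in V -> y2 \in V -> y1 != y2 -> conn eY V ->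
  (inner -> [/\ 2 < #|V|, conn eY (V :\ y1) & conn eY (V :\ y2)]) ->
  exists P, [/\ path eY y1 P, last y1 P = y2, uniq (y1 :: P), {subset P <= V} &
    inner -> exists2 q, q \in P & q != y2].
Proof.
move=> y1V y2V y12 cV; case: inner => [/(_ isT)[V3 c1 c2]|_]; last first.
  by have [P [h1 h2 h3 h4]] := conn_path cV y1V y2V; exists P.
have [q qV /norP[q1 q2]] : exists2 q, q \in V & ~~ ((q == y1) || (q == y2)).
  have : 0 < #|V :\: [set y1; y2]|.
    rewrite cardsD subn_gt0; apply: leq_ltn_trans V3.
    by apply: leq_trans (subset_leq_card (subsetIr _ _)) _; rewrite cards2; case: (_ == _).
  by case/card_gt0P=> q; rewrite !inE => /andP[h qV]; exists q.
have [s1 [p1 l1 _ sV1]] : exists t, [/\ path eY y1 t, last y1 t = q, uniq (y1 :: t) &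
    {subset t <= V :\ y2}].
  by apply: conn_path; rewrite ?inE ?y12 ?q2 ?y1V.
have [s2 [p2 l2 _ sV2]] : exists t, [/\ path eY q t, last q t = y2, uniq (q :: t) &
    {subset t <= V :\ y1}].
  by apply: conn_path; rewrite ?inE ?q1 ?qV ?y2V ?andbT // eq_sym.
pose e' : rel T := fun x z => eY x z && ~~ ((x == y1) && (z == y2)).
have p1' : path e' y1 s1.
  have sub : {in [pred x | x != y2] &, subrel eY e'}.
    by move=> x z _ zy xz; rewrite /e' xz negb_and; rewrite inE in zy; rewrite zy orbT.
  apply: (sub_in_path sub) p1.
  by apply/allP=> x; rewrite !inE => /predU1P[->//|/sV1]; rewrite !inE => /andP[].
have p2' : path e' q s2.
  have sub : {in [pred x | x != y1] &, subrel eY e'}.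
    by move=> x z xy _ xz; rewrite /e' xz negb_and; rewrite inE in xy; rewrite xy.
  apply: (sub_in_path sub) p2.
  by apply/allP=> x; rewrite !inE => /predU1P[->//|/sV2]; rewrite !inE => /andP[].
have p' : path e' y1 (s1 ++ s2) by rewrite cat_path l1 p1'.
have l' : last y1 (s1 ++ s2) = y2 by rewrite last_cat l1.
case/shortenP: p' l' => P pP UP sP lP; exists P; split=> //.
- by apply: sub_path pP => x z /andP[].
- by move=> x /sP; rewrite mem_cat => /orP[/sV1|/sV2]; rewrite inE => /andP[].
move=> _; case: P pP UP lP {sP} => [|q' P] /=; first by move=> _ _ e; rewrite e eqxx in y12.
case/andP=> /andP[_]; rewrite eqxx /= => q'2 _ _ _; by exists q'; rewrite ?mem_head.
Qed.

(** Two moves of the blank from [w], to [y1] and to [y2], are joined by the rotation along a cycle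
through these three positions. A deleted state that differs from [w] at a further position is
avoided by a cycle that misses this position, since the rotation does not change what is there; at
most [s - 2] positions and that of the blank are excluded, so the rest of the star is still
connected. The other deleted states permute the tokens on the three positions only;
[orbit_no_transposition] applies to them if the cycle has a fourth vertex, which can be arranged
since these states exclude no position. *)
Lemma star_neighbours_connected B w y1 y2 : #|B|.+2 <= s -> w \notin B ->
  y1 \in w @: S -> y2 \in w @: S -> eY (w c) y1 -> eY (w c) y2 ->
  w * tperm (w c) y1 \notin B -> w * tperm (w c) y2 \notin B ->
  connect (induced (swap eX eY) (~: (w |: B))) (w * tperm (w c) y1) (w * tperm (w c) y2).
Proof.
move=> hB wB y1V y2V yy1 yy2 uB vB; set y := w c in yy1 yy2 uB vB *.
have [->|y12] := eqVneq y1 y2; first exact: connect0.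
have ny1 : y1 != y by apply: contraTneq yy1 => ->; rewrite Y_irr.
have ny2 : y2 != y by apply: contraTneq yy2 => ->; rewrite Y_irr.
(* wit t is a position other than the three where t and w differ, and D collects those found; inner
says that some state of B has none *)
pose wit (t : {perm T}) := [pick z | (z \notin [:: y; y1; y2]) && (t^-1 z != w^-1 z)].
pose D := [set odflt y (wit t) | t in [set t in B | wit t != None]].
pose inner := [exists t in B, wit t == None].
have yV : y \in w @: S by rewrite imset_f // setU11.
have witP t : (exists z, [/\ wit t = Some z, z \notin [:: y; y1; y2] & t^-1 z != w^-1 z]) \/
    wit t = None /\ forall z, z \notin [:: y; y1; y2] -> t^-1 z = w^-1 z.
  rewrite /wit; case: pickP => [z /andP[h1 h2]|no]; first by left; exists z.
  by right; split=> // z hz; apply/eqP; have := no z; rewrite hz => /negbFE.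
have D_out z : z \in [:: y; y1; y2] -> z \notin D.
  move=> hz; apply/imsetP=> -[t]; rewrite inE.
  have [[z' [-> /= hz' _]]|[-> _]] := witP t; last by rewrite andbF.
  by move=> _ e; rewrite -e hz in hz'.
have [y1D y2D] : y1 \notin D /\ y2 \notin D by rewrite !D_out // !inE eqxx ?orbT.
have cD : #|D| <= #|B|.
  apply: leq_trans (leq_imset_card _ _) _; apply: subset_leq_card.
  by apply/subsetP=> t; rewrite inE => /andP[].
have cD' : inner -> #|D| < #|B|.
  case/exists_inP=> t tB wt; apply: leq_ltn_trans (leq_imset_card _ _) _.
  apply: proper_card; apply/properP; split; first by apply/subsetP=> t'; rewrite inE => /andP[].
  by exists t; rewrite // inE tB wt.
pose V := w @: S :\: (y |: D).
have cyD W : #|y |: D| + #|W| < s -> conn eY (V :\: W).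
  by move=> h; rewrite setDDl; apply: conn_star_del; apply: leq_ltn_trans h; apply: leq_card_setU.
have cyD1 : #|y |: D| <= #|D|.+1 by rewrite cardsU1 -add1n leq_add2r; case: (_ \notin _).
have inV z : z \in w @: S -> z != y -> z \notin D -> z \in V.
  by move=> zS zy zD; rewrite !inE negb_or zy zD.
have [P [pP lP UP PV Pinner]] : exists P, [/\ path eY y1 P, last y1 P = y2, uniq (y1 :: P),
    {subset P <= V} & inner -> exists2 q, q \in P & q != y2].
  apply: detour; rewrite ?inV //.
    rewrite -(setD0 V); apply: cyD; rewrite cards0 addn0.
    by apply: leq_ltn_trans cyD1 _; apply: leq_trans hB; rewrite ltnS ltnS.
  move=> /cD' hD.
  have hD2 : #|y |: D|.+1 < s.
    by apply: leq_trans hB; rewrite !ltnS; apply: leq_trans hD.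
  split; try by apply: cyD; rewrite cards1 addn1.
  rewrite cardsD; apply: leq_trans (leq_sub2l _ (subset_leq_card (subsetIr _ _))).
  by rewrite ltn_subRL; apply: leq_ltn_trans (card_star w); rewrite addn2.
have UZ : uniq (y :: y1 :: P).
  rewrite /= in UP *; rewrite UP andbT inE negb_or eq_sym ny1 /=.
  by apply/negP=> /PV; rewrite !inE eqxx.
pose Q := y1 :: P.
pose f : {perm T} -> {perm T} := advance c w Q.
have ZV x : x \in y :: Q -> x \in w @: S.
  by rewrite !inE => /or3P[/eqP->|/eqP->|/PV] //; rewrite inE => /andP[].
have fwc i : iter i f w c \in y :: Q by apply: orbit_blank.
have cZ : path.cycle eY (y :: Q) by rewrite /= yy1 rcons_path pP lP Y_sym.
have fslide i : slide (induced eY (w @: S)) c (iter i f w) (iter i.+1 f w).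
  rewrite /slide /= advance_c eqxx andbT /induced !ZV ?mem_next //=.
  exact: next_cycle cZ (fwc i).
have fstate i : (forall x, x \in w @: S -> (iter i f w)^-1 x \in S).
  elim: i => [|i IH]; first by move=> x; rewrite mem_im.
  exact: (slide_swap Y_irr IH (fslide i)).2.
have fswap i : swap eX eY (iter i f w) (iter i.+1 f w).
  exact: (slide_swap Y_irr (fstate i) (fslide i)).1.
have finj : injective f by apply: advance_inj.
have fw : f w = w * tperm y y1 by rewrite /f /advance /= eqxx.
have nl : next (y :: Q) y2 = y by rewrite -lP -[last y1 P]/(last y Q) next_last.
(* the orbit of w begins with one of the two neighbours of w and ends with the other *)
have fv : f (w * tperm y y2) = w.
  rewrite /f /advance permM -/y tpermL nl -mulgA (tpermC y) tperm2 mulg1 //.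
have iter_order_w : iter (fingraph.order f w) f w = w by apply: fingraph.iter_order.
have last_v : iter (fingraph.order f w).-1 f w = w * tperm y y2.
  by apply: finj; rewrite -iterS prednK ?fingraph.order_gt0 // iter_order_w fv.
have off_w i : 0 < i < fingraph.order f w -> iter i f w != w.
  case/andP=> i0 hi; apply: contraTneq i0 => e; rewrite -leqNgt leqn0.
  by rewrite -(fingraph.findex_iter hi) e findex0.
(* a state of [B] agreeing with [w] off [y], [y1] and [y2] would be this transposition or next to it on
the orbit *)
have no_tr i : inner -> iter i f w != w * tperm y1 y2.
  move/Pinner=> [q qP q2]; apply: (@orbit_no_transposition _ c w Q UZ i y1 y2 q).
  - exact: mem_head.
  - by rewrite inE qP orbT.
  - by apply: contraTneq qP => ->; case/andP: UP.
  - exact: q2.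
  - by rewrite eq_sym.
  by rewrite -lP mem_last.
have off_B i : 0 < i < fingraph.order f w -> iter i f w \notin B.
  move=> hi; apply/negP=> tB; set t := iter i f w in tB.
  have tw : t != w by apply: off_w.
  have [[z [wz hz tz]]|[wN agree]] := witP t.
    have zZ : z \notin y :: Q.
      move: hz; rewrite !inE !negb_or => /and3P[-> -> _]; apply/negP=> /PV; rewrite inE.
      case/andP=> + _; rewrite in_setU1 negb_or => /andP[_ /negP]; apply.
      by apply/imsetP; exists t; rewrite ?inE ?tB wz.
    by case/eqP: tz; apply: orbit_off.
  have hin : inner by apply/exists_inP; exists t; rewrite ?wN.
  (* g permutes y, y1 and y2; it is composed with a move of the blank to bring y back, which leaves
  the identity or the transposition of y1 and y2 *)
  pose g := w^-1 * t.
  have tg : t = w * g by rewrite mulKVg.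
  have g_off z : z \notin [:: y; y1; y2] -> g z = z by move/agree=> e; rewrite permM -e permKV.
  have home (h : {perm T}) : (forall z, z \notin [:: y; y1; y2] -> h z = z) -> h y = y ->
      h = 1 \/ h = tperm y1 y2.
    move=> h_off hy; apply: perm_on_pair; apply/subsetP=> z; rewrite !inE; apply: contraR.
    rewrite negb_or => /andP[z1 z2]; have [->|zy] := eqVneq z y; first by rewrite hy.
    by rewrite h_off // !inE !negb_or zy z1.
  have off2 y' : y' \in [:: y; y1; y2] -> forall z, z \notin [:: y; y1; y2] -> (g * tperm y' y) z = z.
    move=> hy' z hz; rewrite permM g_off // tpermD //; last by apply: contraNneq hz => <-; rewrite mem_head.
    by apply: contraNneq hz => <-.
  have : g y \in [:: y; y1; y2]
    by apply: contraT => h; have e := perm_inj (g_off _ h); rewrite e mem_head in h.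
  have back y' : (g * tperm y' y) = 1 -> t = w * tperm y y'.
    move=> e; have eg : g = tperm y' y by apply: (mulIg (tperm y' y)); rewrite e tperm2.
    by rewrite tg eg tpermC.
  rewrite !inE => /or3P[] /eqP gy.
  - have [e|e] := home g g_off gy; first by rewrite tg e mulg1 eqxx in tw.
    by have := no_tr i hin; rewrite -/t tg e eqxx.
  - have [||e|e] := home (g * tperm y1 y).
    + by apply: off2; rewrite !inE eqxx orbT.
    + by rewrite permM gy tpermL.
    + by rewrite -(back _ e) tB in uB.
    have [i' et] : exists i', t = f (iter i' f w) by exists i.-1; rewrite -iterS prednK //; case/andP: hi.
    have := no_tr i' hin; rewrite -e mulgA -tg; case/eqP; apply: finj; rewrite -et.
    have tc : t c = y1 by rewrite tg permM -/y gy.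
    by rewrite /f /advance permM tc tpermL /= eqxx -mulgA (tpermC y1) tperm2 mulg1.
  have [||e|e] := home (g * tperm y2 y).
  + by apply: off2; rewrite !inE eqxx !orbT.
  + by rewrite permM gy tpermL.
  + by rewrite -(back _ e) tB in vB.
  have := no_tr i.+1 hin; rewrite -e mulgA -tg iterS -/t.
  have tc : t c = y2 by rewrite tg permM -/y gy.
  by rewrite {1}/f /advance tc nl eqxx.
have reach_i i : i.+1 < fingraph.order f w ->
    connect (induced (swap eX eY) (~: (w |: B))) (w * tperm y y1) (iter i.+1 f w).
  elim: i => [|i IH] hi; first by rewrite /= fw connect0.
  apply: connect_trans (IH (ltnW hi)) _; apply: connect1.
  have av k : 0 < k < fingraph.order f w -> iter k f w \in ~: (w |: B).
    by move=> hk; rewrite !inE negb_or off_w ?off_B.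
  by apply/and3P; split; [apply: av; exact: ltnW|exact: av|exact: fswap].
have n2 : 1 < fingraph.order f w.
  case e : (fingraph.order f w) (fingraph.order_gt0 f w) last_v => [|[|n]] //= _ /eqP.
  rewrite -{1}[w]mulg1 (inj_eq (mulgI w)) eq_sym => /eqP/permP/(_ y).
  by rewrite tpermL perm1 => ?; case/eqP: ny2.
rewrite -last_v; case e : (fingraph.order f w) n2 => [|[|n]] // _ /=.
by apply: reach_i; rewrite e.
Qed.

End StarNeighbours.

(** * Neighbours of a state remain joined after deletions *)

Section LocalConnectivity.
Variables (T : finType) (eX eY : rel T).
Hypotheses (X_sym : symmetric eX) (X_irr : irreflexive eX).
Hypotheses (Y_sym : symmetric eY) (Y_irr : irreflexive eY).
Variables (c : T) (r s : nat).
Let N := [set l | eX c l].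
Let S := c |: N.
Hypothesis kY : kconn eY (r + s) setT.
Hypothesis cS : #|~: S| = r.
Implicit Types (p q w : {perm T}) (B : {set {perm T}}) (a b l x y z : T).

Lemma star_move w l : tperm c l * w = w * tperm (w c) (w l).
Proof. by rewrite -tpermJ conjgE mulKVg. Qed.

Definition star_nbrs w := [set l in N | eY (w c) (w l)].

(** At most [r] of the at least [r + s] neighbours of the position of the blank carry tokens outside
the star. *)
Lemma card_star_nbrs w : s <= #|star_nbrs w|.
Proof.
have := min_degree Y_irr kY (in_setT (w c)).
rewrite -(cardsID (w @: S)) [leqRHS]addnC => h; rewrite -(leq_add2l r); apply: (leq_trans h).
apply: leq_add.
  rewrite -cS -(card_imC w); apply: subset_leq_card; apply/subsetP=> x.
  by rewrite !inE => /andP[].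
rewrite -[#|star_nbrs w|](card_imset _ (@perm_inj _ w)); apply: subset_leq_card; apply/subsetP=> x.
move=> /setIP[xn /imsetP[l lS ex]]; rewrite ex inE in xn *; case/andP: xn => _ yx; apply: imset_f.
rewrite !inE in lS *; rewrite yx andbT; case/orP: lS => // /eqP lc.
by rewrite lc Y_irr in yx.
Qed.

(** A swap of [a] and [b] leads to [u], and the moves of the blank that involve neither of them
commute with it. This gives paths from [u] to states obtained from [w] by moving the blank; they do
not share states, as the position of [c] tells them apart, and there are more of them than states in
[B]. *)
Lemma joined_to_star B w u : #|B|.+2 <= s -> w \notin B -> u \notin B -> swap eX eY w u ->
  exists y, [/\ y \in w @: S, eY (w c) y, w * tperm (w c) y \notin B &
    connect (induced (swap eX eY) (~: (w |: B))) u (w * tperm (w c) y)].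
Proof.
move=> hB wB uB /swapP[a [b [ab wab du]]].
have star l : eX c l -> eY (w c) (w l) -> u = tperm c l * w -> exists y,
    [/\ y \in w @: S, eY (w c) y, w * tperm (w c) y \notin B &
    connect (induced (swap eX eY) (~: (w |: B))) u (w * tperm (w c) y)].
  move=> cl wcl eu; exists (w l); rewrite -star_move -eu connect0; split=> //.
  by apply: imset_f; rewrite !inE cl orbT.
have [ea|nac] := eqVneq a c.
  by apply: (star b); rewrite -?ea.
have [eb|nbc] := eqVneq b c.
  by apply: (star a); rewrite -?eb ?du 1?tpermC // 1?X_sym // Y_sym.
have nab : a != b by apply: contraTneq ab => ->; rewrite X_irr.
set M := star_nbrs w.
have MP l : l \in M -> eX c l /\ eY (w c) (w l) by rewrite !inE => /andP[].
have Mc l : l \in M -> l != c by move/MP=> [cl _]; apply: contraTneq cl => ->; rewrite X_irr.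
(* l = a is admitted if c can be swapped with both a and b: then x a and v a differ by a swap of c
and b *)
pose I := if (a \in M) && (b \in M) then M :\ b else M :\: [set a; b].
have cI : s <= #|I|.+1.
  have cM : s <= #|M| := card_star_nbrs w.
  rewrite /I; case: ifP => [/andP[_ bM]|nM]; first by rewrite (cardsD1 b) bM in cM.
  apply: leq_trans cM _; rewrite -(cardsID [set a; b] M) addnC -addn1 leq_add2l.
  rewrite -(cards1 (if a \in M then a else b)); apply: subset_leq_card; apply/subsetP=> l.
  move=> /setIP[lM /set2P[e|e]]; rewrite e in lM *; first by rewrite inE lM.
  by rewrite inE; case: ifP => // aM; rewrite aM lM in nM.
pose v l := tperm c l * w; pose x l := tperm c l * u.
have IM l : l \in I -> l \in M by rewrite /I; case: ifP => _; rewrite !inE; case/andP.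
have Ib l : l \in I -> l != b.
  by rewrite /I; case: ifP => _; rewrite !inE ?negb_or; [case/andP | case/andP=> /andP[]].
have Ia l : l \in I -> l = a -> b \in M.
  rewrite /I; case: ifP => [/andP[] //|_]; by rewrite !inE => /andP[/norP[+ _] _] e; rewrite e eqxx.
have vc l : v l c = w l by rewrite permM tpermL.
have uc : u c = w c by rewrite du permM tpermD.
have xc l : x l c = u l by rewrite permM tpermL.
have ul l : l != a -> l != b -> u l = w l.
  by move=> la lb; rewrite du permM tpermD // eq_sym.
have ua : u a = w b by rewrite du permM tpermL.
have vw l : l \in I -> v l != w.
  move/IM/Mc => lc; apply/eqP=> e; have := vc l; rewrite e => /perm_inj e'; by rewrite e' eqxx in lc.
have xw l : l \in I -> x l != w.
  move=> lI; apply/eqP=> e; have := xc l; rewrite e.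
  have [la|la] := eqVneq l a; first by rewrite la ua => /perm_inj e'; rewrite e' eqxx in nbc.
  rewrite ul // ?Ib // => /perm_inj e'; by have := Mc l (IM l lI); rewrite e' eqxx.
have ux l : l \in I -> swap eX eY u (x l).
  move=> lI; have [cl wl] := MP l (IM l lI); apply: swapI => //; rewrite uc.
  have [la|la] := eqVneq l a; last by rewrite ul ?Ib.
  by rewrite la ua; case: (MP b (Ia l lI la)).
have xv l : l \in I -> swap eX eY (v l) (x l).
  move=> lI; have [la|la] := eqVneq l a.
    have [cb wb] := MP b (Ia l lI la).
    have -> : x l = tperm c b * v l.
      rewrite /x /v du !mulgA la; congr (_ * w).
      have -> : tperm c b = tperm a b ^ tperm c a by rewrite tpermJ tpermR tpermD // eq_sym.
      by rewrite conjgE tpermV -!mulgA tperm2 mulg1.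
    have vb : v l b = w b by rewrite /v permM la tpermD // eq_sym.
    by apply: swapI => //; rewrite vc vb la.
  have lb := Ib l lI.
  have -> : x l = tperm a b * v l.
    rewrite /x /v du !mulgA; congr (_ * w).
    have e : tperm a b ^ tperm c l = tperm a b by rewrite tpermJ !tpermD // 1?eq_sym // eq_sym.
    by rewrite -{1}e conjgE tpermV !mulgA tperm2 mul1g.
  by apply: swapI => //; rewrite /v !permM !tpermD // 1?eq_sym // eq_sym.
(* were all paths from u through x l to v l blocked, t l would be a blocking state *)
pose t l := if v l \in B then v l else x l.
have [l [lI vB xB]] : exists l, [/\ l \in I, v l \notin B & x l \notin B].
  have [/exists_inP[l lI /andP[h1 h2]]|no] := boolP [exists l in I, (v l \notin B) && (x l \notin B)].
    by exists l.
  have tB l : l \in I -> t l \in B.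
    move=> lI; rewrite /t; case: ifP => // /negbT vB; apply: contraNT no => xB.
    by apply/exists_inP; exists l; rewrite ?vB.
  have tc l : l \in I -> t l c = w l \/ l = a /\ t l c = w b.
    move=> lI; rewrite /t; case: ifP => _; first by left.
    rewrite xc; have [la|la] := eqVneq l a; first by right; rewrite la ua.
    by left; rewrite ul ?Ib.
  have tinj : {in I &, injective t}.
    move=> l1 l2 h1 h2 e; have := tc l1 h1; rewrite e; have := tc l2 h2.
    have b1 := Ib l1 h1; have b2 := Ib l2 h2.
    case=> [->|[e2 ->]] [/perm_inj|[e1 /perm_inj]] // e3.
    - by rewrite e3 eqxx in b2.
    - by rewrite e3 eqxx in b1.
    by rewrite e1 e2.
  have : #|I| <= #|B|.
    rewrite -(card_in_imset tinj); apply: subset_leq_card; apply/subsetP=> _ /imsetP[l lI ->].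
    exact: tB.
  by rewrite leqNgt -ltnS (leq_trans hB cI).
have [cl wl] := MP l (IM l lI).
exists (w l); rewrite -star_move; split=> //.
  by apply: imset_f; rewrite !inE cl orbT.
have uw : u != w.
  apply/eqP=> e; have := ua; rewrite e => /perm_inj e'; by rewrite e' eqxx in nab.
apply: (@connect_trans _ _ (x l)); apply: connect1; rewrite /induced !inE !negb_or.
  by rewrite uw uB xw // xB ux.
by rewrite xw // xB vw // vB swap_sym // xv.
Qed.

Lemma neighbours_connected B w u v : #|B|.+2 <= s -> w \notin B -> u \notin B -> v \notin B ->
  swap eX eY w u -> swap eX eY w v -> connect (induced (swap eX eY) (~: (w |: B))) u v.
Proof.
move=> hB wB uB vB wu wv.
have [y1 [h1 h2 h3 h4]] := joined_to_star hB wB uB wu.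
have [y2 [k1 k2 k3 k4]] := joined_to_star hB wB vB wv.
have s_on := induced_sym (swap_sym eX Y_sym) (~: (w |: B)).
apply: connect_trans h4 _; rewrite (sym_connect_sym s_on); apply: connect_trans k4 _.
by rewrite (sym_connect_sym s_on); apply: (star_neighbours_connected Y_sym Y_irr kY cS).
Qed.

(** A path through the newly deleted state [w] can be led around it by [neighbours_connected]. *)
Lemma swap_kconn B : (forall p q, reach eX eY p q) -> #|B| < s -> conn (swap eX eY) (~: B).
Proof.
move=> cR; move: {2}#|B| (erefl #|B|) => n; elim: n B => [|n IH] B cB hB p q.
  move/eqP: cB; rewrite cards_eq0 => /eqP -> _ _.
  apply: connect_sub (cR p q) => a b ab; apply: connect1; by rewrite /induced !inE ab.
have /card_gt0P[w wB] : 0 < #|B| by rewrite cB.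
rewrite -(setD1K wB); set B0 := B :\ w.
have cB0 : #|B0| = n by apply/eqP; rewrite -eqSS -cB (cardsD1 w B) wB.
have wB0 : w \notin B0 by rewrite !inE eqxx.
have hB0 : #|B0|.+2 <= s by rewrite cB0 -cB.
rewrite !in_setC !in_setU1 !negb_or => /andP[pw pB] /andP[qw qB].
have /connectP[t pt eq] : connect (induced (swap eX eY) (~: B0)) p q.
  by apply: IH; rewrite ?cB0 ?in_setC // -cB ltnW.
have main t' : path (induced (swap eX eY) (~: B0)) p t' ->
    (last p t' != w -> connect (induced (swap eX eY) (~: (w |: B0))) p (last p t')) /\
    (last p t' = w -> exists g : {perm T}, [/\ g \notin B0, g != w, swap eX eY w g &
      connect (induced (swap eX eY) (~: (w |: B0))) p g]).
  elim/last_ind: t' => [|t' g IH'] /=; first by split=> [_|e]; [exact: connect0 | rewrite e eqxx in pw].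
  rewrite rcons_path last_rcons => /andP[/IH'[h1 h2]].
  set g0 := last p t' in h1 h2 *; case/and3P; rewrite !in_setC => g0B gB g0g.
  have [e0|n0] := eqVneq g0 w.
    have [g1 [g1B g1w wg1 pg1]] := h2 e0; rewrite e0 in g0g.
    split=> [gw|eg]; last by exists g1.
    by apply: connect_trans pg1 _; apply: neighbours_connected.
  split=> [gw|eg].
    apply: connect_trans (h1 n0) _; apply: connect1.
    by rewrite /induced !in_setC !in_setU1 !negb_or n0 g0B gw gB.
  exists g0; split=> //; last exact: h1.
  by rewrite swap_sym // -eg.
by rewrite eq; apply: (main t pt).1; rewrite -eq.
Qed.

End LocalConnectivity.

Local Close Scope group_scope.

(** * Transport to the friends-and-strangers graph *)

Lemma set_between (T : finType) (A B : {set T}) m : A \subset B -> #|A| <= m <= #|B| ->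
  exists C : {set T}, [/\ A \subset C, C \subset B & #|C| = m].
Proof.
move=> sAB /andP[hA hB]; exists (A :|: [set x in take (m - #|A|) (enum (B :\: A))]); split.
- exact: subsetUl.
- rewrite subUset sAB; apply/subsetP=> x; rewrite inE => /mem_take.
  by rewrite mem_enum inE => /andP[].
have sz : size (take (m - #|A|) (enum (B :\: A))) = m - #|A|.
  by rewrite size_take -cardE cardsD (setIidPr sAB); case: ltngtP (leq_sub2r #|A| hB).
rewrite cardsU (_ : _ :&: _ = set0) ?cards0 ?subn0.
  by rewrite cardsE (card_uniqP _) ?take_uniq ?enum_uniq // sz subnKC.
apply/setP=> x; rewrite !inE; apply/negP=> /andP[xA /mem_take].
by rewrite mem_enum inE xA.
Qed.

(** A set of fewer than [k] vertices is enlarged to one of exactly [k - 1] vertices which still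
misses the two vertices to be joined. *)
Lemma s_connected_kconn (G : sgraph) k : 0 < k -> s_connected G k -> kconn (@edge G) k setT.
Proof.
case: k => // k _ /andP[hk /forallP hS]; split; first by rewrite cardsT.
move=> S Sk x y; rewrite !inE !andbT => xS yS; have [->|xy] := eqVneq x y; first exact: connect0.
have [||C [sSC sC cC]] := @set_between _ S (~: [set x; y]) k.
- by apply/subsetP=> z zS; rewrite !inE negb_or; apply/andP; split; apply: contraTneq zS => ->.
- rewrite -ltnS Sk /= -(leq_add2l #|[set x; y]|) cardsC cards2 xy addnC addn2.
  exact: leq_trans hk.
have [xC yC] : x \notin C /\ y \notin C.
  by split; apply/negP=> /(subsetP sC); rewrite !inE eqxx ?orbT.
have /implyP := hS C; rewrite cC => /(_ (eqxx _)) /forallP /(_ (exist _ x xC)) /forallP /(_ (exist _ y yC)).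
apply: (@connect_homo _ _ _ _ val) => u v uv; apply: connect1; rewrite /induced !inE !andbT.
apply/and3P; split; last exact: uv.
  by apply: contra (valP u); apply: (subsetP sSC).
by apply: contra (valP v); apply: (subsetP sSC).
Qed.

(** The maximum over an empty range is 0, so a positive connectivity is attained. *)
Lemma kconn_kappa (G : sgraph) k : 0 < k <= kappa G -> kconn (@edge G) k setT.
Proof.
case/andP=> k0 hk; have hk0 : 0 < kappa G by apply: leq_trans hk.
apply: (kconnW hk).
apply: s_connected_kconn => //.
suff [e|//] : kappa G = 0 \/ s_connected G (kappa G) by rewrite e in hk0.
rewrite /kappa; elim/big_ind: _ => [|m1 m2 h1 h2|i hi]; [by left| |by right].
by rewrite /maxn; case: ifP.
Qed.

Lemma kconn_image (T1 T2 : finType) (e : rel T2) (f : T1 -> T2) k : bijective f ->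
  kconn e k setT -> kconn (fun x y => e (f x) (f y)) k setT.
Proof.
case=> g fK gK [hk hc]; have finj := can_inj fK; split.
  by rewrite cardsT (bij_eq_card (Bijective fK gK)) -cardsT.
move=> S hS x y; rewrite !inE !andbT => xS yS.
have imS z : (f z \in f @: S) = (z \in S) by apply: mem_imset.
have := hc (f @: S) _ (f x) (f y); rewrite card_imset // !inE !andbT !imS => /(_ hS xS yS) h.
rewrite -(fK x) -(fK y); apply: connect_homo h => u v /and3P[uS vS uv]; apply: connect1.
by move: uS vS; rewrite /induced !inE !andbT -{1}(gK u) -{1}(gK v) !imS !gK => -> ->.
Qed.

Lemma exists_bijection (T1 T2 : finType) : #|T1| = #|T2| -> exists f : T1 -> T2, bijective f.
Proof.
move=> e; exists (fun x => enum_val (cast_ord e (enum_rank x))).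
exists (fun y => enum_val (cast_ord (esym e) (enum_rank y))) => x.
  by rewrite enum_valK cast_ordK enum_rankK.
by rewrite enum_valK cast_ordKV enum_rankK.
Qed.

Section Transport.
Variables (X Y : sgraph) (f : X -> Y).
Hypothesis f_bij : bijective f.
Let eX : rel X := @edge X.
Let eY : rel X := fun x y => edge (f x) (f y).
Implicit Types p q : {perm X}.

Lemma bip_graph (G : sgraph) : bip (@edge G) setT -> bipartite G.
Proof. by case/bipP=> c hc; exists c => x y; apply: hc; rewrite inE. Qed.

Lemma bip_image : bip eY setT -> bipartite Y.
Proof.
case: f_bij => g fK gK /bipP[c hc]; exists (fun y => c (g y)) => x y xy.
by apply: hc; rewrite ?inE // /eY !gK.
Qed.

Lemma exact_cycle_iso : exact_cycle (induced eY setT) setT -> isomorphic Y (cycle_graph #|Y|).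
Proof.
case: f_bij => g fK gK [Z [UZ Z3 VZ hE]].
have szZ : size Z = #|Y|.
  rewrite -(bij_eq_card f_bij) -cardsT -(card_uniqP UZ); apply: eq_card => x; by rewrite VZ.
have inZ y : index (g y) Z < #|Y| by rewrite -szZ index_mem -VZ inE.
pose F y : cycle_graph #|Y| := Ordinal (inZ y); exists F.
have gE y1 y2 : (index (g y1) Z == index (g y2) Z) = (y1 == y2).
  apply/eqP/eqP=> [e|-> //]; apply: (can_inj gK).
  by rewrite -(nth_index (g y1) (s := Z) (x := g y1)) -?VZ ?inE // e nth_index // -VZ inE.
have Finj : injective F by move=> y1 y2 /(congr1 val) /= /eqP; rewrite gE => /eqP.
split; first by apply: inj_card_bij Finj _; rewrite card_ord.
have nextE y : index (next Z (g y)) Z = (index (g y) Z).+1 %% #|Y|.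
  have gyZ : g y \in Z by rewrite -VZ inE.
  have := congr1 (fun s => index (nth (g y) s (index (g y) Z)) Z) (map_next UZ).
  rewrite (nth_map (g y)) ?index_mem // nth_index // => ->.
  case: Z UZ Z3 VZ hE szZ inZ @F gE Finj gyZ => // z0 Z UZ Z3 VZ hE szZ inZ F gE Finj gyZ.
  rewrite rot1_cons nth_rcons -szZ; have := inZ y; rewrite -szZ /= ltnS.
  set i := index _ _; case: ltngtP => // [iZ _|-> _]; last by rewrite /= eqxx modnn.
  rewrite modn_small ?ltnS //; case/andP: UZ => z0Z UZ; rewrite /= index_uniq //.
  by case: eqP => // e; rewrite e mem_nth in z0Z.
move=> y1 y2; have [->|ne] := eqVneq y1 y2; first by rewrite !edge_irr.
have -> : edge y1 y2 = induced eY setT (g y1) (g y2) by rewrite /induced !inE /eY !gK.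
have idxE a b : (index a Z == index b Z) = (a == b).
  by have := gE (f a) (f b); rewrite !fK (can_eq fK).
rewrite hE -?VZ ?inE // /edge /= /cycle_edge -(inj_eq val_inj) /= gE ne /=.
by rewrite -!nextE !idxE.
Qed.

Lemma exact_theta0_iso : exact_theta0 (induced eY setT) setT -> isomorphic Y theta0.
Proof.
case: f_bij => g fK gK [u [L [UL L7 VL hE]]].
pose ord6 (i : nat) (h : i < 6) : option 'I_6 := Some (Ordinal h).
(* the 6-cycle is u a1 a2 v b2 b1 *)
pose h (i : nat) : option 'I_6 := nth None
  [:: @ord6 0 isT; @ord6 3 isT; @ord6 1 isT; @ord6 2 isT; @ord6 5 isT; @ord6 4 isT; None] i.
have hinj i j : i < 7 -> j < 7 -> h i = h j -> i = j.
  by case: i => [|[|[|[|[|[|[|i]]]]]]] // _; case: j => [|[|[|[|[|[|[|j]]]]]]].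
have hadj i j : i < 7 -> j < 7 -> theta0_edge (h i) (h j) = theta0_adj i j.
  by case: i => [|[|[|[|[|[|[|i]]]]]]] // _; case: j => [|[|[|[|[|[|[|j]]]]]]] // _; vm_compute.
have inL y : index (g y) L < 7 by rewrite -L7 index_mem -VL inE.
pose F y : theta0 := h (index (g y) L); exists F.
have Finj : injective F.
  move=> y1 y2 /(hinj _ _ (inL y1) (inL y2)) e; apply: (can_inj gK).
  by rewrite -(nth_index u (s := L) (x := g y1)) -?VL ?inE // e nth_index // -VL inE.
split.
  apply: inj_card_bij Finj _; rewrite card_option card_ord -L7 -(card_uniqP UL).
  by rewrite -(bij_eq_card f_bij); apply: max_card.
move=> y1 y2; rewrite /edge /= hadj // -hE // !nth_index -?VL ?inE //.
by rewrite /induced !inE /eY !gK.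
Qed.

Fact state_bijb p : bijb [ffun x => f (p x)].
Proof.
apply/andP; split.
  by apply/injectiveP=> x y; rewrite !ffunE => /(bij_inj f_bij)/perm_inj.
case: f_bij => g fK gK; apply/forallP=> y; apply/existsP; exists (p^-1%g (g y)).
by rewrite ffunE permKV gK.
Qed.

Definition state p : FS X Y := exist _ [ffun x => f (p x)] (state_bijb p).

Lemma state_inj : injective state.
Proof.
move=> p q /(congr1 val) /ffunP e; apply/permP=> x; have := e x.
by rewrite !ffunE => /(bij_inj f_bij).
Qed.

Lemma state_surj u : exists p, state p = u.
Proof.
case: u => h hb; have /andP[/injectiveP hinj _] := hb; case: (f_bij) => g fK gK.
have inj : injective (fun x => g (h x)) by move=> x y /(can_inj gK)/hinj.
by exists (perm inj); apply: val_inj; apply/ffunP=> x; rewrite !ffunE permE gK.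
Qed.

Lemma swap_state p q : swap eX eY p q -> FS_edge (state p) (state q).
Proof.
case/swapP=> a [b [ab pab ->]]; apply/existsP; exists a; apply/existsP; exists b.
rewrite /= !ffunE !permM tpermL tpermR !eqxx (ab : edge a b) (pab : edge (f (p a)) (f (p b))).
apply/andP; split; first by apply: contraTneq ab => ->; rewrite /eX edge_irr.
apply/forallP=> d; apply/implyP=> /andP[da db].
by rewrite !ffunE permM tpermD 1?eq_sym.
Qed.

Lemma FS_s_connected s : s < #|X| ->
  (forall B : {set {perm X}}, #|B| < s -> conn (swap eX eY) (~: B)) -> s_connected (FS X Y) s.
Proof.
move=> sX hB; apply/andP; split.
  apply: leq_trans sX _; have [x0|no] := pickP (@predT X); last by rewrite eq_card0.
  have inj : injective (fun x => state (tperm x0 x)).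
    by move=> x y /state_inj/permP/(_ x0); rewrite !tpermL.
  by move=> _; apply: (leq_card _ inj).
apply/forallP=> S; apply/implyP=> /eqP cS.
pose B := state @^-1: S.
have cB : #|B| < s.
  rewrite -cS ltnS -(card_imset _ state_inj); apply: subset_leq_card.
  by apply/subsetP=> _ /imsetP[p + ->]; rewrite inE.
apply/forallP=> u; apply/forallP=> v.
have [p ep] := state_surj (val u); have [q eq] := state_surj (val v).
have pB : p \in ~: B by rewrite !inE ep; apply: valP u.
have qB : q \in ~: B by rewrite !inE eq; apply: valP v.
pose F p : del S := insubd u (state p).
have FE p' : p' \in ~: B -> val (F p') = state p'.
  by rewrite !inE => h; rewrite /F insubdK.
have -> : u = F p by apply: val_inj; rewrite FE // ep.
have -> : v = F q by apply: val_inj; rewrite FE // eq.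
apply: connect_homo (hB B cB p q pB qB) => p1 p2 /and3P[h1 h2 h12]; apply: connect1.
by rewrite /edge /= /del_edge !FE //; apply: swap_state.
Qed.

End Transport.

Theorem theorem1p7 (s n : nat) (X Y : sgraph)
  (s_ge2 : 2 <= s)
  (oX : #|X| = n) (oY : #|Y| = n)
  (cX : connected X) (cY : connected Y)
  (nonbip : ~ bipartite X \/ ~ bipartite Y)
  (Y_not_cycle : ~ isomorphic Y (cycle_graph n))
  (Y_not_theta0 : ~ isomorphic Y theta0)
  (hdeg : n + s - 1 <= max_degree X + kappa Y) :
  s_connected (FS X Y) s.
Proof.
have [f f_bij] : exists f : X -> Y, bijective f by apply: exists_bijection; rewrite oX.
pose eX : rel X := @edge X; pose eY : rel X := fun x y => edge (f x) (f y).
have X_sym : symmetric eX := @edge_sym X.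
have X_irr : irreflexive eX := @edge_irr X.
have Y_sym : symmetric eY by move=> x y; apply: edge_sym.
have Y_irr : irreflexive eY by move=> x; apply: edge_irr.
have n0 : 0 < n.
  rewrite lt0n; apply/eqP=> n0.
  have : kappa Y = 0 by rewrite /kappa big1 // => i; case: i => i /=; rewrite oY n0.
  have : max_degree X = 0 by rewrite /max_degree big1 // => i; have := fintype0 i; rewrite oX n0 => /(_ erefl).
  by move=> h1 h2; move: hdeg; rewrite h1 h2 n0 leqn0 subn_eq0 leqNgt s_ge2.
have [c ec] : {c : X | max_degree X = #|[set y | eX c y]|} by apply: eq_bigmax; rewrite oX.
set N := [set y | eX c y] in ec.
have cN : c \notin N by rewrite inE X_irr.
set r := #|~: (c |: N)|.
have cr : (#|N|).+1 + r = n by rewrite /r -oX -(cardsC (c |: N)) cardsU1 cN.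
have hk : r + s <= kappa Y.
  rewrite -(leq_add2l #|N|) -ec; apply: leq_trans hdeg.
  by rewrite -cr addSn addSn subn1 /= ec addnA.
have kY : kconn eY (r + s) setT.
  by apply: kconn_image f_bij _; apply: kconn_kappa; rewrite hk addn_gt0 (ltnW s_ge2) orbT.
have kY2 : kconn eY (r + 2) setT by apply: kconnW kY; rewrite leq_add2l.
have cX' x : connect eX c x by move/forallP: cX => /(_ c) /forallP; apply.
have sX : s < #|X| by case: kY => h _; rewrite cardsT in h; apply: leq_ltn_trans h; apply: leq_addl.
(* with no position to delete, the exceptions to the theorem of Wilson are those of the statement *)
have mob0 : r = 0 -> mobile eY setT.
  move=> r0; rewrite r0 in kY2; have [//|[ex|ex]] := wilson_induced Y_sym Y_irr kY2.
    by case: Y_not_cycle; rewrite -oY; apply: exact_cycle_iso ex.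
  by case: Y_not_theta0; apply: exact_theta0_iso ex.
have reachable p q : reach eX eY p q.
  have [bY|nbY] := boolP (bip eY setT).
    apply: (reach_bip X_irr Y_sym Y_irr kY2 (erefl r) cX') => //.
    - move=> U cU; case er: r cU => [|r'] cU.
        by move/eqP: cU; rewrite cards_eq0 => /eqP->; rewrite setC0; apply: mob0.
      rewrite -setTD; rewrite er in kY2; apply: bip_mobile kY2 _ cU bY => //; exact: subsetT.
    - apply/negP=> bX; case: nonbip => h; apply: h; first exact: bip_graph.
      exact: bip_image f_bij bY.
    have [z cz] : exists z, z \in nbhd eY setT c.
      apply/card_gt0P; apply: leq_trans (min_degree Y_irr kY2 (in_setT c)).
      by rewrite addn2.
    by exists c, z; move: cz; rewrite !inE.
  case er: r => [|r'].
    apply: (@reach_nonbip _ _ _ X_irr Y_sym Y_irr c r kY2 (erefl r) cX' set0).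
    - by rewrite cards0 er.
    - by rewrite setC0; apply: mob0.
    - by rewrite setC0.
  rewrite er in kY2.
  have [U [_ cU h1 h2]] := nonbip_mobile_deletions Y_sym Y_irr kY2 nbY.
  by rewrite setTD in h1 h2; apply: (reach_nonbip X_irr Y_sym Y_irr kY2 er cX' cU).
apply: (FS_s_connected f_bij sX) => B hB.
exact: (swap_kconn X_sym X_irr Y_sym Y_irr kY (erefl r) reachable hB).
Qed.
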